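(* Let $\Gamma=((V,E),m)$ be an EAFC system with $V$ finite, and let $G=G_\Gamma$. There exists a normal subgroup $G_0$ of $G$ of finite index $[G:G_0]\leq \prod_{e\in E}\frac{m(e)}{2}$ such that for every subgroup $H\leqslant G$ one of the following holds: (a) $H$ is isomorphic to a subgroup of $\mathbb{Z}^s\times K^t$ for some non-negative integers $s,t$ with $s+2t\leq |V|$, and $H\cap G_0$ is free abelian; or (b) $H\cap G_0$ maps onto a non-abelian free group. In particular, every subgroup of $G$ is either large or virtually abelian.
   Context: An Artin–Tits system $\Gamma=((V,E),m)$ consists of a simplicial graph $(V,E)$ (with $V\neq\emptyset$, $E\subseteq\{\{u,v\}: u,v\in V, u\neq v\}$) and a labelling $m\colon E\to\{2,3,\dots\}$. The associated Artin–Tits group is $G_\Gamma=\langle V \mid \mathrm{prod}(u,v,m(\{u,v\}))=\mathrm{prod}(v,u,m(\{u,v\}))\ \forall \{u,v\}\in E\rangle$, where $\mathrm{prod}(u,v,n)$ is the prefix of length $n$ of the infinite alternating word $uvuv\cdots$. The system is even if $m(E)\subseteq 2\mathbb{N}$. An EAFC system is an even Artin–Tits system such that for any three pairwise adjacent vertices, at least two of the three edges between them have label $2$. $K$ denotes the Klein bottle group $\langle x,y\mid x^2=y^2\rangle$. A group is large if it has a finite index subgroup mapping onto the free group $\mathbb{F}_2$ of rank 2. *)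

(* Defs.v *)
From Stdlib Require List.
From mathcomp Require Import all_boot ssralg ssrint.
Set Implicit Arguments. Unset Strict Implicit. Unset Printing Implicit Defensive.
Import GRing.Theory.

Record sgroup := SGroup {
  gcar :> Type;
  geq : gcar -> gcar -> Prop;
  gmul : gcar -> gcar -> gcar;
  ginv : gcar -> gcar;
  gone : gcar;
  geq_refl : forall x, geq x x;
  geq_sym : forall x y, geq x y -> geq y x;
  geq_trans : forall x y z, geq x y -> geq y z -> geq x z;
  gmul_compat : forall x x' y y', geq x x' -> geq y y' -> geq (gmul x y) (gmul x' y');
  ginv_compat : forall x x', geq x x' -> geq (ginv x) (ginv x');
  gmulA : forall x y z, geq (gmul x (gmul y z)) (gmul (gmul x y) z);
  gmul1 : forall x, geq (gmul gone x) x;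
  gmulV : forall x, geq (gmul (ginv x) x) gone
}.

Record is_subgroup (G : sgroup) (H : G -> Prop) : Prop := {
  sub_geq : forall x y, geq x y -> H x -> H y;
  sub_one : H (gone G);
  sub_mul : forall x y, H x -> H y -> H (gmul x y);
  sub_inv : forall x, H x -> H (ginv x)
}.

Arguments is_subgroup : clear implicits.

Definition is_normal (G : sgroup) (H : G -> Prop) : Prop :=
  forall g h, H h -> H (gmul (gmul g h) (ginv g)).

Definition index_le (G : sgroup) (H : G -> Prop) (N : nat) : Prop :=
  exists reps : seq (gcar G), size reps <= N /\
    forall g : G, exists r, List.In r reps /\ H (gmul (ginv r) g).

Arguments is_normal : clear implicits.
Arguments index_le : clear implicits.

Definition finite_index (G : sgroup) (H : G -> Prop) : Prop :=
  exists N, index_le G H N.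

Arguments finite_index : clear implicits.

Definition is_abelian (G : sgroup) : Prop :=
  forall x y : G, geq (gmul x y) (gmul y x).

Section SubGroup.
Variables (G : sgroup) (H : G -> Prop) (hH : is_subgroup G H).
Definition sub_car := {x : G | H x}.
Definition sub_geq' (x y : sub_car) := geq (proj1_sig x) (proj1_sig y).
Definition sub_mul' (x y : sub_car) : sub_car :=
  exist _ (gmul (proj1_sig x) (proj1_sig y)) (sub_mul hH (proj2_sig x) (proj2_sig y)).
Definition sub_inv' (x : sub_car) : sub_car :=
  exist _ (ginv (proj1_sig x)) (sub_inv hH (proj2_sig x)).
Definition sub_one' : sub_car := exist _ (gone G) (sub_one hH).
Definition sub_sgroup : sgroup :=
  @SGroup sub_car sub_geq' sub_mul' sub_inv' sub_one'
    (fun x => geq_refl (proj1_sig x))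
    (fun x y => @geq_sym G (proj1_sig x) (proj1_sig y))
    (fun x y z => @geq_trans G (proj1_sig x) (proj1_sig y) (proj1_sig z))
    (fun x x' y y' => @gmul_compat G (proj1_sig x) (proj1_sig x') (proj1_sig y) (proj1_sig y'))
    (fun x x' => @ginv_compat G (proj1_sig x) (proj1_sig x'))
    (fun x y z => @gmulA G (proj1_sig x) (proj1_sig y) (proj1_sig z))
    (fun x => @gmul1 G (proj1_sig x))
    (fun x => @gmulV G (proj1_sig x)).
End SubGroup.

Lemma is_subgroupI (G : sgroup) (H K : G -> Prop) :
  is_subgroup G H -> is_subgroup G K -> is_subgroup G (fun x => H x /\ K x).
Proof.
move=> [h1 h2 h3 h4] [k1 k2 k3 k4]; split.
- by move=> x y e [? ?]; split; [apply: h1 e _|apply: k1 e _].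
- by split.
- by move=> x y [? ?] [? ?]; split; [apply: h3|apply: k3].
- by move=> x [? ?]; split; [apply: h4|apply: k4].
Qed.

Record is_hom (G H : sgroup) (f : G -> H) : Prop := {
  hom_compat : forall x y, geq x y -> geq (f x) (f y);
  hom_mul : forall x y, geq (f (gmul x y)) (gmul (f x) (f y))
}.
Definition hom_injective (G H : sgroup) (f : G -> H) : Prop :=
  forall x y, geq (f x) (f y) -> geq x y.
Definition hom_surjective (G H : sgroup) (f : G -> H) : Prop :=
  forall y, exists x, geq (f x) y.

(* A word is a list of letters (x, true) = x, (x, false) = x^-1.      *)
Definition word (X : Type) := seq (X * bool).
Definition winv (X : Type) (w : word X) : word X :=
  rev (map (fun p => (p.1, ~~ p.2)) w).

Inductive pres_eq (X : Type) (R : word X -> word X -> Prop) : word X -> word X -> Prop :=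
  | pe_refl w : pres_eq R w w
  | pe_sym u v : pres_eq R u v -> pres_eq R v u
  | pe_trans u v w : pres_eq R u v -> pres_eq R v w -> pres_eq R u w
  | pe_free u v x b : pres_eq R (u ++ [:: (x, b); (x, ~~ b)] ++ v) (u ++ v)
  | pe_rel u v l r : R l r -> pres_eq R (u ++ l ++ v) (u ++ r ++ v).

Section Pres.
Variables (X : Type) (R : word X -> word X -> Prop).

Lemma pe_catl c a b : pres_eq R a b -> pres_eq R (c ++ a) (c ++ b).
Proof.
elim=> [w|u v _ IH|u v w _ IH1 _ IH2|u v x b'|u v l r Hr].
- exact: pe_refl.
- exact: pe_sym.
- exact: pe_trans IH1 IH2.
- by have := pe_free R (c ++ u) v x b'; rewrite -!catA.
- by have := pe_rel (c ++ u) v Hr; rewrite -!catA.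
Qed.

Lemma pe_catr c a b : pres_eq R a b -> pres_eq R (a ++ c) (b ++ c).
Proof.
elim=> [w|u v _ IH|u v w _ IH1 _ IH2|u v x b'|u v l r Hr].
- exact: pe_refl.
- exact: pe_sym.
- exact: pe_trans IH1 IH2.
- by have := pe_free R u (v ++ c) x b'; rewrite -!catA.
- by have := pe_rel u (v ++ c) Hr; rewrite -!catA.
Qed.

Lemma pe_cat a a' b b' : pres_eq R a a' -> pres_eq R b b' ->
  pres_eq R (a ++ b) (a' ++ b').
Proof. by move=> Ha Hb; apply: pe_trans (pe_catr _ Ha) (pe_catl _ Hb). Qed.

Lemma pe_winvl w : pres_eq R (winv w ++ w) [::].
Proof.
elim: w => [|[x b] w IH]; first exact: pe_refl.
rewrite /winv /= rev_cons -cats1 -/(winv w) -catA.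
apply: pe_trans (IH); apply: pe_catl.
have -> : [:: (x, ~~ b)] ++ (x, b) :: w = [::] ++ [:: (x, ~~ b); (x, ~~ ~~ b)] ++ w
  by rewrite negbK.
exact: pe_free.
Qed.

Lemma pe_winvr w : pres_eq R (w ++ winv w) [::].
Proof.
elim: w => [|[x b] w IH]; first exact: pe_refl.
rewrite /winv /= rev_cons -cats1 -/(winv w).
apply: pe_trans (_ : pres_eq R ([:: (x, b)] ++ [:: (x, ~~ b)]) [::]).
  have -> : (x, b) :: w ++ winv w ++ [:: (x, ~~ b)]
    = [:: (x, b)] ++ (w ++ winv w) ++ [:: (x, ~~ b)] by rewrite /= catA.
  apply: pe_catl; rewrite -{2}(cat0s [:: (x, ~~ b)]); exact: pe_catr IH.
exact: (@pe_free X R [::] [::] x b).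
Qed.

Lemma pe_winv a b : pres_eq R a b -> pres_eq R (winv a) (winv b).
Proof.
move=> Hab.
apply: pe_trans (_ : pres_eq R (winv a) (winv a ++ b ++ winv b)) _.
  apply: pe_sym; rewrite -{2}(cats0 (winv a)); apply: pe_catl; exact: pe_winvr.
rewrite catA; rewrite -{2}(cat0s (winv b)); apply: pe_catr.
apply: pe_trans (pe_catl _ (pe_sym Hab)) _; exact: pe_winvl.
Qed.

Definition pres_group : sgroup :=
  @SGroup (word X) (pres_eq R) (@cat _) (@winv X) [::]
    (@pe_refl X R) (@pe_sym X R) (@pe_trans X R)
    (fun a a' b b' => @pe_cat a a' b b')
    (@pe_winv)
    (fun x y z => eq_ind_r (fun t => pres_eq R t _) (pe_refl R _) (catA x y z))
    (@pe_refl X R)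
    pe_winvl.
End Pres.

Definition free_group (X : Type) : sgroup := pres_group (fun _ _ : word X => False).
Definition free_abelian_group (X : Type) : sgroup :=
  pres_group (fun l r : word X =>
    exists x y : X, l = [:: (x, true); (y, true)] /\ r = [:: (y, true); (x, true)]).

Definition is_free_abelian (G : sgroup) : Prop :=
  exists (X : Type) (f : G -> free_abelian_group X),
    is_hom f /\ hom_injective f /\ hom_surjective f.

(* Klein bottle group K = <x, y | x^2 = y^2>, x := true, y := false. *)
Definition klein_group : sgroup :=
  pres_group (fun l r : word bool =>
    l = [:: (true, true); (true, true)] /\ r = [:: (false, true); (false, true)]).

Definition Zgroup : sgroup :=
  @SGroup int (@eq int) (fun a b => a + b)%R (fun a => - a)%R 0%R
    (@erefl int) (@esym int) (@etrans int)
    (fun x x' y y' (e1 : x = x') (e2 : y = y') => f_equal2 (fun a b => a + b)%R e1 e2)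
    (fun x x' (e : x = x') => f_equal (fun a => - a)%R e)
    (fun x y z => addrA x y z)
    (fun x => add0r x)
    (fun x => addNr x).

Section Products.
Variables (G H : sgroup).
Definition pow_group (n : nat) : sgroup :=
  @SGroup ('I_n -> G) (fun f g => forall i, geq (f i) (g i))
    (fun f g i => gmul (f i) (g i)) (fun f i => ginv (f i)) (fun _ => gone G)
    (fun f i => geq_refl (f i))
    (fun f g e i => geq_sym (e i))
    (fun f g h e1 e2 i => geq_trans (e1 i) (e2 i))
    (fun f f' g g' e1 e2 i => gmul_compat (e1 i) (e2 i))
    (fun f f' e i => ginv_compat (e i))
    (fun f g h i => gmulA (f i) (g i) (h i))
    (fun f i => gmul1 (f i))
    (fun f i => gmulV (f i)).
Definition prod_group : sgroup :=
  @SGroup (G * H) (fun p q => geq p.1 q.1 /\ geq p.2 q.2)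
    (fun p q => (gmul p.1 q.1, gmul p.2 q.2)) (fun p => (ginv p.1, ginv p.2))
    (gone G, gone H)
    (fun p => conj (geq_refl p.1) (geq_refl p.2))
    (fun p q e => conj (geq_sym (proj1 e)) (geq_sym (proj2 e)))
    (fun p q r e1 e2 => conj (geq_trans (proj1 e1) (proj1 e2)) (geq_trans (proj2 e1) (proj2 e2)))
    (fun p p' q q' e1 e2 => conj (gmul_compat (proj1 e1) (proj1 e2)) (gmul_compat (proj2 e1) (proj2 e2)))
    (fun p p' e => conj (ginv_compat (proj1 e)) (ginv_compat (proj2 e)))
    (fun p q r => conj (gmulA p.1 q.1 r.1) (gmulA p.2 q.2 r.2))
    (fun p => conj (gmul1 p.1) (gmul1 p.2))
    (fun p => conj (gmulV p.1) (gmulV p.2)).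
End Products.

Definition ZK_group (s t : nat) : sgroup :=
  prod_group (pow_group Zgroup s) (pow_group klein_group t).

Definition is_large (G : sgroup) : Prop :=
  exists (H : G -> Prop) (hH : is_subgroup G H), finite_index G H /\
    exists f : sub_sgroup hH -> free_group bool, is_hom f /\ hom_surjective f.

Definition is_virtually_abelian (G : sgroup) : Prop :=
  exists (H : G -> Prop) (hH : is_subgroup G H), finite_index G H /\
    is_abelian (sub_sgroup hH).

(* The labelled graph is encoded by m : V -> V -> nat with             *)
(* m u v = 0 meaning {u,v} is not an edge, and m u v = label otherwise *)
(* (symmetric, m u u = 0, labels >= 2).                                *)
Definition alt_word (V : Type) (u v : V) (n : nat) : word V :=
  mkseq (fun i => (if odd i then v else u, true)) n.

Definition artin_rel (V : Type) (m : V -> V -> nat) (l r : word V) : Prop :=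
  exists u v, m u v <> 0 /\ l = alt_word u v (m u v) /\ r = alt_word v u (m u v).

Definition artin_group (V : Type) (m : V -> V -> nat) : sgroup :=
  pres_group (artin_rel m).

Definition is_AT_system (V : Type) (m : V -> V -> nat) : Prop :=
  (forall u v, m u v = m v u) /\ (forall u, m u u = 0) /\
  (forall u v, m u v <> 1).

Definition is_EAFC (V : Type) (m : V -> V -> nat) : Prop :=
  is_AT_system m /\ (forall u v, ~~ odd (m u v)) /\
  (forall u v w, m u v <> 0 -> m v w <> 0 -> m u w <> 0 ->
     2 <= (m u v == 2) + (m v w == 2) + (m u w == 2)).

(* prod_{e in E} m(e)/2, each unordered edge counted once. *)
Definition edge_half_prod (V : finType) (m : V -> V -> nat) : nat :=
  \prod_(u : V) \prod_(v : V | (enum_rank u < enum_rank v)%N && (m u v != 0))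
     (m u v)./2.

(* Main.v *)
From HB Require Import structures.
From mathcomp Require Import all_boot all_order all_algebra.
From mathcomp Require Import boolp.
From mathcomp Require Import zify.
Require Import Defs.
Set Implicit Arguments. Unset Strict Implicit. Unset Printing Implicit Defensive.
Import Order.TTheory GRing.Theory Num.Theory.
Local Open Scope group_scope.

(* For nonadjacent u, v in S the parabolic subgroup G_S is the amalgam of
   G_(S - u) and G_(S - v) over G_(S - u - v), and evenness gives retractions
   of G onto all parabolic subgroups. A subgroup H of such a group acts on the
   Bass-Serre tree. If it has a homomorphism to Z^n that is injective on vertex
   stabilizers, and edge stabilizers are root-closed, then either H is abelian
   or H has a homomorphism to a free group with noncommuting images: two
   elliptic elements a, b without common fixed point, taken as close as
   possible, are sent to t^i and w t^j w^-1 by relabelling the tree through a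
   character Z^n -> Z, and if there is no such pair then the elliptic elements
   are central and the commutators vanish. By the Nielsen-Schreier theorem the
   image is then a non-abelian free group.

   Splitting along nonadjacent pairs reduces everything to complete graphs,
   hence, by the EAFC condition, to direct products of copies of Z and of
   dihedral Artin groups, the latter being semidirect products of the free
   group on Z/k with Z, which shifts the basis. A first induction of this kind
   shows that two elements with a common power and the same projections to all
   G_{x, y} are equal, so that parabolic subgroups are root-closed in G. A
   second one gives the alternative for subgroups of G_0, the group of all g
   such that, for every edge {x, y} with x < y, m(x, y)/2 divides the exponent
   sum of x in g: in a dihedral factor the Z-part of such a g acts trivially on
   the free part. A third one embeds H in Z^s x K^t when H meets G_0 in an
   abelian group; Klein bottle groups only arise from the dihedral factors. *)

(** * Subgroups, partial homomorphisms and integer powers *)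

(** That an amalgam acts on a tree is encoded by a crossed homomorphism from the group to the free
    group on the edges. It is the first coordinate of a homomorphism to a semidirect product, which
    the presentation supplies directly, so no normal form theorem for amalgams enters. The obstacle
    is that the word of edge orbits read along a geodesic may cancel. A cancellation always yields
    some h in H that fixes a vertex and moves an adjacent edge; each argument is arranged to exclude
    this h or to exploit it: by minimality of a pair, by freeness, or by commutation through [gate].
    Root-closed edge stabilizers allow passing from a power of an element to the element. The
    embedding theorem is stated for subgroups whose k-th powers commute, a condition that passes to
    images under retractions. Applied to abelian subgroups it supplies the integer coordinates that
    the alternative requires on vertex stabilizers, hence it comes first. Elements with a common
    power may differ, such as xy and yx in a dihedral factor with label at least 4; this is why
    uniqueness of roots prescribes the projections to all pairs. *)

Section Subgroups.
Variable G : groupType.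
Implicit Types (H K : G -> Prop) (x y : G).

Record subgrp H : Prop := Subgrp {
  subgrp1 : H 1;
  subgrpM : forall x y, H x -> H y -> H (x * y);
  subgrpV : forall x, H x -> H x^-1 }.

Lemma subgrpX H x n : subgrp H -> H x -> H (x ^+ n).
Proof.
move=> hH Hx; elim: n => [|n IH]; first by rewrite expg0; apply: subgrp1.
by rewrite expgS; apply: subgrpM.
Qed.

Lemma subgrpXV H x n : subgrp H -> H x -> H (x ^- n).
Proof. by move=> hH Hx; apply: subgrpV => //; apply: subgrpX. Qed.

Lemma subgrpF H x y : subgrp H -> H x -> H y -> H (x / y).
Proof. by move=> hH Hx Hy; apply: subgrpM => //; apply: subgrpV. Qed.

Lemma subgrpJ H x y : subgrp H -> H x -> H y -> H (x ^ y).
Proof. by move=> hH Hx Hy; rewrite conjgE; do ?apply: subgrpM => //; apply: subgrpV. Qed.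

Lemma subgrpT : subgrp (fun=> True).
Proof. by []. Qed.

Definition abelian_on H := forall x y, H x -> H y -> commute x y.

Definition generated (P : G -> Prop) : G -> Prop :=
  fun x => forall K, subgrp K -> (forall y, P y -> K y) -> K x.

Lemma generated_subgrp P : subgrp (generated P).
Proof.
split=> [K hK _|x y hx hy K hK PK|x hx K hK PK]; first exact: subgrp1.
- by apply: subgrpM => //; [apply: hx|apply: hy].
- by apply: subgrpV => //; apply: hx.
Qed.

Lemma generated_sub P x : P x -> generated P x.
Proof. by move=> Px K _; apply. Qed.

End Subgroups.

Section HomOn.
Variables (G L : groupType).
Implicit Types (H : G -> Prop) (f : G -> L).

(** Maps are total on [G] and multiplicative on [H] only, so subgroups can remain predicates and no
    group structure on a subtype is required. *)
Definition hom_on H f := forall x y, H x -> H y -> f (x * y) = f x * f y.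

Variables (H : G -> Prop) (f : G -> L).
Hypotheses (hH : subgrp H) (hf : hom_on H f).

Lemma hom_on1 : f 1 = 1.
Proof.
have := hf (subgrp1 hH) (subgrp1 hH); rewrite mulg1 => /esym e.
by apply: (mulgI (f 1)); rewrite e mulg1.
Qed.

Lemma hom_onV x : H x -> f x^-1 = (f x)^-1.
Proof.
move=> Hx; apply/esym/mulg1_eq; rewrite -hf ?mulgV ?hom_on1 //.
exact: subgrpV.
Qed.

Lemma hom_onX x n : H x -> f (x ^+ n) = f x ^+ n.
Proof.
move=> Hx; elim: n => [|n IH]; first exact: hom_on1.
by rewrite !expgS hf ?IH //; apply: subgrpX.
Qed.

Lemma hom_onR x y : H x -> H y -> f [~ x, y] = [~ f x, f y].
Proof.
move=> Hx Hy; have Vx := subgrpV hH Hx; have Vy := subgrpV hH Hy.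
rewrite /commg /conjg !hf ?hom_onV //; try exact: subgrpM; exact: subgrpJ.
Qed.

Definition image_on : L -> Prop := fun y => exists2 x, H x & f x = y.

Lemma image_on_subgrp : subgrp image_on.
Proof.
split=> [|_ _ [x Hx <-] [y Hy <-]|_ [x Hx <-]].
- by exists 1; [apply: subgrp1|apply: hom_on1].
- by exists (x * y); [apply: subgrpM|apply: hf].
- by exists x^-1; [apply: subgrpV|apply: hom_onV].
Qed.

End HomOn.

Lemma hom_on_comp (G L M : groupType) (H : G -> Prop) (f : G -> L) (g : L -> M) :
  hom_on H f -> hom_on (image_on H f) g -> hom_on H (g \o f).
Proof. by move=> hf hg x y Hx Hy /=; rewrite hf ?hg //; [exists x|exists y]. Qed.

Section Morphisms.
Variables (G L : groupType) (f : G -> L).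
Hypothesis fM : {morph f : x y / x * y}.

Lemma morph_hom_on (H : G -> Prop) : hom_on H f.
Proof. by move=> x y _ _; apply: fM. Qed.

Lemma morphg1 : f 1 = 1.
Proof. exact: hom_on1 (subgrpT G) (@morph_hom_on _). Qed.

Lemma morphgV x : f x^-1 = (f x)^-1.
Proof. exact: (hom_onV (subgrpT G) (@morph_hom_on _)). Qed.

Lemma morphgX x n : f (x ^+ n) = f x ^+ n.
Proof. exact: (hom_onX (subgrpT G) (@morph_hom_on _)). Qed.

End Morphisms.

Section IntegerPowers.
Variable G : groupType.
Implicit Types (x y : G) (i j : int).

Definition expgz x i := match i with Posz n => x ^+ n | Negz n => x ^- n.+1 end.

Lemma expgzS x i : expgz x (i + 1)%R = expgz x i * x.
Proof.
case: i => [n|[|n]].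
- by rewrite (_ : (Posz n + 1 = Posz n.+1)%R); [rewrite /= expgSr|lia].
- by rewrite (_ : (Negz 0 + 1 = Posz 0)%R); [rewrite /= expg1 mulVg|lia].
- rewrite (_ : (Negz n.+1 + 1 = Negz n)%R); last lia.
  by rewrite /= (expgS x n.+1) invgM mulgVK.
Qed.

Lemma expgzB1 x i : expgz x (i - 1)%R = expgz x i * x^-1.
Proof. by rewrite -[in RHS](subrK 1%R i) expgzS mulgK. Qed.

Lemma expgzD x i j : expgz x (i + j)%R = expgz x i * expgz x j.
Proof.
elim/int_rec: j => [|n IH|n IH]; first by rewrite addr0 mulg1.
- by rewrite -[n.+1]addn1 PoszD addrA !expgzS IH mulgA.
- have -> : (- Posz n.+1 = - Posz n - 1)%R by lia.
  by rewrite addrA !expgzB1 IH mulgA.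
Qed.

Lemma expgzN x i : expgz x (- i)%R = (expgz x i)^-1.
Proof. by apply/esym/mulg1_eq; rewrite -expgzD addrN. Qed.

Lemma expgz1 x : expgz x 1 = x. Proof. by []. Qed.

Lemma expgz1g i : expgz (1 : G) i = 1.
Proof. by case: i => n /=; rewrite ?expg1n ?invg1. Qed.

Lemma commute_expgz x y i : commute x y -> commute x (expgz y i).
Proof. by move=> xy; case: i => n /=; [|apply: commuteV]; apply: commuteX. Qed.

Lemma expgzM x i j : expgz x (i * j)%R = expgz (expgz x i) j.
Proof.
elim/int_rec: j => [|n IH|n IH]; first by rewrite mulr0.
- by rewrite -[n.+1]addn1 PoszD expgzS mulrDr mulr1 expgzD IH.
- have -> : (- Posz n.+1 = - Posz n - 1)%R by lia.
  by rewrite expgzB1 mulrDr mulrN1 expgzD IH (expgzN x i).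
Qed.

Lemma expgzJ x y i : expgz x i ^ y = expgz (x ^ y) i.
Proof. by case: i => n /=; rewrite ?conjVg conjXg. Qed.

Lemma subgrp_expgz (H : G -> Prop) x i : subgrp H -> H x -> H (expgz x i).
Proof. by move=> hH Hx; case: i => n /=; [apply: subgrpX|apply: subgrpXV]. Qed.

Definition cycle_of x : G -> Prop := fun y => exists i, y = expgz x i.

Lemma cycle_of_subgrp x : subgrp (cycle_of x).
Proof.
split=> [|_ _ [i ->] [j ->]|_ [i ->]]; first by exists 0%R.
- by exists (i + j)%R; rewrite expgzD.
- by exists (- i)%R; rewrite expgzN.
Qed.

Lemma cycle_of_id x : cycle_of x x. Proof. by exists 1%R. Qed.

Lemma cycle_of_abelian x : abelian_on (cycle_of x).
Proof. by move=> _ _ [i ->] [j ->]; rewrite /commute -!expgzD addrC. Qed.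

End IntegerPowers.

Lemma hom_on_expgz (G L : groupType) (H : G -> Prop) (f : G -> L) x i :
  subgrp H -> hom_on H f -> H x -> f (expgz x i) = expgz (f x) i.
Proof.
move=> hH hf Hx; case: i => n /=; first exact: hom_onX hf _ _ Hx.
by rewrite (hom_onV hH hf) ?(hom_onX hH hf) //; apply: subgrpX.
Qed.

Lemma morph_expgz (G L : groupType) (f : G -> L) x i :
  {morph f : x y / x * y} -> f (expgz x i) = expgz (f x) i.
Proof. by move=> fM; exact: (hom_on_expgz _ (subgrpT G) (@morph_hom_on _ _ _ fM _)). Qed.

(** A multiplicative copy of Z, so that it can be the target of group homomorphisms: its product is
    addition and its [1] is the integer 0. *)
Definition mint : Type := int.
HB.instance Definition _ := Choice.on mint.
HB.instance Definition _ := isGroup.Build mint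
  (fun i j k : mint => addrA (i : int) j k) (fun i : mint => add0r (i : int))
  (fun i : mint => addr0 (i : int)) (fun i : mint => addNr (i : int))
  (fun i : mint => addrN (i : int)).

Definition mone : mint := 1%R.
Lemma mintM (i j : mint) : i * j = (i + j)%R :> (int). Proof. by []. Qed.
Lemma mintV (i : mint) : i^-1 = (- i)%R :> (int). Proof. by []. Qed.
Lemma mint1 : (1 : mint) = 0%R :> (int). Proof. by []. Qed.
Lemma expgz_mint (i : mint) (n : int) : expgz i n = (i * n)%R :> (int).
Proof.
elim/int_rec: n => [|n IH|n IH]; first by rewrite mulr0.
- by rewrite -[n.+1]addn1 PoszD expgzS mintM IH mulrDr mulr1.
- have -> : (- Posz n.+1 = - Posz n - 1)%R by lia.
  by rewrite expgzB1 mintM IH mulrDr mulrN1.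
Qed.

Lemma expg_mint (i : mint) (n : nat) : i ^+ n = (i * Posz n)%R :> (int).
Proof. exact: (expgz_mint i n). Qed.

Section AbelianGenerated.
Variables (G : groupType) (P : G -> Prop).
Hypothesis P_comm : forall x y, P x -> P y -> commute x y.

Lemma centralizer_subgrp (G' : groupType) (Q : G' -> Prop) :
  subgrp (fun x => forall y, Q y -> commute x y).
Proof.
split=> [y _|x z hx hz y Qy|x hx y Qy]; first exact/commute_sym/commute1.
- by apply/commute_sym/commuteM; apply/commute_sym; [apply: hx|apply: hz].
- by apply/commute_sym/commuteV/commute_sym/hx.
Qed.

(** Centralizers are subgroups, so commutation may be checked on generators in one argument and then
    in the other. *)
Lemma generated_abelian : abelian_on (generated P).
Proof.
move=> x y hx hy; apply: (hx _ (centralizer_subgrp (generated P))) => // z Pz t ht.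
apply/commute_sym; apply: (ht _ (centralizer_subgrp P)) => // t' Pt' z' Pz'.
exact: P_comm.
Qed.

End AbelianGenerated.

Lemma expgz_mone (n : int) : expgz mone n = n.
Proof. by rewrite -[LHS]/(expgz mone n : int) expgz_mint mul1r. Qed.

Lemma expgzMm (G : groupType) (x : G) (i j : mint) :
  expgz x (i * j)%g = expgz x i * expgz x j.
Proof. by rewrite -[(i * j)%g]/(i + j : int)%R expgzD. Qed.

(** * Free groups as reduced words *)

Section FreeGroup.
Variable X : choiceType.
Implicit Types (l : X * bool) (w u v : seq (X * bool)).

Definition linv l : X * bool := (l.1, ~~ l.2).

Lemma linvK : involutive linv.
Proof. by case=> x b; rewrite /linv /= negbK. Qed.

Definition nocancel : rel (X * bool) := fun l l' => l' != linv l.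

Lemma nocancel_linv l l' : nocancel (linv l') (linv l) = nocancel l l'.
Proof. by rewrite /nocancel linvK eq_sym. Qed.

Definition reduced w := sorted nocancel w.

Definition push l w : seq (X * bool) :=
  if w is l' :: w' then if l' == linv l then w' else l :: w else [:: l].

Lemma push_reduced l w : reduced w -> reduced (push l w).
Proof.
case: w => [//|l' w] /= hw; case: ifPn => [_|ne]; first exact: path_sorted hw.
by rewrite /= hw andbT.
Qed.

(** Letters act on reduced words by mutually inverse bijections. This is van der Waerden's argument:
    the product is the action of one word on another, and associativity follows without a confluence
    proof. *)
Lemma pushK l w : reduced w -> push (linv l) (push l w) = w.
Proof.
case: w => [_|l' w] /=; first by rewrite linvK eqxx.
case: ifPn => [/eqP -> |ne hw]; last by rewrite /= linvK eqxx.
case: w => [//|l'' w] /= /andP[].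
by rewrite /nocancel => /negPf ->.
Qed.

Lemma push_cons l w : reduced (l :: w) -> push l w = l :: w.
Proof. by case: w => [//|l' w] /= /andP[/negPf]; rewrite /nocancel => ->. Qed.

Lemma foldr_push_reduced w u : reduced u -> reduced (foldr push u w).
Proof. by elim: w => //= l w IH hu; apply/push_reduced/IH. Qed.

Lemma foldr_push_id w : reduced w -> foldr push [::] w = w.
Proof.
elim: w => //= l w IH hw.
by rewrite IH ?push_cons //; apply: path_sorted hw.
Qed.

Lemma foldr_push_push l w u : reduced w -> reduced u ->
  foldr push u (push l w) = push l (foldr push u w).
Proof.
case: w => [//|l' w] hw hu /=; case: ifPn => [/eqP -> | //].
rewrite -{1}(linvK l) pushK //; exact: foldr_push_reduced.
Qed.

Lemma foldr_pushA w u v : reduced u -> reduced v ->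
  foldr push (foldr push v u) w = foldr push v (foldr push u w).
Proof.
by elim: w => //= l w IH hu hv; rewrite foldr_push_push ?IH //; apply: foldr_push_reduced.
Qed.

Definition invword w := rev (map linv w).

Lemma invwordK : involutive invword.
Proof.
by move=> w; rewrite /invword map_rev revK -map_comp map_id_in // => l _; apply: linvK.
Qed.

Lemma invword_cat w u : invword (w ++ u) = invword u ++ invword w.
Proof. by rewrite /invword map_cat rev_cat. Qed.

Lemma invword_reduced w : reduced w -> reduced (invword w).
Proof.
rewrite /reduced /invword rev_sorted sorted_map; congr is_true.
by apply: eq_sorted => l l' /=; rewrite /relpre /= nocancel_linv.
Qed.

Record free := Free { fword : seq (X * bool); fwordP : reduced fword }.
HB.instance Definition _ := [isSub for fword].
HB.instance Definition _ := [Choice of free by <:].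

Definition free1 := @Free [::] isT.
Definition freeM (f g : free) := Free (foldr_push_reduced (fword f) (fwordP g)).
Definition freeV (f : free) := Free (invword_reduced (fwordP f)).

Fact freeMA : associative freeM.
Proof. by move=> f g h; apply: val_inj; rewrite /= foldr_pushA // fwordP. Qed.
Fact free1M : left_id free1 freeM.
Proof. by move=> f; apply: val_inj. Qed.
Fact freeM1 : right_id free1 freeM.
Proof. by move=> f; apply: val_inj; rewrite /= foldr_push_id ?fwordP. Qed.

Lemma foldr_push_invword w u : reduced u -> foldr push (foldr push u w) (invword w) = u.
Proof.
elim: w u => [//|l w IH] u hu; rewrite /invword /= rev_cons foldr_rcons.
by rewrite pushK ?IH //; apply: foldr_push_reduced.
Qed.

Fact freeVM : left_inverse free1 freeV freeM.
Proof.
move=> f; apply: val_inj => /=.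
by rewrite -{1}(foldr_push_id (fwordP f)) foldr_push_invword.
Qed.
Fact freeMV : right_inverse free1 freeV freeM.
Proof.
move=> f; have := freeVM (freeV f); congr (freeM _ _ = _); apply: val_inj; exact: invwordK.
Qed.
HB.instance Definition _ := isGroup.Build free freeMA free1M freeM1 freeVM freeMV.

Definition fletter l : free := @Free [:: l] isT.
Definition fgen x : free := fletter (x, true).

Lemma fword1 : fword 1 = [::]. Proof. by []. Qed.
Lemma fwordM f g : fword (f * g) = foldr push (fword g) (fword f). Proof. by []. Qed.
Lemma fwordV f : fword f^-1 = invword (fword f). Proof. by []. Qed.
Lemma fword_eq1 f : fword f = [::] -> f = 1.
Proof. by move=> e; apply: val_inj. Qed.

Lemma fletterV l : fletter (linv l) = (fletter l)^-1.
Proof. exact: val_inj. Qed.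

Definition fprod w : free := \prod_(l <- w) fletter l.

Lemma fprod_cons l w : fprod (l :: w) = fletter l * fprod w.
Proof. by rewrite /fprod big_cons. Qed.

Lemma fprod_nil : fprod [::] = 1. Proof. by rewrite /fprod big_nil. Qed.

Lemma fprod_cat w u : fprod (w ++ u) = fprod w * fprod u.
Proof. by rewrite /fprod big_cat. Qed.

Lemma fword_fprod w : fword (fprod w) = foldr push [::] w.
Proof. by elim: w => [|l w IH]; rewrite ?fprod_nil // fprod_cons fwordM IH. Qed.

Lemma fword_reduced w : reduced w -> fword (fprod w) = w.
Proof. by move=> hw; rewrite fword_fprod foldr_push_id. Qed.

Lemma fwordK f : fprod (fword f) = f.
Proof. by apply: val_inj; rewrite /= fword_reduced // fwordP. Qed.

Lemma free_ind (P : free -> Prop) :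
  P 1 -> (forall l f, P f -> P (fletter l * f)) -> forall f, P f.
Proof.
move=> P1 PM f; rewrite -(fwordK f).
by elim: (fword f) => [|l w IH]; rewrite ?fprod_nil // fprod_cons; apply: PM.
Qed.

Section Extension.
Variables (L : groupType) (h : X -> L).

Definition eletter l : L := if l.2 then h l.1 else (h l.1)^-1.
Definition fext (f : free) : L := \prod_(l <- fword f) eletter l.

Lemma eletterV l : eletter (linv l) = (eletter l)^-1.
Proof. by case: l => x []; rewrite /eletter /= ?invgK. Qed.

Lemma eletter_push l w :
  \prod_(l' <- push l w) eletter l' = eletter l * \prod_(l' <- w) eletter l'.
Proof.
case: w => [|l' w] /=; first by rewrite !big_cons.
case: ifPn => [/eqP ->|_]; rewrite !big_cons //.
by rewrite eletterV mulVKg.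
Qed.

Lemma fextM : {morph fext : f g / f * g}.
Proof.
move=> f g; rewrite /fext fwordM; elim: (fword f) => [|l w IH] /=.
  by rewrite big_nil mul1g.
by rewrite eletter_push IH big_cons mulgA.
Qed.
Lemma fext1 : fext 1 = 1. Proof. exact: morphg1 fextM. Qed.
Lemma fextV f : fext f^-1 = (fext f)^-1. Proof. exact: morphgV fextM _. Qed.

Lemma fext_letter l : fext (fletter l) = eletter l.
Proof. by rewrite /fext big_cons big_nil mulg1. Qed.

Lemma fext_gen x : fext (fgen x) = h x.
Proof. exact: fext_letter. Qed.

End Extension.

Lemma free_hom_eq (L : groupType) (f g : free -> L) :
  {morph f : x y / x * y} -> {morph g : x y / x * y} ->
  (forall x, f (fgen x) = g (fgen x)) -> f =1 g.
Proof.
move=> fM gM e f0; elim/free_ind: f0 => [|[x b] w IH]; first by rewrite (morphg1 fM) (morphg1 gM).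
rewrite fM gM IH; congr (_ * _); case: b; first exact: e.
by rewrite -/(linv (x, true)) fletterV (morphgV fM) (morphgV gM) -/(fgen x) e.
Qed.

End FreeGroup.

(** * The Nielsen-Schreier alternative *)

Section NielsenSchreier.
Variables (X : choiceType) (H : free X -> Prop).
Hypothesis hH : subgrp H.
Implicit Types (f g z : free X) (l : X * bool) (x : X).

Definition same_coset g z := H (z * g^-1).

Lemma same_coset_refl g : same_coset g g.
Proof. by rewrite /same_coset mulgV; apply: subgrp1. Qed.
Lemma same_coset_sym g z : same_coset g z -> same_coset z g.
Proof. by move=> /(subgrpV hH); rewrite invgF. Qed.
Lemma same_coset_trans f g z : same_coset f g -> same_coset g z -> same_coset f z.
Proof. by move=> h1 h2; have := subgrpM hH h2 h1; rewrite mulgA mulgVK. Qed.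
Lemma same_cosetM f g z : same_coset f g -> same_coset (f * z) (g * z).
Proof. by rewrite /same_coset invgM mulgA mulgK. Qed.

Definition shortest g z :=
  `[< same_coset g z /\ forall z', same_coset g z' -> size (fword z) <= size (fword z') >].

Lemma shortest_ex g : exists z, shortest g z.
Proof.
pose P n := `[< exists2 z, same_coset g z & size (fword z) = n >].
have exP : exists n, P n by exists (size (fword g)); apply/asboolP; exists g => //; apply: same_coset_refl.
have [n /asboolP[z hz <-] mn] := ex_minnP exP.
exists z; apply/asboolP; split=> // z' hz'; apply: mn; apply/asboolP; by exists z'.
Qed.

Definition short_rep g := xchoose (shortest_ex g).

Lemma short_repP g : same_coset g (short_rep g) /\
  forall z, same_coset g z -> size (fword (short_rep g)) <= size (fword z).
Proof. by have /asboolP := xchooseP (shortest_ex g). Qed.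

Lemma short_rep_coset g z : same_coset g z -> short_rep g = short_rep z.
Proof.
move=> gz; apply: eq_xchoose => f; apply/asboolP/asboolP => -[h1 h2]; split.
- exact: same_coset_trans (same_coset_sym gz) h1.
- by move=> z' h; apply: h2; apply: same_coset_trans gz h.
- exact: same_coset_trans gz h1.
- by move=> z' h; apply: h2; apply: same_coset_trans (same_coset_sym gz) h.
Qed.

Definition depth g := size (fword (short_rep g)).
Definition parent g := fprod (take (depth g).-1 (fword (short_rep g))).
Definition last_letters g := fprod (drop (depth g).-1 (fword (short_rep g))).

(** Chosen shortest representatives need not be closed under prefixes. Rebuilding them letter by
    letter, with the representative of the parent coset in place of the prefix, produces a Schreier
    transversal. The fuel is the depth, which drops by one at each step. *)
Fixpoint schreier_rec n g : free X :=
  if n is n'.+1 then schreier_rec n' (parent g) * last_letters g else 1.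
Definition schreier g := schreier_rec (depth g) g.

Lemma short_repE g : short_rep g = parent g * last_letters g.
Proof. by rewrite -fprod_cat cat_take_drop fwordK. Qed.

Lemma last_lettersE g : 0 < depth g -> exists l, last_letters g = fletter l.
Proof.
rewrite /last_letters /depth; case/lastP: (fword _) => // w l _.
by rewrite size_rcons /= -cats1 drop_size_cat //; exists l; rewrite fprod_cons fprod_nil mulg1.
Qed.

Lemma size_fwordM f g : size (fword (f * g)) <= size (fword f) + size (fword g).
Proof.
rewrite fwordM; elim: (fword f) => [//|l w IH] /=.
apply: leq_trans (_ : (size (foldr (@push X) (fword g) w)).+1 <= _); last by rewrite addSn ltnS.
by case: (foldr _ _ _) => [//|l' u] /=; case: ifP => //= _; rewrite -addn2 leq_addr.
Qed.

(** The prefix is one letter shorter, and a still shorter representative of its coset, extended by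
    the last letter, would beat the shortest representative of the coset of [g]. *)
Lemma depth_parent g : 0 < depth g -> depth (parent g) = (depth g).-1.
Proof.
move=> dg; apply/eqP; rewrite eqn_leq; apply/andP; split.
  have [_ /(_ _ (same_coset_refl _))] := short_repP (parent g).
  move/leq_trans; apply; rewrite /parent fword_reduced ?size_take; first by case: ltnP => //; rewrite -/(depth g); lia.
  by apply: take_sorted; apply: fwordP.
have [l el] := last_lettersE dg.
have [h1 _] := short_repP (parent g); have [h3 h4] := short_repP g.
have /h4 : same_coset g (short_rep (parent g) * last_letters g).
  apply: same_coset_trans h3 _; rewrite [X in same_coset X]short_repE; exact: same_cosetM.
have := size_fwordM (short_rep (parent g)) (last_letters g).
rewrite el /= -/(depth g) -/(depth (parent g)); lia.
Qed.

Lemma schreier_ind (P : free X -> Prop) :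
  (forall g, same_coset 1 g -> P g) ->
  (forall g z l, schreier g = schreier z * fletter l -> same_coset g (z * fletter l) ->
     P z -> P g) -> forall g, P g.
Proof.
move=> P1 PS g; have [n] := ubnP (depth g); elim: n g => // n IH g.
rewrite ltnS => dn; case: (posnP (depth g)) => [d0|dp].
  apply: P1; have [h _] := short_repP g.
  by move: h; rewrite (fword_eq1 (size0nil d0)) => h; apply: same_coset_sym.
have [l el] := last_lettersE dp.
apply: (PS _ (parent g) l); last by apply: IH; rewrite depth_parent //; lia.
- by rewrite /schreier depth_parent // -el; case: (depth g) dp.
- by rewrite -el -short_repE; have [] := short_repP g.
Qed.

Lemma schreier_mem g : same_coset g (schreier g).
Proof.
elim/schreier_ind: g => [g hg|g z l -> hzl IH]; last first.
  exact: same_coset_trans hzl (same_cosetM _ IH).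
have d0 : depth g = 0%N.
  have [_ /(_ 1 (same_coset_sym hg))] := short_repP g.
  by rewrite fword1 leqn0 => /eqP.
by rewrite /schreier d0; apply: same_coset_sym.
Qed.

Lemma schreier_coset g z : same_coset g z -> schreier g = schreier z.
Proof.
move=> /short_rep_coset e; rewrite /schreier /depth e.
by case: (size _) => //= n; rewrite /parent /last_letters /depth e.
Qed.

Lemma schreier1 : schreier 1 = 1.
Proof.
have d0 : depth 1 = 0%N.
  have [_ /(_ 1 (same_coset_refl 1))] := short_repP 1.
  by rewrite fword1 leqn0 => /eqP.
by rewrite /schreier d0.
Qed.

Lemma schreier_id g : schreier (schreier g) = schreier g.
Proof. exact/esym/schreier_coset/schreier_mem. Qed.

(** A Schreier generator: the loop at the base coset that follows the transversal to [p.1], crosses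
    the edge labelled [p.2] and returns along the transversal. Those different from 1 index the
    letters of the target of the rewriting. *)
Definition sgen (p : free X * X) : free X :=
  schreier p.1 * fgen p.2 * (schreier (p.1 * fgen p.2))^-1.

Definition sindex := {p : free X * X | (schreier p.1 == p.1) && (sgen p != 1)}.
HB.instance Definition _ := Choice.on sindex.

Definition xweight g x : free sindex :=
  if insub (schreier g, x) is Some y then fgen (y : sindex) else 1.

Definition weight g l : free sindex :=
  if l.2 then xweight g l.1 else (xweight (g * fletter l) l.1)^-1.

(** Reidemeister-Schreier rewriting: the word is read along the coset graph from the coset [H g],
    each edge contributing the symbol of its Schreier generator. A negative letter contributes the
    inverse of the weight taken at its far end, so that cancelling letters have cancelling
    weights. *)
Fixpoint rewriting_word g (w : seq (X * bool)) : free sindex :=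
  if w is l :: w' then weight g l * rewriting_word (g * fletter l) w' else 1.
Definition rewriting g f := rewriting_word g (fword f).

Lemma weightV g l : weight (g * fletter l) (linv l) = (weight g l)^-1.
Proof.
case: l => x []; rewrite /weight /= ?invgK //.
by rewrite fletterV mulgK.
Qed.

Lemma xweight_coset g z x : same_coset g z -> xweight g x = xweight z x.
Proof. by move=> /schreier_coset e; rewrite /xweight e. Qed.

Lemma weight_coset g z l : same_coset g z -> weight g l = weight z l.
Proof.
move=> gz; rewrite /weight (xweight_coset _ gz).
by rewrite (xweight_coset _ (same_cosetM _ gz)).
Qed.

Lemma rewriting_coset g z f : same_coset g z -> rewriting g f = rewriting z f.
Proof.
rewrite /rewriting; elim: (fword f) g z => //= l w IH g z gz.
by rewrite (weight_coset _ gz) (IH _ _ (same_cosetM _ gz)).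
Qed.

Lemma rewriting_push g l w :
  rewriting_word g (push l w) = weight g l * rewriting_word (g * fletter l) w.
Proof.
case: w => [//|l' w] /=; case: ifPn => [/eqP ->|//] /=.
by rewrite weightV mulVKg fletterV mulgK.
Qed.

Lemma rewritingM g f z : rewriting g (f * z) = rewriting g f * rewriting (g * f) z.
Proof.
rewrite /rewriting fwordM -[X in g * X](fwordK f).
elim: (fword f) g => [|l w IH] g /=; first by rewrite fprod_nil mulg1 mul1g.
by rewrite rewriting_push IH fprod_cons !mulgA.
Qed.

Lemma rewriting1 g : rewriting g 1 = 1. Proof. by []. Qed.
Lemma rewriting_letter g l : rewriting g (fletter l) = weight g l.
Proof. by rewrite /rewriting /= mulg1. Qed.

Lemma rewritingV g f : rewriting g f^-1 = (rewriting (g * f^-1) f)^-1.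
Proof. by apply/esym/mulg1_eq; rewrite -{2}(mulgVK f g) -rewritingM mulgV. Qed.

Lemma sgen_schreier g x : sgen (schreier g, x) = sgen (g, x).
Proof.
rewrite /sgen /= schreier_id; congr (_ * _^-1); apply/esym/schreier_coset.
exact/same_cosetM/schreier_mem.
Qed.

Lemma xweight1 g x : sgen (g, x) = 1 -> xweight g x = 1.
Proof.
by move=> e; rewrite /xweight insubF //= sgen_schreier e eqxx andbF.
Qed.

(** A transversal word runs inside the Schreier tree, all of whose edges have trivial generators. *)
Lemma rewriting_schreier g : rewriting 1 (schreier g) = 1.
Proof.
elim/schreier_ind: g => [g hg|g z l e hzl IH].
  by rewrite -(schreier_coset hg) schreier1.
have e2 : schreier (z * fletter l) = schreier z * fletter l.
  by rewrite -e; apply/esym/schreier_coset.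
rewrite e rewritingM IH !mul1g rewriting_letter.
rewrite (weight_coset _ (same_coset_sym (schreier_mem z))).
case: l {e hzl} e2 => x [] e2; rewrite /weight /= xweight1 ?invg1 //.
  by rewrite /sgen e2 /= mulgV.
by rewrite /sgen e2 /= -[(x, false)]/(linv (x, true)) fletterV mulgVK mulgVK mulgV.
Qed.

Lemma rewriting_hom : hom_on H (rewriting 1).
Proof.
move=> f g Hf _; rewrite rewritingM mul1g; congr (_ * _).
by apply/rewriting_coset/same_coset_sym; rewrite /same_coset invg1 mulg1.
Qed.

Lemma sgen_mem p : H (sgen p).
Proof. exact: same_coset_trans (same_coset_sym (schreier_mem _)) (same_cosetM _ (schreier_mem _)). Qed.

Lemma rewriting_sgen (y : sindex) : rewriting 1 (sgen (val y)) = fgen y.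
Proof.
case: y => -[g x] /= hp; have /andP[/eqP sg _] := hp.
rewrite /sgen rewritingM rewritingM rewriting_schreier !mul1g /= sg.
rewrite rewritingV (@rewriting_coset _ 1 (schreier _)); last first.
  by rewrite /same_coset mul1g invgF; have := schreier_mem (g * fgen x).
rewrite rewriting_schreier invg1 mulg1 rewriting_letter /weight /= /xweight.
by rewrite sg insubT /=; congr fgen; apply: val_inj.
Qed.

(** The product over the letters telescopes once the transversal element of each intermediate coset
    is inserted together with its inverse. *)
Lemma sgen_rewriting g f :
  schreier g * f * (schreier (g * f))^-1 = fext (fun y : sindex => sgen (val y)) (rewriting g f).
Proof.
have gen x z : schreier z * fgen x * (schreier (z * fgen x))^-1 =
    fext (fun y : sindex => sgen (val y)) (xweight z x).
  rewrite -[LHS]/(sgen (z, x)) -sgen_schreier /xweight; case: insubP => [y _ <-|].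
    by rewrite fext_gen.
  by rewrite /= schreier_id eqxx /= negbK => /eqP ->; rewrite fext1.
elim/free_ind: f g => [|l f IH] g; first by rewrite !mulg1 mulgV rewriting1 fext1.
rewrite rewritingM fextM -IH !mulgA; congr (_ * _ * _).
rewrite -[LHS](mulgVK (schreier (g * fletter l))); congr (_ * _).
rewrite rewriting_letter; case: l => x []; rewrite /weight /=; first exact: gen.
rewrite fextV -gen -[(x, false)]/(linv (x, true)) fletterV.
by rewrite mulgVK !invgM !invgK mulgA.
Qed.

(** The cases are distinguished by whether there are two different symbols. If so, [rewriting_sgen]
    makes the rewriting surjective. If not, [fE] recovers every element of [H] as a power of the
    only generator, with the exponent sum as [chi]. *)
Lemma nielsen_schreier :
  (exists s (chi : free X -> mint),
     [/\ H s, hom_on H chi & forall h, H h -> h = expgz s (chi h)]) \/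
  (exists (Y : choiceType) (y1 y2 : Y) (psi : free X -> free Y),
     [/\ y1 <> y2, hom_on H psi & forall f : free Y, exists2 h, H h & psi h = f]).
Proof.
have fE h : H h -> h = fext (fun y : sindex => sgen (val y)) (rewriting 1 h).
  move=> Hh; rewrite -sgen_rewriting mul1g schreier1 mul1g.
  rewrite -(schreier_coset (g := 1)) ?schreier1 ?invg1 ?mulg1 //.
  by rewrite /same_coset invg1 mulg1.
have [[y1 [y2 ne]]|all_eq] := pselect (exists y1 y2 : sindex, y1 <> y2).
  right; exists sindex, y1, y2, (rewriting 1); split=> //; first exact: rewriting_hom.
  elim/free_ind => [|[y b] f [h Hh <-]]; first by exists 1; [apply: subgrp1|apply: rewriting1].
  have hy := sgen_mem (val y); have Vy := subgrpV hH hy.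
  case: b.
    exists (sgen (val y) * h); first exact: subgrpM.
    by rewrite rewriting_hom // rewriting_sgen.
  exists ((sgen (val y))^-1 * h); first exact: subgrpM.
  rewrite rewriting_hom // (hom_onV hH rewriting_hom) // rewriting_sgen.
  by rewrite -[(y, false)]/(linv (y, true)) fletterV.
left; have [[y _]|noy] := pselect (exists y : sindex, True).
  pose deg := fext (fun=> 1%R : mint) : free sindex -> mint.
  exists (sgen (val y)), (deg \o rewriting 1); split; first exact: sgen_mem.
    move=> h h' Hh Hh'; rewrite /= rewriting_hom //; exact: fextM.
  move=> h /fE {1}->; rewrite /=; elim/free_ind: (rewriting 1 h) => [|[z b] f IH].
    by rewrite /deg !fext1.
  have -> : z = y by apply: contrapT => ne; apply: all_eq; exists z, y.
  rewrite /deg !fextM IH !fext_letter expgzD; congr (_ * _).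
  by case: b; rewrite /eletter.
exists 1, (fun=> 0%R : mint); split=> [|h h' _ _|h /fE ->]; [exact: subgrp1| by rewrite mulg1 |].
by elim/free_ind: (rewriting 1 h) => [|[z b] f IH]; [rewrite fext1|case: noy; exists z].
Qed.

End NielsenSchreier.

(** * Roots and commutation in free groups *)

Lemma fgen_noncommute (X : choiceType) (x y : X) : x <> y -> ~ commute (fgen x) (fgen y).
Proof.
move=> ne /(congr1 (@fword X)); rewrite !fwordM /=.
have -> : ((y, true) == linv (x, true)) = false by apply/eqP => -[].
have -> : ((x, true) == linv (y, true)) = false by apply/eqP => -[].
by case=> e; case: ne.
Qed.

Section Roots.
Variable X : choiceType.
Implicit Types x y f s : free X.

(** In the other case of [nielsen_schreier] two commuting elements would have distinct free
    generators as images. *)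
Lemma free_abelian_cyclic (H : free X -> Prop) : subgrp H -> abelian_on H ->
  exists s (chi : free X -> mint),
    [/\ H s, hom_on H chi & forall h, H h -> h = expgz s (chi h)].
Proof.
move=> hH aH; have [//|[Y [y1 [y2 [psi [ne hpsi sur]]]]]] := nielsen_schreier hH.
have [h1 H1 e1] := sur (fgen y1); have [h2 H2 e2] := sur (fgen y2).
by case: (fgen_noncommute ne); rewrite -e1 -e2 /commute -!hpsi // aH.
Qed.

Lemma free_torsion x k : 0 < k -> x ^+ k = 1 -> x = 1.
Proof.
move=> k0 xk; have hC := cycle_of_subgrp x; have Cx := cycle_of_id x.
have [s [chi [_ hchi sE]]] := free_abelian_cyclic hC (@cycle_of_abelian _ x).
have := hom_onX hC hchi k Cx; rewrite xk (hom_on1 hC hchi) => /esym/(congr1 (id : mint -> int)).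
by rewrite expg_mint mint1 => /eqP; rewrite mulf_eq0 => /orP[/eqP e|]; [rewrite (sE _ Cx) e|lia].
Qed.

(** Every character of the group generated by [x] and [y] takes the same value on both. Hence the
    degree vectors of all its elements, in any free quotient, are multiples of a single one, which
    excludes two free generators. So the group is cyclic, and its coordinate is a character that
    does not distinguish [x] from [y]. *)
Lemma free_unique_roots x y k : 0 < k -> x ^+ k = y ^+ k -> x = y.
Proof.
move=> k0 xy; pose P z := z = x \/ z = y; pose H := generated P.
have hH : subgrp H := generated_subgrp P.
have Hx : H x by apply: generated_sub; left.
have Hy : H y by apply: generated_sub; right.
have eq_chi (chi : free X -> mint) : hom_on H chi -> chi x = chi y.
  move=> hchi; have := congr1 chi xy; rewrite !(hom_onX hH hchi) //.
  move/(congr1 (id : mint -> int)); rewrite !expg_mint; apply: mulIf; lia.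
have [[s [chi [_ hchi sE]]]|[Y [y1 [y2 [psi [ne hpsi sur]]]]]] := nielsen_schreier hH.
  by rewrite (sE _ Hx) (sE _ Hy) (eq_chi _ hchi).
pose deg (v : Y) : free Y -> mint := fext (fun z => if z == v then mone else 1).
have hdeg v : hom_on H (deg v \o psi).
  by move=> f1 f2 Hf Hg; rewrite /= hpsi //; apply: fextM.
pose K z := H z /\ exists i : int, forall v, deg v (psi z) = (deg v (psi x) * i)%R :> (int).
have hK : subgrp K.
  split=> [|f g [Hf [i ei]] [Hg [j ej]]|f [Hf [i ei]]].
  - split; first exact: (subgrp1 hH).
    by exists 0%R => v; rewrite mulr0 [LHS](hom_on1 hH (hdeg v)).
  - split; first exact: (subgrpM hH).
    by exists (i + j)%R => v; rewrite [LHS](hdeg v) //= mintM ei ej mulrDr.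
  - split; first exact: (subgrpV hH).
    by exists (- i)%R => v; rewrite [LHS](hom_onV hH (hdeg v)) //= mintV ei mulrN.
have HK z : H z -> K z.
  move=> Hz; apply: (Hz _ hK) => z' [] ->; split=> //; exists 1%R => v; rewrite mulr1 //.
  by rewrite [LHS](esym (eq_chi _ (hdeg v))).
have [h1 /HK[_ [i ei]] e1] := sur (fgen y1); have [h2 /HK[_ [j ej]] e2] := sur (fgen y2).
have := ei y1; have := ei y2; have := ej y1; have := ej y2.
rewrite e1 e2 /deg !fext_gen !eqxx -/(deg y1) -/(deg y2).
have -> : (y1 == y2) = false by apply/eqP.
have -> : (y2 == y1) = false by apply/eqP => e; case: ne.
set a := deg y1 _ : int; set b := deg y2 _ : int => e3 e4 e5 e6; move: a b e3 e4 e5 e6 => a b.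
by move=> h1' /esym/eqP; rewrite mulf_eq0 => /orP[/eqP ->|/eqP ej0]; last (rewrite ej0 mulr0 in h1'); rewrite ?mul0r.
Qed.

Lemma free_unique_rootsz x y (i : int) : i <> 0%R -> expgz x i = expgz y i -> x = y.
Proof.
case: i => n n0 /=; first by apply: free_unique_roots; lia.
by move/invg_inj; apply: free_unique_roots.
Qed.

(** Conjugating [y] by [x ^+ k] preserves its [l]-th power, hence preserves [y]; then [x] is treated
    in the same way. *)
Lemma free_commute_roots x y k l : 0 < k -> 0 < l -> commute (x ^+ k) (y ^+ l) -> commute x y.
Proof.
move=> k0 l0 xy.
have h1 : commute (x ^+ k) y.
  suff e : y ^ (x ^+ k) = y by rewrite /commute (conjgC y) e.
  apply: (free_unique_roots l0); rewrite -conjXg; apply/conjg_fixP/commgP.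
  exact: commute_sym.
suff e : x ^ y = x by rewrite /commute conjgC e.
by apply: (free_unique_roots k0); rewrite -conjXg; apply/conjg_fixP/commgP.
Qed.

End Roots.

Section Translate.
Variable O : choiceType.
Let F := free (option O).
Let t : F := fgen None.
Let kill : F -> free O := fext (fun o => if o is Some o' then fgen o' else 1).
Let tdeg : F -> mint := fext (fun o : option O => if o is Some _ then 1 else mone).

(** If they commute, both are powers of one [s]. Comparing [t]-degrees, [t] and its conjugate by [w]
    have a common nonzero power, so [w] commutes with [t] by unique roots. Then [w] and [t] are
    powers of one element; killing [t] kills this element, and with it [w]. *)
Lemma conj_noncommute (w : F) (i j : int) : i <> 0%R -> j <> 0%R -> kill w <> 1 ->
  ~ commute (expgz t i) (w * expgz t j * w^-1).
Proof.
move=> i0 j0 kw co; have tM : {morph tdeg : x y / x * y} := fextM _.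
have kM : {morph kill : x y / x * y} := fextM _.
have tt : tdeg t = mone by rewrite /tdeg fext_gen.
have kt : kill t = 1 by rewrite /kill fext_gen.
have tJ x y : tdeg (x * y * x^-1) = tdeg y.
  rewrite !tM (morphgV tM); apply/(@congr1 int _ id); rewrite !mintM mintV; lia.
have wt : commute w t.
  pose P z := z = expgz t i \/ z = w * expgz t j * w^-1.
  have aP : abelian_on (generated P).
    by apply: generated_abelian => x y [] -> [] -> //; apply: commute_sym.
  have [s [chi [_ _ sE]]] := free_abelian_cyclic (generated_subgrp P) aP.
  have /sE := generated_sub (or_introl erefl : P _).
  have /sE := generated_sub (or_intror erefl : P (w * expgz t j * w^-1)).
  move: (chi _) (chi _) => a b eb ea.
  have := congr1 tdeg ea; have := congr1 tdeg eb.
  rewrite tJ !(morph_expgz _ _ tM) tt !expgz_mone => /(congr1 (id : mint -> int)) /=; rewrite expgz_mint.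
  move=> ej /(congr1 (id : mint -> int)) /=; rewrite expgz_mint => ei.
  (* With [d] the [t]-degree of [s], [i = d a] and [j = d b], so [i b = j a]. *)
  have e : expgz t (i * b)%R = expgz (w * t * w^-1) (i * b)%R.
    rewrite [LHS]expgzM ea -expgzM (mulrC (a : int)) [LHS]expgzM -eb.
    have wJ z : w * z * w^-1 = z ^ w^-1 by rewrite conjgE invgK mulgA.
    rewrite !wJ -!expgzJ -expgzM; congr (expgz _ _ ^ _).
    by rewrite ei ej mulrAC.
  have : t = w * t * w^-1.
    apply: free_unique_rootsz e => /eqP; rewrite mulf_eq0 => /orP[/eqP //|/eqP b0].
    by apply: j0; rewrite ej b0 mulr0.
  by move/(congr1 (fun z => z * w)); rewrite mulgVK.
pose P z := z = t \/ z = w.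
have aP : abelian_on (generated P).
  by apply: generated_abelian => x y [] -> [] -> //; apply: commute_sym.
have [s [chi [_ _ sE]]] := free_abelian_cyclic (generated_subgrp P) aP.
have /sE := generated_sub (or_introl erefl : P _).
have /sE := generated_sub (or_intror erefl : P w).
move: (chi _) (chi _) => a b eb ea; apply: kw.
have := congr1 tdeg ea; rewrite tt (morph_expgz _ _ tM) => /(congr1 (id : mint -> int)).
rewrite expgz_mint => sa.
have ks : kill s = 1.
  apply: (@free_unique_rootsz _ _ _ a); first by move=> a0; rewrite a0 mulr0 in sa.
  by rewrite expgz1g -(morph_expgz _ _ kM) -ea.
by rewrite eb (morph_expgz _ _ kM) ks expgz1g.
Qed.

End Translate.

(** * Trees with a group action *)

Section Walks.
Variables (E : choiceType) (V : Type) (src tgt : E -> V).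

Definition lsrc (l : E * bool) := if l.2 then src l.1 else tgt l.1.

Fixpoint walk v (w : seq (E * bool)) v' : Prop :=
  if w is l :: w' then v = lsrc l /\ walk (lsrc (linv l)) w' v' else v = v'.

Lemma walk_cat v w1 w2 v' :
  walk v (w1 ++ w2) v' <-> exists u, walk v w1 u /\ walk u w2 v'.
Proof.
elim: w1 v => [|l w1 IH] v /=; first by split=> [h|[u [-> //]]]; exists v.
split=> [[-> /IH[u [h1 h2]]]|[u [[-> h1] h2]]]; first by exists u.
by split=> //; apply/IH; exists u.
Qed.

Lemma walk_inv v w v' : walk v w v' -> walk v' (invword w) v.
Proof.
elim: w v => [|l w IH] v /=; first by move->.
case=> -> /IH h; rewrite -cat1s invword_cat; apply/walk_cat.
by exists (lsrc (linv l)); split=> //=; rewrite linvK.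
Qed.

Lemma walk_push v l w v' : walk v (l :: w) v' -> walk v (push l w) v'.
Proof.
case: w => [//|l' w]; rewrite /push; case: ifPn => [/eqP -> /=|//].
by rewrite linvK => -[-> [_]].
Qed.

Lemma walk_reduce v w v' : walk v w v' -> walk v (foldr (@push E) [::] w) v'.
Proof.
elim: w v => [//|l w IH] v /= [-> /IH h]; exact: walk_push.
Qed.

Lemma walk_end v w u u' : walk v w u -> walk v w u' -> u = u'.
Proof.
elim: w v => [|l w IH] v /=; first by move=> ->.
by move=> [_ h1] [_ h2]; apply: IH h1 h2.
Qed.

End Walks.

(* A tree with an action of G without inversions.  The tree is embedded, by
   pos, in the Cayley tree of the free group on its edges, so that geodesics are
   reduced words and uniqueness of geodesics needs no separate axiom. *)
Record tree (G : groupType) := Tree {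
  edge : choiceType;
  vertex : Type;
  eact : G -> edge -> edge;
  vact : G -> vertex -> vertex;
  src : edge -> vertex;
  tgt : edge -> vertex;
  pos : vertex -> free edge;
  eact1 : forall e, eact 1 e = e;
  eactM : forall g h e, eact (g * h) e = eact g (eact h e);
  vact1 : forall v, vact 1 v = v;
  vactM : forall g h v, vact (g * h) v = vact g (vact h v);
  src_act : forall g e, src (eact g e) = vact g (src e);
  tgt_act : forall g e, tgt (eact g e) = vact g (tgt e);
  pos_tgt : forall e, pos (tgt e) = pos (src e) * fgen e;
  connected : forall v v', exists w, walk src tgt v w v' }.

Section TreeBasics.
Variables (G : groupType) (T : tree G).
Local Notation E := (edge T).
Local Notation V := (vertex T).
Implicit Types (g h : G) (v u : V) (l : E * bool) (w : seq (E * bool)).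

Definition lstart l : V := lsrc (@src _ T) (@tgt _ T) l.
Definition lend l : V := lstart (linv l).
Definition lact g l : E * bool := (eact g l.1, l.2).
Definition twalk v w v' := walk (@src _ T) (@tgt _ T) v w v'.

Lemma twalk_cons v l w v' : twalk v (l :: w) v' = (v = lstart l /\ twalk (lend l) w v').
Proof. by []. Qed.

Lemma eactK g : cancel (@eact _ T g) (eact g^-1).
Proof. by move=> e; rewrite -eactM mulVg eact1. Qed.
Lemma vactK g : cancel (@vact _ T g) (vact g^-1).
Proof. by move=> e; rewrite -vactM mulVg vact1. Qed.

Lemma vactV g v : vact g v = v -> vact g^-1 v = v.
Proof. by move=> {1}<-; rewrite vactK. Qed.
Lemma vactMf g h v : vact g v = v -> vact h v = v -> vact (g * h) v = v.
Proof. by rewrite vactM => gv ->. Qed.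
Lemma vactX g v k : vact g v = v -> vact (g ^+ k) v = v.
Proof. by move=> gv; elim: k => [|k IH]; rewrite ?vact1 // expgS vactMf. Qed.
Lemma vactJ g h v : vact g v = v -> vact (h * g * h^-1) (vact h v) = vact h v.
Proof. by move=> gv; rewrite -vactM mulgVK vactM gv. Qed.

Lemma linv_lact g l : linv (lact g l) = lact g (linv l). Proof. by []. Qed.
Lemma lact_inj g : injective (lact g).
Proof. by move=> [e b] [e' b'] [/(can_inj (eactK g)) -> ->]. Qed.
Lemma lact_eq g l : lact g l = l <-> eact g l.1 = l.1.
Proof. by case: l => e b; split=> [[]|/= e1]; rewrite /lact /= ?e1. Qed.
Lemma lactM g h l : lact (g * h) l = lact g (lact h l).
Proof. by rewrite /lact eactM. Qed.

Lemma lstart_act g l : lstart (lact g l) = vact g (lstart l).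
Proof. by case: l => e []; rewrite /lstart /lsrc /= ?src_act ?tgt_act. Qed.
Lemma lend_act g l : lend (lact g l) = vact g (lend l).
Proof. by rewrite /lend linv_lact lstart_act. Qed.

Lemma lact_ends g l : lact g l = l -> vact g (lstart l) = lstart l /\ vact g (lend l) = lend l.
Proof. by move=> gl; rewrite -lstart_act -lend_act gl. Qed.

Lemma reduced_map g w : reduced (map (lact g) w) = reduced w.
Proof.
rewrite /reduced sorted_map; apply: eq_sorted => l l' /=.
by rewrite /relpre /= /nocancel linv_lact (inj_eq (@lact_inj g)).
Qed.

Lemma twalk_act g v w v' : twalk v w v' -> twalk (vact g v) (map (lact g) w) (vact g v').
Proof.
elim: w v => [|l w IH] v; first by move->.
by rewrite map_cons !twalk_cons => -[-> h]; split; [rewrite lstart_act|rewrite lend_act; apply: IH].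
Qed.

Lemma twalk_pos v w v' : twalk v w v' -> pos v' = pos v * fprod w.
Proof.
elim: w v => [|l w IH] v; first by move->; rewrite fprod_nil mulg1.
case=> -> /IH ->; rewrite fprod_cons mulgA; congr (_ * _).
case: l => e []; rewrite /lsrc /= ?pos_tgt //.
by rewrite -[(e, false)]/(linv (e, true)) fletterV mulgK.
Qed.

Definition geo v v' := fword ((pos v)^-1 * pos v').

Lemma geo_reduced v v' : reduced (geo v v').
Proof. exact: fwordP. Qed.

Lemma geoP v w v' : twalk v w v' -> reduced w -> w = geo v v'.
Proof.
by move=> h hw; rewrite /geo (twalk_pos h) mulKg fword_reduced.
Qed.

Lemma geo_walk v v' : twalk v (geo v v') v'.
Proof.
have [w hw] := connected v v'; have := walk_reduce hw.
by rewrite /geo (twalk_pos hw) mulKg fword_fprod.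
Qed.

Lemma geo_nil v v' : geo v v' = [::] -> v = v'.
Proof. by move=> e; have := geo_walk v v'; rewrite e. Qed.

Lemma geo_act g v v' : geo (vact g v) (vact g v') = map (lact g) (geo v v').
Proof.
apply/esym/geoP; first exact/twalk_act/geo_walk.
by rewrite reduced_map geo_reduced.
Qed.

Lemma geo_inv v v' : geo v' v = invword (geo v v').
Proof. by rewrite /geo -fwordV invgM invgK. Qed.

(** By uniqueness the geodesic is mapped to itself, hence letter by letter. *)
Lemma geo_fixed g v v' l : vact g v = v -> vact g v' = v' -> l \in geo v v' -> lact g l = l.
Proof.
move=> gv gv'; have := geo_act g v v'; rewrite gv gv'.
by elim: (geo v v') => //= l' w IH [e1 e2]; rewrite inE => /orP[/eqP -> |]; [|apply: IH].
Qed.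

Lemma twalk_fixed g v w v' : twalk v w v' -> vact g v = v ->
  (forall l, l \in w -> lact g l = l) -> vact g v' = v'.
Proof.
elim: w v => [|l w IH] v; first by move->.
case=> _ h _ hl; apply: (IH _ h) => [|l' l'w].
  by have [] := lact_ends (hl l (mem_head _ _)).
by apply: hl; rewrite inE l'w orbT.
Qed.

Lemma geo_cat v v' w1 w2 : geo v v' = w1 ++ w2 ->
  exists u, [/\ w1 = geo v u, w2 = geo u v', twalk v w1 u & twalk u w2 v'].
Proof.
move=> e; have := geo_walk v v'; rewrite e => /walk_cat[u [h1 h2]].
have := geo_reduced v v'; rewrite e => /cat_sorted2[r1 r2].
by exists u; split=> //; apply: geoP.
Qed.

Lemma reduced_cat (w1 w2 : seq (E * bool)) : reduced w1 -> reduced w2 ->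
  (forall w1' l l' w2', w1 = rcons w1' l -> w2 = l' :: w2' -> l' <> linv l) ->
  reduced (w1 ++ w2).
Proof.
case/lastP: w1 => [//|w1 l]; case: w2 => [|l' w2]; first by rewrite cats0.
move=> r1; rewrite {1}/reduced /= => r2 hl; rewrite /reduced cat_rcons.
move: r1; rewrite /reduced -cats1; case: w1 hl => [|l0 w1] hl /=.
  by move=> _; rewrite r2 andbT; apply/eqP; apply: (hl [::] l l' w2).
rewrite !cat_path /= andbT => /andP[-> ->] /=; rewrite r2 andbT.
by apply/eqP; apply: (hl (l0 :: w1) l l' w2).
Qed.

Lemma not_reducedP (X : choiceType) (f : E * bool -> X * bool) w :
  (forall x y w1 w2, w = w1 ++ x :: y :: w2 -> f y <> linv (f x)) -> reduced (map f w).
Proof.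
elim: w => [//|x [//|y w] IH] h /=; rewrite /reduced /= in IH *.
apply/andP; split; first by apply/eqP; apply: (h x y [::] w).
by apply: IH => x' y' w1 w2 e; apply: (h x' y' (x :: w1) w2); rewrite e.
Qed.

End TreeBasics.

(** * Homomorphisms to free groups from an action on a tree *)

(** This form of the second alternative pulls back along homomorphisms at once; [good_surjection]
    later turns it into a surjection onto the free group of rank 2. *)
Definition good (G : groupType) (H : G -> Prop) :=
  exists (X : choiceType) (phi : G -> free X),
    hom_on H phi /\ exists x y, [/\ H x, H y & ~ commute (phi x) (phi y)].

Section TreeHom.
Variables (G : groupType) (T : tree G) (H : G -> Prop) (hH : subgrp H).
Local Notation E := (edge T).
Implicit Types (g h : G) (v u : vertex T) (e : E) (l : E * bool) (w : seq (E * bool)).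

Definition same_orbit e e' := exists2 h, H h & e' = eact h e.

Lemma same_orbit_ex e : exists e', `[< same_orbit e e' >].
Proof. by exists e; apply/asboolP; exists 1; [apply: subgrp1|rewrite eact1]. Qed.

Definition orbit_rep e := xchoose (same_orbit_ex e).

Lemma orbit_rep_mover e : exists h, H h /\ e = eact h (orbit_rep e).
Proof.
have /asboolP[h Hh eE] := xchooseP (same_orbit_ex e).
by exists h^-1; split; [apply: subgrpV|rewrite /orbit_rep eE eactK].
Qed.

Definition mover e := projT1 (cid (orbit_rep_mover e)).
Lemma moverP e : H (mover e) /\ e = eact (mover e) (orbit_rep e).
Proof. exact: projT2 (cid (orbit_rep_mover e)). Qed.

Lemma orbit_rep_act g e : H g -> orbit_rep (eact g e) = orbit_rep e.
Proof.
move=> Hg; apply: eq_xchoose => e'; apply/asboolP/asboolP => -[h Hh ->].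
- by exists (h * g); [apply: subgrpM|rewrite eactM].
- exists (h * g^-1); first by apply: subgrpM => //; apply: subgrpV.
  by rewrite eactM eactK.
Qed.

Lemma orbit_repP e e' : orbit_rep e = orbit_rep e' -> exists h, H h /\ e' = eact h e.
Proof.
move=> ee; have [h1 e1] := moverP e; have [h2 e2] := moverP e'.
exists (mover e' * (mover e)^-1); split; first by apply: subgrpM => //; apply: subgrpV.
rewrite eactM (_ : eact (mover e)^-1 e = orbit_rep e) ?ee //.
by rewrite [X in eact _ X]e1 eactK.
Qed.

Variable chi : G -> mint.
Hypothesis hchi : hom_on H chi.

(** Equivariance forces the weight of an edge to commute with [t] to the power [chi h] for every [h]
    of [H] stabilizing it. So an edge orbit can receive a free letter of its own only if [chi]
    vanishes on its stabilizers; the other edges are collapsed. *)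
Definition killed e := `[< forall h, H h -> eact h e = e -> chi h = 1 >].

Let F := free (option E).
Let t : F := fgen None.

(** The conjugation makes the weights equivariant, [g] acting through conjugation by [t] to the
    power [chi g]. The choice of mover is immaterial: two movers differ by an element stabilizing
    the orbit representative, on which [chi] vanishes. *)
Definition eweight e : F :=
  if killed e then expgz t (chi (mover e)) * fgen (Some (orbit_rep e)) * (expgz t (chi (mover e)))^-1
  else 1.

Lemma killed_act g e : H g -> killed (eact g e) = killed e.
Proof.
move=> Hg; have Vg := subgrpV hH Hg; apply/asboolP/asboolP => k h Hh he.
- have := k (g * h * g^-1); rewrite -eactM mulgVK eactM he => /(_ _ erefl).
  rewrite !hchi ?(hom_onV hH hchi) //; last exact: subgrpM.
  move=> e1; have {}e1 := e1 (subgrpM hH (subgrpM hH Hg Hh) Vg).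
  by apply: (mulgI (chi g)); apply: (mulIg (chi g)^-1); rewrite e1 mulg1 mulgV.
- have : chi (g^-1 * h * g) = 1.
    apply: k; first by do !apply: subgrpM => //.
    by rewrite -mulgA !eactM he eactK.
  rewrite !hchi ?(hom_onV hH hchi) //; last exact: subgrpM.
  by move=> e1; apply: (mulgI (chi g)^-1); apply: (mulIg (chi g)); rewrite e1 mulg1 mulVg.
Qed.

Lemma eweight_act g e : H g ->
  eweight (eact g e) = expgz t (chi g) * eweight e * (expgz t (chi g))^-1.
Proof.
move=> Hg; rewrite /eweight killed_act //; case: ifP => [ke|_]; last by rewrite mulg1 mulgV.
rewrite orbit_rep_act //; have [h1 e1] := moverP e; have [h2 e2] := moverP (eact g e).
have kr : killed (orbit_rep e) by rewrite -(@killed_act (mover e)) // -e1.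
have : chi ((mover (eact g e))^-1 * (g * mover e)) = 1.
  move/asboolP: kr; apply; first by apply: subgrpM; [|apply: subgrpV|apply: subgrpM].
  by rewrite !eactM -e1 {2}e2 eactK orbit_rep_act.
rewrite hchi ?(hom_onV hH hchi) //; [|exact: subgrpV|exact: subgrpM].
rewrite hchi // => /mulg1_eq; rewrite invgK => ->.
by rewrite -[chi g * chi _]/(chi g + chi (mover e))%R expgzD invgM !mulgA.
Qed.

Definition wval v v' : F := fext eweight ((pos v)^-1 * pos v').

Lemma wvalM v u v' : wval v v' = wval v u * wval u v'.
Proof. by rewrite /wval -fextM mulgA mulgK. Qed.

Lemma wvalE v v' : wval v v' = \prod_(l <- geo v v') eletter eweight l.
Proof. by []. Qed.

Lemma wval_act g v v' : H g ->
  wval (vact g v) (vact g v') = expgz t (chi g) * wval v v' * (expgz t (chi g))^-1.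
Proof.
move=> Hg; rewrite !wvalE geo_act; elim: (geo v v') => [|l w IH] /=.
  by rewrite !big_nil mulg1 mulgV.
have eE : eletter eweight (lact g l) = expgz t (chi g) * eletter eweight l * (expgz t (chi g))^-1.
  by case: l => e []; rewrite /eletter /= eweight_act // !invgM invgK mulgA.
by rewrite !big_cons IH eE !mulgA mulgVK.
Qed.

(** The label of the path from [v] to its translate, corrected by a power of [t]; equivariance of
    the weights makes it multiplicative, and elements fixing a vertex become conjugates of powers of
    [t]. *)
Definition tree_hom v g : F := wval v (vact g v) * expgz t (chi g).

Lemma tree_homM v : hom_on H (tree_hom v).
Proof.
move=> g h Hg Hh; rewrite /tree_hom (wvalM _ (vact g v)) vactM wval_act // hchi //.
by rewrite -[chi g * chi h]/(chi g + chi h)%R expgzD -!mulgA mulKg.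
Qed.

Lemma tree_hom_fix v v' g : H g -> vact g v' = v' ->
  tree_hom v g = wval v v' * expgz t (chi g) * (wval v v')^-1.
Proof.
move=> Hg gv'; rewrite /tree_hom (wvalM v v' (vact g v)) -{2}gv' wval_act //.
have -> : wval v' v = (wval v v')^-1.
  by apply/esym/mulg1_eq; rewrite -wvalM /wval mulVg fext1.
by rewrite !mulgA mulgVK.
Qed.

Definition kill_t : F -> free E := fext (fun o => if o is Some e then fgen e else 1).

Definition orep_letter l : E * bool := (orbit_rep l.1, l.2).

(** Without [t] the weights are just names of edge orbits, so that only cancellation between
    consecutive names can occur. *)
Lemma kill_wval v v' : (forall l, l \in geo v v' -> killed l.1) ->
  kill_t (wval v v') = fprod (map orep_letter (geo v v')).
Proof.
have kM : {morph kill_t : x y / x * y} := fextM _.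
rewrite wvalE; elim: (geo v v') => [|l w IH] hl; first by rewrite big_nil fprod_nil (morphg1 kM).
rewrite big_cons kM IH /= ?fprod_cons; last by move=> l' l'w; apply: hl; rewrite inE l'w orbT.
congr (_ * _).
have kw : kill_t (eweight l.1) = fgen (orbit_rep l.1).
  rewrite /eweight (hl _ (mem_head _ _)) !kM (morphgV kM) (morph_expgz _ _ kM).
  by rewrite /kill_t !fext_gen expgz1g invg1 mulg1 mul1g.
case: l kw {hl} => e [] /= kw; rewrite /eletter /= ?(morphgV kM) kw //.
by rewrite -[orep_letter _]/(linv (orbit_rep e, true)) fletterV.
Qed.

Lemma killed_trivial e : (forall h, H h -> chi h = 1) -> killed e.
Proof. by move=> h1; apply/asboolP => h Hh _; apply: h1. Qed.

End TreeHom.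

Section Backtrack.
Variables (G : groupType) (T : tree G) (H : G -> Prop) (hH : subgrp H).
Implicit Types (g h : G) (v u : vertex T).

(** The obstruction to the word of edge orbits being reduced: at the vertex between the successive
    letters [x] and [y], some [h] fixing this vertex carries [x] to the inverse of [y]. *)
Definition backtrack v v' (w1 : seq (edge T * bool)) x y w2 h :=
  [/\ geo v v' = w1 ++ x :: y :: w2, H h, vact h (lend x) = lend x,
      y = linv (lact h x) & eact h x.1 <> x.1].

Lemma backtrackP v v' :
  reduced (map (orep_letter hH) (geo v v')) \/ exists w1 x y w2 h, backtrack v v' w1 x y w2 h.
Proof.
have [[w1 [x [y [w2 [h b]]]]]|no] := pselect (exists w1 x y w2 h, backtrack v v' w1 x y w2 h).
  by right; exists w1, x, y, w2, h.
left; apply: not_reducedP => x y w1 w2 e [e1 e2]; apply: no.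
have [h [Hh yE]] := orbit_repP (esym e1).
have ye : y = linv (lact h x) by case: y e e2 yE {e1} => y1 y2 /= _ -> ->.
exists w1, x, y, w2, h; split=> //.
  have := geo_walk v v'; rewrite e => /walk_cat[u [_ ]].
  rewrite -!/(twalk _ _ _) !twalk_cons => -[_ [hx _]].
  by rewrite -lend_act [RHS]hx ye.
move=> hx; have := geo_reduced v v'; rewrite e /reduced => /cat_sorted2[_] /=.
case/andP => /eqP + _; rewrite ye => -[].
by have /lact_eq -> := hx.
Qed.

End Backtrack.

(** * Separating vectors from a subgroup of Z^n *)

Section Separation.
Local Open Scope ring_scope.

Lemma common_denominator (s : seq rat) :
  exists2 D : nat, (0 < D)%N & forall x, x \in s -> exists z : int, D%:R * x = z%:~R.
Proof.
elim: s => [|x s [D D0 hD]]; first by exists 1%N.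
exists (`|denq x| * D)%N; first by rewrite muln_gt0 D0 andbT absz_gt0 denq_neq0.
move=> y; rewrite inE natrM => /orP[/eqP ->|/hD[z hz]].
  exists (D%:Z * numq x); rewrite natr_absz gtr0_norm ?denq_gt0 // mulrAC rmorphM /= mulrC.
  by congr (_ * _); rewrite mulrC -numqE.
by exists (`|denq x|%:Z * z); rewrite -mulrA hz rmorphM /= natr_absz.
Qed.

Lemma integral_multiple m n (u : 'M[rat]_(m, n)) :
  exists2 D : nat, (0 < D)%N & exists v : 'M[int]_(m, n), map_mx intr v = D%:R *: u.
Proof.
have [D D0 hD] := common_denominator [seq u ij.1 ij.2 | ij : 'I_m * 'I_n].
exists D => //; exists (\matrix_(i, j) numq (D%:R * u i j)); apply/matrixP => i j.
rewrite !mxE; have [|z ->] := hD (u i j); last by rewrite numq_int.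
by apply/mapP; exists (i, j); rewrite ?mem_enum.
Qed.

Lemma map_intr_inj m n : injective (map_mx intr : 'M[int]_(m, n) -> 'M[rat]_(m, n)).
Proof. by move=> A B /matrixP e; apply/matrixP => i j; have := e i j; rewrite !mxE => /intr_inj. Qed.

Variables (n : nat) (E0 : 'rV[int]_n -> Prop).
Hypotheses (E00 : E0 0) (E0D : forall x y, E0 x -> E0 y -> E0 (x + y))
  (E0N : forall x, E0 x -> E0 (- x)).

Lemma E0Z (z : int) x : E0 x -> E0 (z *: x).
Proof.
have pos (k : nat) : E0 x -> E0 (k%:Z *: x).
  move=> Ex; elim: k => [|k IH]; first by rewrite scale0r.
  by rewrite -[k.+1]addn1 PoszD scalerDl scale1r; apply: E0D.
by case: z => k Ex; [|rewrite NegzE scaleNr; apply: E0N]; apply: pos.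
Qed.

(** The rows form a family in [E0] of maximal rational rank; it spans [E0] over Q, though perhaps
    not over Z. *)
Lemma spanning_matrix : exists m (M : 'M[int]_(m, n)),
  (forall i, E0 (row i M)) /\ forall x, E0 x -> ((map_mx intr x : 'rV[rat]_n) <= (map_mx intr M : 'M[rat]_(m, n)))%MS.
Proof.
pose P r := `[< exists m (M : 'M[int]_(m, n)),
  (forall i, E0 (row i M)) /\ \rank (map_mx intr M : 'M[rat]_(m, n)) = r >].
have exP : exists r, P r.
  by exists (\rank (map_mx intr (0 : 'M[int]_(0, n)) : 'M[rat]_(0, n))); apply/asboolP; exists 0%N, 0; split=> // -[].
have bP r : P r -> (r <= n)%N by move=> /asboolP[m [M [_ <-]]]; apply: rank_leq_col.
have [r /asboolP[m [M [hM rM]]] mx] := ex_maxnP exP bP.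
exists m, M; split=> // x Ex.
have : P (\rank (map_mx intr (col_mx M x) : 'M[rat]_(m + 1, n))).
  apply/asboolP; exists (m + 1)%N, (col_mx M x); split=> // i; rewrite -(splitK i).
  by case: (fintype.split i) => j /=; rewrite ?rowKu ?rowKd ?hM // (ord1 j) row_id.
move/mx; rewrite map_col_mx -rM -addsmxE => le; apply: submx_trans (addsmxSr (map_mx intr M) _) _.
by rewrite -(geq_leqif (mxrank_leqif_sup (addsmxSl _ _))).
Qed.

(** If [a] lay in the rational span of [E0], clearing denominators would put a positive multiple of
    it in [E0]. Otherwise some column of the cokernel matrix, scaled to integers, separates [a] from
    [E0]. *)
Lemma separate1 a : (forall k, (0 < k)%N -> ~ E0 (k%:Z *: a)) ->
  exists c : 'cV[int]_n, (forall x, E0 x -> x *m c = 0) /\ a *m c != 0.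
Proof.
move=> ha; have [m [M [hM spM]]] := spanning_matrix.
pose Q := map_mx intr M : 'M[rat]_(m, n).
have naQ : ~~ (map_mx intr a <= Q)%MS.
  apply/negP => /submxP[u aE]; have [D D0 [v vE]] := integral_multiple u.
  apply: (ha D) => //; have -> : D%:Z *: a = v *m M.
    apply: map_intr_inj; rewrite map_mxZ map_mxM /= vE -scalemxAl -aE.
    by congr (_ *: _).
  rewrite mulmx_sum_row; apply: (big_ind E0) => // i _.
  exact/E0Z/hM.
move: naQ; rewrite submxE => /matrix0Pn[i [j hij]].
have [D D0 [c cE]] := integral_multiple (col j (cokermx Q)).
have cM k (x : 'M[int]_(k, n)) : map_mx intr (x *m c) = D%:R *: (map_mx intr x *m col j (cokermx Q)) :> 'cV[rat]_k.
  by rewrite map_mxM /= cE -scalemxAr.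
have col_mul k (A : 'M[rat]_(k, n)) : A *m col j (cokermx Q) = col j (A *m cokermx Q).
  by rewrite !colE mulmxA.
exists c; split=> [x /spM|].
  rewrite submxE => /eqP e; apply: map_intr_inj.
  by rewrite cM col_mul e col0 scaler0 map_mx0.
apply: contra_neq hij => e; have := cM _ a; rewrite e map_mx0 col_mul => /matrixP/(_ i 0).
rewrite [LHS]mxE [RHS]mxE [X in _ * X]mxE => /esym/eqP.
by rewrite mulf_eq0 pnatr_eq0 => /orP[/eqP D00|/eqP //]; rewrite D00 in D0.
Qed.

Lemma separate2 a b : (forall k, (0 < k)%N -> ~ E0 (k%:Z *: a)) ->
  (forall k, (0 < k)%N -> ~ E0 (k%:Z *: b)) ->
  exists c : 'cV[int]_n, [/\ forall x, E0 x -> x *m c = 0, a *m c != 0 & b *m c != 0].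
Proof.
move=> /separate1[c [hc ac]] /separate1[d [hd bd]].
have [bc|bc] := eqVneq (b *m c) 0; last by exists c.
have [ad|ad] := eqVneq (a *m d) 0; last by exists d.
(* Here [c] vanishes on [b] and [d] on [a], so both nonzero values survive in the sum. *)
exists (c + d); split=> [x Ex||]; rewrite mulmxDr.
- by rewrite hc // hd // addr0.
- by rewrite ad addr0.
- by rewrite bc add0r.
Qed.

End Separation.

(** * The alternative for groups acting on trees *)

Section Gate.
Variables (G : groupType) (T : tree G).
Implicit Types (g n c : G) (v u : vertex T).

(* The fixed point set of c meets the geodesic from v to n v only in u, and it is
   invariant under n; so u is the projection of both v and n v to it, hence u = n u. *)
Lemma gate c n v u w1 x y w2 : geo v (vact n v) = w1 ++ x :: y :: w2 ->
  u = lend x -> commute c n -> vact c u = u ->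
  lact c x <> x -> lact c y <> y -> vact n u = u.
Proof.
move=> e ux cn cu cx cy.
have [u1 [w1E w2E k1 k2]] : exists u1, [/\ rcons w1 x = geo v u1, y :: w2 = geo u1 (vact n v),
    twalk v (rcons w1 x) u1 & twalk u1 (y :: w2) (vact n v)].
  by apply: geo_cat; rewrite cat_rcons.
have u1E : u1 = u.
  rewrite ux; move: k1; rewrite -cats1 => /walk_cat[u2 [_ ]].
  by rewrite -/(twalk _ _ _) twalk_cons => -[_ ->].
move: u1 u1E w1E w2E k1 k2 => _ -> w1E w2E k1 k2.
have cnu : vact c (vact n u) = vact n u by rewrite -vactM cn vactM cu.
have [m0|] := eqVneq (geo u (vact n u)) [::]; first by rewrite -(geo_nil m0).
move=> mN; exfalso.
have e3 : geo u (vact n v) = geo u (vact n u) ++ map (lact n) (geo u v).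
  apply/esym/geoP.
    by apply/walk_cat; exists (vact n u); split; [|apply: twalk_act]; apply: geo_walk.
  apply: reduced_cat; rewrite ?reduced_map ?geo_reduced //.
  move=> m' l l' w' e1; rewrite geo_inv -w1E -cats1 invword_cat /= => -[<- _] e2.
  have cl : lact c l = l.
    by apply: (geo_fixed cu cnu); rewrite e1 mem_rcons mem_head.
  apply: cx; apply: (can_inj (@linvK _)); apply: (@lact_inj _ _ n).
  by rewrite linv_lact -lactM -cn lactM e2 -linv_lact cl.
move: e3; rewrite -w2E; case eg : (geo u (vact n u)) mN => [//|l m] _ [yl _].
by apply: cy; apply: (geo_fixed cu cnu); rewrite eg yl mem_head.
Qed.

End Gate.

(** For trivial [chi] every edge is killed; if the word of edge orbits is reduced, a trivial image
    makes the geodesic empty. *)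
Lemma tree_hom_trivial (G : groupType) (T : tree G) (H : G -> Prop) (hH : subgrp H) v g :
  tree_hom (T := T) hH (fun=> 1) v g = 1 ->
  reduced (map (orep_letter hH) (geo v (vact g v))) -> vact g v = v.
Proof.
rewrite /tree_hom mulg1 => /(congr1 (@kill_t _ _)).
rewrite kill_wval => [|l _]; last exact: killed_trivial.
rewrite /kill_t fext1 => /(congr1 (@fword _)); rewrite fword1 => e red.
move: e; rewrite fword_reduced //; case eg : (geo _ _) => [|//] _.
by rewrite -(geo_nil eg).
Qed.

Section TreeAction.
Variables (G : groupType) (T : tree G) (H : G -> Prop) (hH : subgrp H).
Implicit Types (g h a b : G) (v u z : vertex T) (w : seq (edge T * bool)) (l : edge T * bool).

Definition no_common_fix a b := ~ exists z, vact a z = z /\ vact b z = z.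

(** Minimality ranges over all pairs of elements of [H] without common fixed vertex, and not just
    over the vertices fixed by [a] and [b]; this gives control over any element of [H] that fixes an
    interior vertex of the geodesic. *)
Definition closest a b v v' := [/\ H a, H b, vact a v = v, vact b v' = v' &
  no_common_fix a b /\
  forall a' b' u u', H a' -> H b' -> vact a' u = u -> vact b' u' = u' ->
    no_common_fix a' b' -> size (geo v v') <= size (geo u u')].

Lemma closest_sym a b v v' : closest a b v v' -> closest b a v' v.
Proof.
case=> Ha Hb av bv [nf mn]; split=> //; split=> [[z [h1 h2]]|]; first by apply: nf; exists z.
by rewrite geo_inv /invword size_rev size_map.
Qed.

Lemma closest_ex a b v v' : H a -> H b -> vact a v = v -> vact b v' = v' -> no_common_fix a b ->
  exists a b v v', closest a b v v'.
Proof.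
move=> Ha Hb av bv nf.
pose P n := `[< exists a b v v', [/\ H a, H b, vact a v = v, vact b v' = v' &
  no_common_fix a b /\ size (geo v v') = n] >].
have exP : exists n, P n by exists (size (geo v v')); apply/asboolP; exists a, b, v, v'.
have [n /asboolP[a1 [b1 [v1 [v1' [h1 h2 h3 h4 [h5 <-]]]]]] mn] := ex_minnP exP.
exists a1, b1, v1, v1'; split=> //; split=> // a' b' u u' Ha' Hb' au bu nf'.
by apply: mn; apply/asboolP; exists a', b', u, u'.
Qed.

(** The vertex [u] is nearer to [v] than [v'] is, so by minimality [a] and [g] share a fixed vertex
    [z]. The geodesic from [u] to [z] passes through [v], and [g] fixes both of its ends. *)
Lemma closest_fix_start a b v v' w1 w2 u g : closest a b v v' ->
  geo v v' = w1 ++ w2 -> w1 <> [::] -> w2 <> [::] -> twalk v w1 u ->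
  H g -> vact g u = u -> vact g v = v.
Proof.
case=> Ha Hb av bv [nf mn] e n1 n2 k1 Hg gu.
have [u1 [w1E w2E k1' k2]] := geo_cat e.
have uu : u1 = u := walk_end k1' k1; move: u1 uu w1E w2E k1' k2 => _ -> w1E w2E _ k2.
have [z [az gz]] : exists z, vact a z = z /\ vact g z = z.
  apply: contrapT => nag; have := mn _ _ _ _ Ha Hg av gu nag.
  by rewrite -w1E e size_cat; case: (w2) n2 => //= ? ? _; lia.
case: w1 n1 e k1 w1E => [//|x w1] _ e k1 w1E.
(* Otherwise [a] would fix a vertex one step closer to [v']. *)
have nax : lact a x <> x.
  move=> ax; have [_ ax'] := lact_ends ax.
  have [u2 [_ e2 k3 _]] : exists u2, [/\ [:: x] = geo v u2, w1 ++ w2 = geo u2 v',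
    twalk v [:: x] u2 & twalk u2 (w1 ++ w2) v'] by apply: geo_cat; rewrite e.
  have := mn _ _ _ _ Ha Hb ax' bv nf.
  by move: k3; rewrite twalk_cons => -[_ ->]; rewrite -e2 e /=; lia.
(* There is no cancellation at [v]: if the geodesic from [v] to [z] started with [x], then [a],
   fixing both of its ends, would fix [x]. *)
have e3 : geo u z = invword (x :: w1) ++ geo v z.
  apply/esym/geoP; first by apply/walk_cat; exists v; split; [apply: walk_inv|apply: geo_walk].
  apply: reduced_cat; rewrite ?geo_reduced //.
    by apply: invword_reduced; rewrite w1E geo_reduced.
  move=> m' l l' w'; rewrite -cat1s invword_cat cats1 => /rcons_inj[_ <-] e4 e5.
  apply: nax; rewrite linvK in e5; apply: (geo_fixed av az).
  by rewrite e4 e5 mem_head.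
apply: (twalk_fixed (walk_inv k1) gu) => l lw; apply: (geo_fixed gu gz).
by rewrite e3 mem_cat lw.
Qed.

Lemma closest_fix_interior a b v v' w1 w2 u g : closest a b v v' ->
  geo v v' = w1 ++ w2 -> w1 <> [::] -> w2 <> [::] -> twalk v w1 u ->
  H g -> vact g u = u -> vact g v = v /\ vact g v' = v'.
Proof.
move=> cl e n1 n2 k1 Hg gu; split; first exact: closest_fix_start cl e n1 n2 k1 Hg gu.
have [u1 [_ _ k1' k2]] := geo_cat e; have uu : u1 = u := walk_end k1' k1; subst u1.
have e' : geo v' v = invword w2 ++ invword w1 by rewrite geo_inv e invword_cat.
apply: closest_fix_start (closest_sym cl) e' _ _ (walk_inv k2) Hg gu => /(congr1 (@invword _)).
  by rewrite invwordK.
by rewrite invwordK.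
Qed.

(** An edge of the geodesic has an interior end, unless it is the whole geodesic. *)
Lemma closest_fix_edge a b v v' l g : closest a b v v' ->
  l \in geo v v' -> H g -> lact g l = l -> vact g v = v /\ vact g v' = v'.
Proof.
move=> cl lw Hg gl; have [gs ge] := lact_ends gl.
have [w1 [w2 e]] : exists w1 w2, geo v v' = w1 ++ l :: w2.
  by case/splitPr: lw => w1 w2; exists w1, w2.
have := geo_walk v v'; rewrite e => /walk_cat[u [k1 [us k2]]].
have [n1|n1] := pselect (w1 = [::]); last first.
  by apply: (closest_fix_interior cl e n1 _ k1 Hg) => //; rewrite us.
have [n2|n2] := pselect (w2 = [::]).
  by subst w1 w2; move: k1 k2 us => /= -> <- ->.
subst w1; apply: (@closest_fix_interior _ _ _ _ [:: l] w2 (lend l) _ cl) => //.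
by move: k1 => /= ->; split.
Qed.

Variables (n : nat) (rho : G -> 'rV[int]_n).
Hypothesis rhoM : forall x y, H x -> H y -> rho (x * y) = (rho x + rho y)%R.
Hypothesis rho_inj : forall a v, H a -> vact a v = v -> rho a = 0%R -> a = 1.
Hypothesis edge_roots : forall a l k, H a -> 0 < k -> vact a (lstart l) = lstart l ->
  lact (a ^+ k) l = l -> lact a l = l.

Lemma rho1 : rho 1 = 0%R.
Proof.
have := rhoM (subgrp1 hH) (subgrp1 hH); rewrite mulg1 => e.
by apply: (addrI (rho 1)); rewrite -e addr0.
Qed.

Lemma rhoV x : H x -> rho x^-1 = (- rho x)%R.
Proof.
move=> Hx; apply: (addrI (rho x)); rewrite -rhoM ?mulgV ?rho1 ?subrr //.
exact: subgrpV.
Qed.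

Lemma rhoX x k : H x -> rho (x ^+ k) = (k%:Z *: rho x)%R.
Proof.
move=> Hx; elim: k => [|k IH]; first by rewrite rho1 scale0r.
rewrite expgS rhoM ?IH //; last exact: subgrpX.
by rewrite -[k.+1]addn1 PoszD scalerDl scale1r addrC.
Qed.

Lemma fix_rho_eq a b v : H a -> H b -> vact a v = v -> vact b v = v -> rho a = rho b -> a = b.
Proof.
move=> Ha Hb av bv e; apply: divg1_eq; apply: (@rho_inj _ v).
- exact: subgrpF.
- by apply: vactMf => //; apply: vactV.
- by rewrite rhoM ?rhoV ?e ?subrr //; apply: subgrpV.
Qed.

(** [E0] is the [rho]-image of the elements of [H] fixing the geodesic. A character vanishing on
    [E0] kills all edges of the geodesic, so these keep their letters; being nonzero on [a] and [b],
    it leaves the situation of [conj_noncommute]. *)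
Lemma good_of_closest a b v v' : closest a b v v' -> good H.
Proof.
move=> cl; have [Ha Hb av bv [nf _]] := cl.
pose E0 x := exists g, [/\ H g, vact g v = v, vact g v' = v' & rho g = x].
have E00 : E0 0%R by exists 1; rewrite !vact1 rho1; split=> //; apply: subgrp1.
have E0D x y : E0 x -> E0 y -> E0 (x + y)%R.
  move=> [g [Hg gv gv' <-]] [h [Hh hv hv' <-]]; exists (g * h).
  by rewrite !vactMf // rhoM //; split=> //; apply: subgrpM.
have E0N x : E0 x -> E0 (- x)%R.
  move=> [g [Hg gv gv' <-]]; exists g^-1; rewrite !vactV // rhoV //.
  by split=> //; apply: subgrpV.
have fix_pow c l k : H c -> 0 < k -> l \in geo v v' -> lact (c ^+ k) l = l ->
    vact c (lstart l) = lstart l \/ vact c (lend l) = lend l ->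
    vact c v = v /\ vact c v' = v'.
  move=> Hc k0 lw cl1 hc; apply: (closest_fix_edge cl lw Hc).
  case: hc => hc; first exact: edge_roots Hc k0 hc cl1.
  apply: (can_inj (@linvK _)); rewrite linv_lact; apply: edge_roots Hc k0 hc _.
  by rewrite -linv_lact cl1.
(* A counterexample [g] equals [a ^+ k] by injectivity at [v]. Root-closed edge stabilizers then
   make [a] fix the first edge, hence also [v'], which [b] fixes. *)
have aE0 k : 0 < k -> ~ E0 (k%:Z *: rho a)%R.
  move=> k0 [g [Hg gv gv']]; rewrite -rhoX // => e.
  have gE : g = a ^+ k by apply: (@fix_rho_eq _ _ v) e => //; [apply: subgrpX|apply: vactX].
  case eg : (geo v v') => [|x w].
    by apply: nf; exists v; split=> //; rewrite (geo_nil eg).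
  have xw : x \in geo v v' by rewrite eg mem_head.
  have vs : v = lstart x by have := geo_walk v v'; rewrite eg => -[].
  have [||_ av'] := fix_pow a x k Ha k0 xw; last by apply: nf; exists v'.
    by rewrite -gE; apply: (geo_fixed gv gv').
  by left; rewrite -vs.
have bE0 k : 0 < k -> ~ E0 (k%:Z *: rho b)%R.
  move=> k0 [g [Hg gv gv']]; rewrite -rhoX // => e.
  have gE : g = b ^+ k by apply: (@fix_rho_eq _ _ v') e => //; [apply: subgrpX|apply: vactX].
  case/lastP eg : (geo v v') => [|w x].
    by apply: nf; exists v; split=> //; rewrite (geo_nil eg).
  have xw : x \in geo v v' by rewrite eg mem_rcons mem_head.
  have vs : v' = lend x.
    have := geo_walk v v'; rewrite eg -cats1 => /walk_cat[u [_]].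
    by rewrite -/(twalk _ _ _) twalk_cons => -[_ <-].
  have [||bv0 _] := fix_pow b x k Hb k0 xw; last by apply: nf; exists v.
    by rewrite -gE; apply: (geo_fixed gv gv').
  by right; rewrite -vs.
have [c [c0 ac bc]] := separate2 E00 E0D E0N aE0 bE0.
pose chi g : mint := ((rho g *m c) 0 0)%R.
have hchi : hom_on H chi by move=> g h Hg Hh; rewrite /chi rhoM // mulmxDl mxE.
have chi_neq0 g : (rho g *m c != 0)%R -> (chi g : int) <> 0%R.
  by move=> /eqP gc e; apply: gc; apply/matrixP => i j; rewrite !ord1 [LHS]e mxE.
exists (option (edge T)), (tree_hom hH chi v); split; first exact: tree_homM.
exists a, b; split=> //.
rewrite (tree_hom_fix hH hchi v Ha av) (tree_hom_fix hH hchi v Hb bv).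
have -> : wval hH chi v v = 1 by rewrite /wval mulVg fext1.
rewrite mul1g invg1 mulg1; apply: conj_noncommute; try exact: chi_neq0.
rewrite -[fext _ _]/(kill_t _) kill_wval; last first.
  move=> l lw; apply/asboolP => h Hh hl.
  have [hv hv'] : vact h v = v /\ vact h v' = v'.
    by apply: (closest_fix_edge cl lw Hh); apply/lact_eq.
  by rewrite /chi c0 ?mxE //; exists h.
have [red|[w1 [x [y [w2 [h [e Hh hx _ nx]]]]]]] := backtrackP hH v v'.
  move=> /(congr1 (@fword _)); rewrite fword_reduced // fword1.
  case eg : (geo v v') => [|//] _; apply: nf.
  by exists v; split=> //; rewrite (geo_nil eg).
(* The backtracking element fixes an interior vertex, hence the whole geodesic, including the edge
   that it is supposed to move. *)
have [hv hv'] : vact h v = v /\ vact h v' = v'.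
  apply: (@closest_fix_interior _ _ _ _ (rcons w1 x) (y :: w2) (lend x) h cl) => //.
  - by rewrite cat_rcons.
  - by case: (w1).
  - have := geo_walk v v'; rewrite e -cat_rcons => /walk_cat[u [k1 _]].
    move: (k1); rewrite -cats1 => /walk_cat[u2 [k2]].
    rewrite -/(twalk _ _ _) twalk_cons => -[u2x _].
    by apply/walk_cat; exists u2.
move=> _; apply: nx; apply/lact_eq; apply: (geo_fixed hv hv').
by rewrite e mem_cat mem_head orbT.
Qed.

(** If [H] is not [good], an elliptic element shares a fixed vertex with each of its conjugates and
    has the same [rho], so it is central. A commutator has [rho] 0, and is trivial once elliptic.
    The map for trivial [chi] kills it: without backtrack it fixes [v0]; a backtrack provides a
    central elliptic element, and [gate] gives a fixed vertex. *)
Theorem tree_alternative : inhabited (vertex T) -> abelian_on H \/ good H.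
Proof.
move=> [v0]; have [gd|ng] := pselect (good H); [by right|left].
have cfix a b v v' : H a -> H b -> vact a v = v -> vact b v' = v' ->
    exists z, vact a z = z /\ vact b z = z.
  move=> Ha Hb av bv; apply: contrapT => nf; apply: ng.
  have [a1 [b1 [v1 [v1' cl]]]] := closest_ex Ha Hb av bv nf.
  exact: good_of_closest cl.
have central a v : H a -> vact a v = v -> forall h, H h -> commute a h.
  move=> Ha av h Hh; have Hh' := subgrpV hH Hh.
  have Haj : H (h * a * h^-1) by do ?apply: subgrpM.
  have [z [h1 h2]] := cfix _ _ _ _ Ha Haj av (vactJ h av).
  have : h * a * h^-1 = a.
    have Hha := subgrpM hH Hh Ha; apply: (fix_rho_eq Haj Ha h2 h1).
    by rewrite !rhoM ?rhoV // addrAC subrr add0r.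
  by move/(congr1 (fun x => x * h)); rewrite mulgVK.
move=> h k Hh Hk; pose c := [~ h, k].
have Hc : H c by rewrite /c /commg; apply: (subgrpM hH); [exact: (subgrpV hH)|exact: (subgrpJ hH)].
suff c1 : c = 1 by apply/commgP/eqP.
have rc : rho c = 0%R.
  have Vh := subgrpV hH Hh; have Vk := subgrpV hH Hk.
  rewrite /c /commg /conjg !rhoM ?rhoV //; do ?apply: (subgrpM hH) => //.
  by rewrite [in X in (_ + X)%R]addrC addrK addNr.
have [fc|nfc] := pselect (exists v, vact c v = v).
  by have [v cv] := fc; apply: rho_inj cv rc.
exfalso; have h1M : hom_on H (fun=> 1 : mint) by move=> *; rewrite mulg1.
have hom := tree_homM hH h1M v0.
have c1 : tree_hom hH (fun=> 1) v0 c = 1.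
  rewrite /c (hom_onR hH hom) //; apply/eqP/commgP; apply: contrapT => nc; apply: ng.
  by exists (option (edge T)), (tree_hom hH (fun=> 1) v0); split=> //; exists h, k.
apply: nfc.
have [red|[w1 [x [y [w2 [g [e Hg gx yE nx]]]]]]] := backtrackP hH v0 (vact c v0).
  by exists v0; apply: tree_hom_trivial c1 red.
exists (lend x).
have lgx : lact g x <> x by move/lact_eq.
apply: (gate e erefl (central _ _ Hg gx _ Hc) gx lgx).
by rewrite yE -linv_lact => /(can_inj (@linvK _)) /lact_inj.
Qed.

End TreeAction.

(** A free action has no backtracks, so the map for trivial [chi] has trivial kernel, and its target
    is torsion free. *)
Lemma free_action_torsion (G : groupType) (T : tree G) (H : G -> Prop) d k :
  subgrp H -> inhabited (vertex T) ->
  (forall h (v : vertex T), H h -> vact h v = v -> h = 1) ->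
  H d -> 0 < k -> d ^+ k = 1 -> d = 1.
Proof.
move=> hH [v0] fr Hd k0 dk.
have h1M : hom_on H (fun=> 1 : mint) by move=> *; rewrite mulg1.
have hom := tree_homM hH h1M v0.
apply: (fr _ v0 Hd); apply: (@tree_hom_trivial _ _ H hH).
  by apply: (free_torsion k0); rewrite -(hom_onX hH hom) // dk (hom_on1 hH hom).
have [//|[w1 [x [y [w2 [h [e Hh hx _ nx]]]]]]] := backtrackP hH v0 (vact d v0).
by case: nx; rewrite (fr _ _ Hh hx) eact1.
Qed.

(** * Presented groups and semidirect products *)

Section SetoidQuotient.
Variable S : sgroup.
Implicit Types x y : S.

Definition choose_in (P : S -> Prop) (h : exists x, P x) : S := projT1 (cid h).
Lemma choose_in_eq P Q (hP : exists x, P x) (hQ : exists x, Q x) :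
  P = Q -> choose_in hP = choose_in hQ.
Proof. by move=> e; case: Q / e hQ => hQ; congr choose_in; apply: Prop_irrelevance. Qed.

(** Equivalent elements have extensionally equal classes, so the choice made in the class depends on
    the class alone. This replaces the setoid equality by Leibniz equality. *)
Definition canon x := choose_in (ex_intro (geq x) x (geq_refl x)).

Lemma canonP x : geq x (canon x).
Proof. exact: projT2 (cid (ex_intro (geq x) x (geq_refl x))). Qed.

Lemma canonE x y : geq x y -> canon x = canon y.
Proof.
move=> xy; apply/choose_in_eq/predeqP => z; split; last exact: geq_trans xy.
exact/geq_trans/geq_sym.
Qed.

Definition gquot := {x : {classic S} | `[< canon x = x >]}.
HB.instance Definition _ := Choice.on gquot.

Lemma canonK x : `[< canon (canon x) = canon x >].
Proof. by apply/asboolP/canonE/geq_sym/canonP. Qed.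

Definition gcl x : gquot := exist _ (canon x : {classic S}) (canonK x).
Definition grepr (a : gquot) : S := val a.

Lemma gclP x y : gcl x = gcl y <-> geq x y.
Proof.
split=> [/(congr1 grepr) /= e|xy]; last by apply: val_inj => /=; apply: canonE.
by apply: geq_trans (canonP x) _; rewrite [canon x]e; apply/geq_sym/canonP.
Qed.

Lemma greprK a : gcl (grepr a) = a.
Proof. by case: a => x hx; apply: val_inj; have /asboolP := hx. Qed.

Lemma grepr_gcl x : geq (grepr (gcl x)) x.
Proof. exact/geq_sym/canonP. Qed.

Definition gquotM a b := gcl (gmul (grepr a) (grepr b)).
Definition gquotV a := gcl (ginv (grepr a)).
Definition gquot1 := gcl (gone S).

Lemma gquotM_gcl x y : gquotM (gcl x) (gcl y) = gcl (gmul x y).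
Proof. by apply/gclP/gmul_compat; apply: grepr_gcl. Qed.
Lemma gquotV_gcl x : gquotV (gcl x) = gcl (ginv x).
Proof. exact/gclP/ginv_compat/grepr_gcl. Qed.

Lemma gquotMA : associative gquotM.
Proof.
move=> a b c; rewrite -(greprK a) -(greprK b) -(greprK c) !gquotM_gcl.
exact/gclP/gmulA.
Qed.
Lemma gquot1M : left_id gquot1 gquotM.
Proof. by move=> a; rewrite -(greprK a) gquotM_gcl; apply/gclP/gmul1. Qed.
Lemma gquotVM : left_inverse gquot1 gquotV gquotM.
Proof. by move=> a; rewrite -(greprK a) gquotV_gcl gquotM_gcl; apply/gclP/gmulV. Qed.
Lemma gquotMV : right_inverse gquot1 gquotV gquotM.
Proof.
move=> a; rewrite -[LHS]gquot1M -{1}(gquotVM (gquotV a)) -gquotMA.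
by rewrite (gquotMA (gquotV a)) gquotVM gquot1M gquotVM.
Qed.
Lemma gquotM1 : right_id gquot1 gquotM.
Proof. by move=> a; rewrite -(gquotVM a) gquotMA gquotMV gquot1M. Qed.
HB.instance Definition _ := isGroup.Build gquot gquotMA gquot1M gquotM1 gquotVM gquotMV.

Lemma gclM x y : gcl (gmul x y) = gcl x * gcl y.
Proof. by rewrite -gquotM_gcl. Qed.
Lemma gclV x : gcl (ginv x) = (gcl x)^-1.
Proof. by rewrite -gquotV_gcl. Qed.

End SetoidQuotient.

Section Presentation.
Variables (X : choiceType) (R : word X -> word X -> Prop).

Definition presg := gquot (pres_group R).
HB.instance Definition _ := Group.on presg.
Definition pcl (w : word X) : presg := @gcl (pres_group R) w.
Definition pgen x : presg := pcl [:: (x, true)].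

Lemma pclP w u : pcl w = pcl u <-> pres_eq R w u.
Proof. exact: gclP. Qed.

Lemma pcl_surj (a : presg) : exists w, a = pcl w.
Proof. by exists (grepr a); rewrite /pcl greprK. Qed.

Lemma pcl_cat w u : pcl (w ++ u) = pcl w * pcl u.
Proof. exact: (@gclM (pres_group R)). Qed.

Lemma pcl_letter l : pcl [:: l] = eletter pgen l.
Proof.
case: l => x []; rewrite /eletter //=.
by rewrite -[RHS](@gclV (pres_group R)).
Qed.

Lemma pclE w : pcl w = \prod_(l <- w) eletter pgen l.
Proof.
elim: w => [|l w IH]; first by rewrite big_nil.
by rewrite big_cons -cat1s pcl_cat IH pcl_letter.
Qed.

Lemma pcl_rel l r : R l r -> pcl l = pcl r.
Proof. by move=> lr; apply/pclP; have := pe_rel [::] [::] lr; rewrite /= !cats0. Qed.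

Lemma pres_ind (K : presg -> Prop) : subgrp K -> (forall x, K (pgen x)) -> forall a, K a.
Proof.
move=> hK Kg a; have [w ->] := pcl_surj a; rewrite pclE.
elim: w => [|[x b] w IH]; first by rewrite big_nil; apply: subgrp1.
rewrite big_cons; apply: subgrpM => //; case: b; first exact: Kg.
exact: (subgrpV hK (Kg x)).
Qed.

Section Ext.
Variables (L : groupType) (h : X -> L).
Definition weval (w : word X) : L := \prod_(l <- w) eletter h l.
Hypothesis hrel : forall l r, R l r -> weval l = weval r.

Lemma weval_cat w u : weval (w ++ u) = weval w * weval u.
Proof. by rewrite /weval big_cat. Qed.

Lemma weval_pres w u : pres_eq R w u -> weval w = weval u.
Proof.
elim=> // [? ? ? _ -> _ -> //|u' v x b|u' v l r lr].
- rewrite !weval_cat; congr (_ * _); rewrite {1}/weval !big_cons big_nil mulg1.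
  by rewrite -[(x, ~~ b)]/(linv (x, b)) eletterV mulgV mul1g.
- by rewrite !weval_cat (hrel lr).
Qed.

Definition pext (a : presg) : L := weval (grepr a).

Lemma pext_cl w : pext (pcl w) = weval w.
Proof. by apply: weval_pres; apply: (@grepr_gcl (pres_group R)). Qed.

Lemma pextM : {morph pext : a b / a * b}.
Proof.
move=> a b; have [w ->] := pcl_surj a; have [u ->] := pcl_surj b.
by rewrite -pcl_cat !pext_cl weval_cat.
Qed.

Lemma pext_gen x : pext (pgen x) = h x.
Proof. by rewrite pext_cl /weval big_cons big_nil mulg1. Qed.

End Ext.

Lemma pres_hom_eq (L : groupType) (f g : presg -> L) :
  {morph f : x y / x * y} -> {morph g : x y / x * y} ->
  (forall x, f (pgen x) = g (pgen x)) -> f =1 g.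
Proof.
move=> fM gM e; apply: pres_ind => //; split.
- by rewrite (morphg1 fM) (morphg1 gM).
- by move=> x y fx fy; rewrite fM gM fx fy.
- by move=> x fx; rewrite (morphgV fM) (morphgV gM) fx.
Qed.

End Presentation.

Record gaction (N Q : groupType) := GAction {
  gact :> Q -> N -> N;
  gactM : forall q, {morph gact q : n m / n * m};
  gact_id : forall n, gact 1 n = n;
  gact_comp : forall q r n, gact (q * r) n = gact q (gact r n) }.

Section Semidirect.
Variables (N Q : groupType).

Definition sdprod of gaction N Q : Type := (N * Q)%type.
HB.instance Definition _ b := Choice.on (sdprod b).

Variable a : gaction N Q.
Definition sdprodM (x y : sdprod a) : sdprod a := (x.1 * a x.2 y.1, x.2 * y.2).
Definition sdprodV (x : sdprod a) : sdprod a := (a x.2^-1 x.1^-1, x.2^-1).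
Definition sdprod1 : sdprod a := (1, 1).

Lemma gact1 q : a q 1 = 1. Proof. exact: morphg1 (gactM a q). Qed.

Lemma sdprodMA : associative sdprodM.
Proof. by move=> x y z; rewrite /sdprodM /= gactM gact_comp !mulgA. Qed.
Lemma sdprod1M : left_id sdprod1 sdprodM.
Proof. by case=> n q; rewrite /sdprodM /= gact_id !mul1g. Qed.
Lemma sdprodM1 : right_id sdprod1 sdprodM.
Proof. by case=> n q; rewrite /sdprodM /= gact1 !mulg1. Qed.
Lemma sdprodVM : left_inverse sdprod1 sdprodV sdprodM.
Proof. by case=> n q; rewrite /sdprodM /= -gactM mulVg gact1 mulVg. Qed.
Lemma sdprodMV : right_inverse sdprod1 sdprodV sdprodM.
Proof. by case=> n q; rewrite /sdprodM /= -gact_comp mulgV gact_id !mulgV. Qed.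
HB.instance Definition _ := isGroup.Build (sdprod a) sdprodMA sdprod1M sdprodM1 sdprodVM sdprodMV.

Lemma sdprod_mulE (x y : sdprod a) : x * y = (x.1 * a x.2 y.1, x.2 * y.2). Proof. by []. Qed.

End Semidirect.

Section FreeAction.
Variables (X : choiceType) (Q : groupType) (act : Q -> X -> X).
Hypotheses (act1 : forall x, act 1 x = x) (actM : forall q r x, act (q * r) x = act q (act r x)).

Definition fmap q : free X -> free X := fext (fun x => fgen (act q x)).

Lemma fmapM q : {morph fmap q : f g / f * g}. Proof. exact: fextM. Qed.
Lemma fmapg1 q : fmap q 1 = 1. Proof. exact: fext1. Qed.
Lemma fmapV q f : fmap q f^-1 = (fmap q f)^-1. Proof. exact: fextV. Qed.
Lemma fmap_gen q x : fmap q (fgen x) = fgen (act q x). Proof. exact: fext_gen. Qed.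

Lemma fmap1 f : fmap 1 f = f.
Proof.
by apply: (@free_hom_eq _ _ (fmap 1) id) => // [|x]; [apply: fmapM|rewrite fmap_gen act1].
Qed.

Lemma fmap_comp q r f : fmap (q * r) f = fmap q (fmap r f).
Proof.
apply: (@free_hom_eq _ _ (fmap (q * r)) (fmap q \o fmap r)) => [|f1 f2|x].
- exact: fmapM.
- by rewrite /= !fmapM.
- by rewrite /= !fmap_gen actM.
Qed.

Definition free_action : gaction (free X) Q := GAction fmapM fmap1 fmap_comp.

End FreeAction.

(** * The tree of an amalgam *)

Section CosetType.
Variables (G : groupType) (C : G -> Prop) (hC : subgrp C).
Implicit Types g h : G.

Lemma in_coset_ex g : exists h, `[< C (g^-1 * h) >].
Proof. by exists g; apply/asboolP; rewrite mulVg; apply: subgrp1. Qed.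

Definition coset_rep g := xchoose (in_coset_ex g).

Lemma coset_repP g : C (g^-1 * coset_rep g).
Proof. by have /asboolP := xchooseP (in_coset_ex g). Qed.

Lemma coset_repE g h : C (g^-1 * h) -> coset_rep g = coset_rep h.
Proof.
move=> gh; have hg : C (h^-1 * g) by have := subgrpV hC gh; rewrite invgM invgK.
apply: eq_xchoose => z; apply/asboolP/asboolP => Cz.
- by have := subgrpM hC hg Cz; rewrite mulgA mulgK.
- by have := subgrpM hC gh Cz; rewrite mulgA mulgK.
Qed.

Definition coset := {g : G | coset_rep g == g}.
HB.instance Definition _ := Choice.on coset.

Lemma coset_repK g : coset_rep (coset_rep g) == coset_rep g.
Proof. by apply/eqP/esym/coset_repE/coset_repP. Qed.
Definition coset_of g : coset := exist _ (coset_rep g) (coset_repK g).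

Lemma coset_ofP g h : coset_of g = coset_of h <-> C (g^-1 * h).
Proof.
split=> [/(congr1 val) /= e|gh]; last by apply: val_inj; apply: coset_repE.
have := subgrpM hC (coset_repP g) (subgrpV hC (coset_repP h)).
by rewrite e invgM invgK mulgA mulgK.
Qed.

Lemma coset_ofK (c : coset) : coset_of (val c) = c.
Proof. by apply: val_inj; case: c => g /= /eqP. Qed.

Definition coset_act g (c : coset) := coset_of (g * val c).

Lemma coset_act_of g h : coset_act g (coset_of h) = coset_of (g * h).
Proof. by apply/coset_ofP; rewrite invgM -mulgA mulKg; apply/coset_ofP/coset_ofK. Qed.

Lemma coset_act1 c : coset_act 1 c = c.
Proof. by rewrite -(coset_ofK c) coset_act_of mul1g. Qed.
Lemma coset_actM g h c : coset_act (g * h) c = coset_act g (coset_act h c).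
Proof. by rewrite -(coset_ofK c) !coset_act_of mulgA. Qed.

Lemma coset_act_fix g h : coset_act g (coset_of h) = coset_of h <-> C (g ^ h).
Proof.
rewrite coset_act_of; split=> [/esym/coset_ofP|gh]; first by [].
exact/esym/coset_ofP.
Qed.

End CosetType.

Section AmalgamTree.
Variables (G : groupType) (A B C : G -> Prop).
Hypotheses (hA : subgrp A) (hB : subgrp B) (hC : subgrp C).
Hypotheses (CA : forall g, C g -> A g) (CB : forall g, C g -> B g).
Hypothesis genAB : forall K : G -> Prop, subgrp K -> (forall g, A g -> K g) ->
  (forall g, B g -> K g) -> forall g, K g.
Let E := coset hC.
Let eg (g : G) : free E := fgen (coset_of hC g).
Let eact0 := @coset_act _ _ hC.
Variable kappa : G -> free E.
Hypothesis kappaM : forall g h, kappa (g * h) = kappa g * fmap eact0 g (kappa h).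
Hypothesis kappaA : forall a, A a -> kappa a = 1.
Hypothesis kappaB : forall b, B b -> kappa b = eg 1 * (eg b)^-1.

Let V := (coset hA + coset hB)%type.
Definition am_vact (g : G) (v : V) : V :=
  match v with inl a => inl (coset_act g a) | inr b => inr (coset_act g b) end.
Definition am_src (e : E) : V := inl (coset_of hA (val e)).
Definition am_tgt (e : E) : V := inr (coset_of hB (val e)).
(** [kappa g] is the label of a walk from the base coset of [A] to its translate by [g]. For [b] in
    [B] this walk crosses the base edge and comes back along its translate by [b], which is
    [kappaB]; the crossed homomorphism rule translates the second part of a walk. *)
Definition am_pos (v : V) : free E :=
  match v with inl a => kappa (val a) | inr b => kappa (val b) * eg (val b) end.

Lemma am_src_of g : am_src (coset_of hC g) = inl (coset_of hA g).
Proof. by congr inl; apply/coset_ofP/CA/(coset_ofP hC)/coset_ofK. Qed.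
Lemma am_tgt_of g : am_tgt (coset_of hC g) = inr (coset_of hB g).
Proof. by congr inr; apply/coset_ofP/CB/(coset_ofP hC)/coset_ofK. Qed.

Lemma fmap_eg g h : fmap eact0 g (eg h) = eg (g * h).
Proof. by rewrite fmap_gen /eact0 coset_act_of. Qed.

Lemma am_pos_l g : am_pos (inl (coset_of hA g)) = kappa g.
Proof.
rewrite /=; have := coset_repP hA g; set h := coset_rep hA g => gh.
by rewrite -(mulVKg g h) kappaM (kappaA gh) fmapg1 mulg1.
Qed.

Lemma am_pos_r g : am_pos (inr (coset_of hB g)) = kappa g * eg g.
Proof.
rewrite /=; have := coset_repP hB g; set h := coset_rep hB g => gh.
rewrite -(mulVKg g h) kappaM (kappaB gh) fmapM fmapV !fmap_eg mulg1.
by rewrite !mulgA mulgVK.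
Qed.

Lemma am_vact1 v : am_vact 1 v = v.
Proof. by case: v => c /=; rewrite coset_act1. Qed.
Lemma am_vactM g h v : am_vact (g * h) v = am_vact g (am_vact h v).
Proof. by case: v => c /=; rewrite coset_actM. Qed.
Lemma am_src_act g e : am_src (coset_act g e) = am_vact g (am_src e).
Proof. by rewrite -(coset_ofK e) coset_act_of !am_src_of /= coset_act_of. Qed.
Lemma am_tgt_act g e : am_tgt (coset_act g e) = am_vact g (am_tgt e).
Proof. by rewrite -(coset_ofK e) coset_act_of !am_tgt_of /= coset_act_of. Qed.
Lemma am_pos_tgt e : am_pos (am_tgt e) = am_pos (am_src e) * fgen e.
Proof. by rewrite -(coset_ofK e) am_src_of am_tgt_of am_pos_l am_pos_r. Qed.

Lemma am_walk_act g v w v' : walk am_src am_tgt v w v' ->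
  exists w', walk am_src am_tgt (am_vact g v) w' (am_vact g v').
Proof.
elim: w v => [|[e b] w IH] v /=; first by move->; exists [::].
case=> -> /IH[w' h]; exists ((coset_act g e, b) :: w'); split.
  by case: b {h}; rewrite /lsrc /= ?am_src_act ?am_tgt_act.
by move: h; case: b; rewrite /lsrc /= ?am_src_act ?am_tgt_act.
Qed.

(** The elements whose translate of the base vertex is joined to it form a subgroup. It contains
    [A], which fixes this vertex, and [B], by a path of two edges. *)
Lemma am_connected v v' : exists w, walk am_src am_tgt v w v'.
Proof.
pose o : V := inl (coset_of hA 1).
have act_o g : am_vact g o = inl (coset_of hA g) by rewrite /= coset_act_of mulg1.
pose K g := exists w, walk am_src am_tgt o w (am_vact g o).
have KG : forall g, K g.
  apply: genAB => [|a Aa|b Bb].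
  - split=> [|g h [w1 k1] [w2 k2]|g [w k]]; first by exists [::]; rewrite am_vact1.
      have [w3 k3] := am_walk_act g k2; exists (w1 ++ w3); apply/walk_cat.
      by exists (am_vact g o); rewrite am_vactM.
    have [w' k'] := am_walk_act g^-1 k; exists (invword w'); apply: walk_inv.
    by rewrite -am_vactM mulVg am_vact1 in k'.
  - by exists [::]; rewrite act_o /=; congr inl; apply/coset_ofP; rewrite invg1 mul1g.
  - exists [:: (coset_of hC 1, true); (coset_of hC b, false)].
    rewrite act_o /= /lsrc /= !am_src_of !am_tgt_of; split=> //; split=> //.
    by congr inr; apply/coset_ofP; rewrite invg1 mul1g.
have from_o u : exists w, walk am_src am_tgt o w u.
  case: u => c; rewrite -(coset_ofK c); have [w k] := KG (val c).
    by exists w; rewrite -act_o.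
  exists (w ++ [:: (coset_of hC (val c), true)]); apply/walk_cat.
  exists (inl (coset_of hA (val c))); rewrite -act_o; split=> //=.
  by rewrite /lsrc /= am_src_of am_tgt_of -act_o.
have [w1 k1] := from_o v; have [w2 k2] := from_o v'.
by exists (invword w1 ++ w2); apply/walk_cat; exists o; split=> //; apply: walk_inv.
Qed.

Definition amalgam_tree : tree G := @Tree G E V eact0 am_vact am_src am_tgt am_pos
  (@coset_act1 _ _ hC) (@coset_actM _ _ hC) am_vact1 am_vactM am_src_act am_tgt_act
  am_pos_tgt am_connected.

Lemma amalgam_stab (v : vertex amalgam_tree) : exists h,
  (forall g, vact g v = v -> A (g ^ h)) \/ (forall g, vact g v = v -> B (g ^ h)).
Proof.
case: v => c; rewrite -(coset_ofK c); exists (val c).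
  left=> g h; apply/(coset_act_fix hA); exact: (@inl_inj _ (coset hB)).
right=> g h; apply/(coset_act_fix hB); exact: (@inr_inj (coset hA)).
Qed.

Lemma amalgam_edge_stab (g : G) (e : edge amalgam_tree) : eact g e = e ->
  exists h, C (g ^ h).
Proof. by rewrite -(coset_ofK e) => /coset_act_fix gc; exists (val e). Qed.

Lemma amalgam_edge_roots (g : G) (l : edge amalgam_tree * bool) k :
  (forall a, A a -> C (a ^+ k) -> C a) -> (forall b, B b -> C (b ^+ k) -> C b) ->
  vact g (lstart l) = lstart l -> lact (g ^+ k) l = l -> lact g l = l.
Proof.
move=> rA rB; case: l => e b; rewrite -(coset_ofK e) => hl.
move=> /lact_eq /coset_act_fix; rewrite conjXg => gk; apply/lact_eq/coset_act_fix.
case: b hl => hl; [apply: rA gk|apply: rB gk].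
  apply/(coset_act_fix hA); apply: (@inl_inj _ (coset hB)).
  by rewrite -[LHS]/(am_vact g (inl _)) -am_src_of.
apply/(coset_act_fix hB); apply: (@inr_inj (coset hA)).
by rewrite -[LHS]/(am_vact g (inr _)) -am_tgt_of.
Qed.

End AmalgamTree.

(** * Even Artin groups and their retractions *)

Section Artin.
Variables (V : finType) (m : V -> V -> nat).
Hypothesis hm : is_EAFC m.
Implicit Types (x y z u v : V) (S X Y : {set V}).

Definition artin := presg (artin_rel m).
HB.instance Definition _ := Group.on artin.
Implicit Types (a b g h : artin).
Definition gen x : artin := pgen (artin_rel m) x.

Lemma label_sym x y : m x y = m y x. Proof. by case: hm => -[]. Qed.
Lemma label_diag x : m x x = 0%N. Proof. by case: hm => -[_ []]. Qed.
Lemma label_half x y : m x y = (m x y)./2.*2.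
Proof. by case: hm => _ [even _]; rewrite even_halfK. Qed.

Lemma half_label_gt0 x y : m x y <> 0%N -> 0 < (m x y)./2.
Proof. by have := label_half x y; case: (m x y)./2 => // ->. Qed.

Lemma weval_alt_word (L : groupType) (f : V -> L) x y k :
  weval f (alt_word x y k.*2) = (f x * f y) ^+ k.
Proof.
rewrite /weval /alt_word /mkseq; elim: k => [|k IH]; first by rewrite big_nil.
rewrite doubleS -addn2 iotaD map_cat big_cat IH expgSr /=; congr (_ * _).
by rewrite add0n /= odd_double /= !big_cons big_nil mulg1.
Qed.

Definition braid_on (L : groupType) (f : V -> L) :=
  forall x y, m x y <> 0%N -> (f x * f y) ^+ (m x y)./2 = (f y * f x) ^+ (m x y)./2.

Section Ext.
Variables (L : groupType) (f : V -> L).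
Hypothesis hf : braid_on f.

Lemma braid_rel l r : artin_rel m l r -> weval f l = weval f r.
Proof.
case=> x [y [xy [-> ->]]]; rewrite (label_half x y) !weval_alt_word.
exact: hf.
Qed.

Definition aext : artin -> L := pext f.
Lemma aextM : {morph aext : a b / a * b}. Proof. exact: pextM braid_rel. Qed.
Lemma aext_gen x : aext (gen x) = f x. Proof. exact: pext_gen braid_rel _. Qed.
End Ext.

Lemma artin_ind (K : artin -> Prop) : subgrp K -> (forall x, K (gen x)) -> forall a, K a.
Proof. exact: pres_ind. Qed.

Lemma artin_hom_eq (L : groupType) (f g : artin -> L) :
  {morph f : x y / x * y} -> {morph g : x y / x * y} ->
  (forall x, f (gen x) = g (gen x)) -> f =1 g.
Proof. exact: pres_hom_eq. Qed.

Lemma braid_gen : braid_on gen.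
Proof.
move=> x y xy.
have E z t k : (gen z * gen t) ^+ k = pcl (artin_rel m) (alt_word z t k.*2).
  by rewrite pclE -[RHS]/(weval gen _) weval_alt_word.
by rewrite !E -label_half; apply: pcl_rel; exists x, y.
Qed.

Lemma gen_commute x y : m x y = 2 -> commute (gen x) (gen y).
Proof. by move=> xy; have := @braid_gen x y; rewrite xy; apply. Qed.

(** This is where evenness acts: when one generator of an even braid relation is sent to 1, both
    sides become the same power of the other, so the retractions exist. *)
Lemma braid_one (L : groupType) (a : L) k : (a * 1) ^+ k = (1 * a) ^+ k.
Proof. by rewrite mulg1 mul1g. Qed.

Definition ret_gen S x : artin := if x \in S then gen x else 1.

Lemma ret_braid S : braid_on (ret_gen S).
Proof.
move=> x y xy; rewrite /ret_gen; case: ifP => _; case: ifP => _; rewrite ?braid_one //.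
exact: braid_gen.
Qed.

Definition ret S : artin -> artin := aext (ret_gen S).

Lemma retM S : {morph ret S : a b / a * b}. Proof. exact: aextM (ret_braid S). Qed.
Lemma ret_genE S x : ret S (gen x) = if x \in S then gen x else 1.
Proof. exact: aext_gen (ret_braid S) x. Qed.
Lemma ret1 S : ret S 1 = 1. Proof. exact: morphg1 (retM S). Qed.
Lemma retV S a : ret S a^-1 = (ret S a)^-1. Proof. exact: morphgV (retM S) _. Qed.
Lemma retX S a k : ret S (a ^+ k) = ret S a ^+ k. Proof. exact: morphgX (retM S) _ _. Qed.
Lemma retJ S a b : ret S (a ^ b) = ret S a ^ ret S b.
Proof. by rewrite /conjg !retM retV. Qed.

Lemma ret_ret S X a : ret S (ret X a) = ret (S :&: X) a.
Proof.
apply: (@artin_hom_eq _ (ret S \o ret X) (ret (S :&: X))) => [g h|g h|x].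
- by rewrite /= !retM.
- exact: retM.
- by rewrite /= !ret_genE inE; case: ifP; rewrite ?andbF ?ret1 // ret_genE andbT.
Qed.

Lemma retT a : ret setT a = a.
Proof.
by apply: (@artin_hom_eq _ (ret setT) id) => // [|x]; [apply: retM|rewrite ret_genE inE].
Qed.

Lemma ret0 a : ret set0 a = 1.
Proof.
apply: (@artin_hom_eq _ (ret set0) (fun=> 1)) => [|g h|x]; first exact: retM.
- by rewrite mulg1.
- by rewrite ret_genE inE.
Qed.

Definition parab S a := ret S a = a.

Lemma parab_subgrp S : subgrp (parab S).
Proof.
split=> [|a b|a]; rewrite /parab; first exact: ret1.
- by move=> ha hb; rewrite retM ha hb.
- by move=> ha; rewrite retV ha.
Qed.

Lemma parab_ret S a : parab S (ret S a).
Proof. by rewrite /parab ret_ret setIid. Qed.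

Lemma parabS S X a : S \subset X -> parab S a -> parab X a.
Proof. by move=> /setIidPr SX <-; rewrite /parab ret_ret SX. Qed.

Section Join.
Variables (X Y : {set V}).
Hypothesis XY2 : forall x y, x \in X -> y \in Y -> m x y = 2.

Lemma ret_commute a b : commute (ret X a) (ret Y b).
Proof.
have cK (P : artin -> Prop) Z : subgrp (fun c => forall t, P t -> commute (ret Z c) t).
  split=> [t _|c d hc hd t Pt|c hc t Pt]; rewrite ?ret1 ?retM ?retV.
  - exact/commute_sym/commute1.
  - by apply/commute_sym/commuteM; apply/commute_sym; [apply: hc|apply: hd].
  - by apply/commute_sym/commuteV/commute_sym/hc.
suff h x : forall t, (exists d, t = ret Y d) -> commute (ret X (gen x)) t.
  by apply: (artin_ind (cK (fun t => exists d, t = ret Y d) X) h a); exists b.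
move=> _ [d ->]; apply/commute_sym.
have [t te] : exists t, t = ret X (gen x) by exists (ret X (gen x)).
rewrite -te.
apply: (artin_ind (cK (fun t' => t' = t) Y) _ d) => // y _ ->; rewrite te !ret_genE.
case: ifP => yY; last exact/commute_sym/commute1.
case: ifP => xX; last exact: commute1.
by apply: gen_commute; rewrite label_sym; apply: XY2.
Qed.

Lemma ret_join a : ret (X :|: Y) a = ret X a * ret Y a.
Proof.
apply: (@artin_hom_eq _ (ret (X :|: Y)) (fun a => ret X a * ret Y a)) => [|g h|x].
- exact: retM.
- by rewrite !retM -!mulgA; congr (_ * _); rewrite !mulgA; congr (_ * _); apply: ret_commute.
- rewrite !ret_genE inE; case xX: (x \in X); case xY: (x \in Y); rewrite ?mulg1 ?mul1g //.
  by have := XY2 xX xY; rewrite label_diag.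
Qed.

End Join.

Definition expo x : artin -> mint := aext (fun y => if y == x then mone else 1).

Lemma mint_commute (i j : mint) : i * j = j * i. Proof. exact: (addrC (i : int) j). Qed.

Lemma expo_braid x : braid_on (fun y => if y == x then mone else 1).
Proof. by move=> y z _; rewrite mint_commute. Qed.

Lemma expoM x : {morph expo x : a b / a * b}. Proof. exact: aextM (expo_braid x). Qed.
Lemma expo_gen x y : expo x (gen y) = if y == x then mone else 1.
Proof. exact: aext_gen (expo_braid x) y. Qed.

Lemma expo_ret x S a : x \in S -> expo x (ret S a) = expo x a.
Proof.
move=> xS; apply: (@artin_hom_eq _ (expo x \o ret S) (expo x)) => [g h||y].
- by rewrite /= retM expoM.
- exact: expoM.
- rewrite /= ret_genE; case: ifPn => // yS; rewrite (morphg1 (expoM x)) expo_gen.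
  by case: eqP => // yx; rewrite yx xS in yS.
Qed.

Lemma expo_ret0 x S a : x \notin S -> expo x (ret S a) = 1.
Proof.
move=> xS; apply: (@artin_hom_eq _ (expo x \o ret S) (fun=> 1)) => [g h|g h|y].
- by rewrite /= retM expoM.
- by rewrite mulg1.
- rewrite /= ret_genE; case: ifPn => yS; last exact: (morphg1 (expoM x)).
  by rewrite expo_gen; case: eqP => // yx; rewrite -yx yS in xS.
Qed.

Lemma ret_single x a : ret [set x] a = expgz (gen x) (expo x a).
Proof.
apply: (@artin_hom_eq _ (ret [set x]) (fun a => expgz (gen x) (expo x a))) => [|g h|y].
- exact: retM.
- by rewrite expoM; apply: expgzD.
- by rewrite ret_genE expo_gen inE; case: eqP => [->|].
Qed.

Section AmalgamParab.
Variables (S : {set V}) (u v : V).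
Hypotheses (uv : u <> v) (muv : m u v = 0%N) (uS : u \in S).

(** The preimage under [ret S] of a parabolic subgroup: the whole Artin group acts on the tree of
    [S] through [ret S], and no group type for the parabolic subgroup of [S] has to be formed. *)
Definition amA a := ret (S :\ u) a = ret S a.
Definition amB a := ret (S :\ v) a = ret S a.
Definition amC a := ret (S :\ u :\ v) a = ret S a.

Lemma ret_equalizer_subgrp X Y : subgrp (fun a => ret X a = ret Y a).
Proof. by split=> [|a b ea eb|a ea]; rewrite ?ret1 ?retM ?retV ?ea ?eb. Qed.
Lemma amA_subgrp : subgrp amA. Proof. exact: ret_equalizer_subgrp. Qed.
Lemma amB_subgrp : subgrp amB. Proof. exact: ret_equalizer_subgrp. Qed.
Lemma amC_subgrp : subgrp amC. Proof. exact: ret_equalizer_subgrp. Qed.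

Lemma amCA a : amC a -> amA a.
Proof.
rewrite /amC /amA => h; have := congr1 (ret (S :\ u)) h; rewrite !ret_ret.
have -> : (S :\ u) :&: (S :\ u :\ v) = S :\ u :\ v by apply/setIidPr/subD1set.
by rewrite (setIidPl (subD1set _ _)) h => ->.
Qed.

Lemma amCB a : amC a -> amB a.
Proof.
rewrite /amC /amB => h; have := congr1 (ret (S :\ v)) h; rewrite !ret_ret.
have -> : (S :\ v) :&: (S :\ u :\ v) = S :\ u :\ v.
  by apply/setP => z; rewrite !inE; do !case: (_ == _); do !case: (_ \in _).
by rewrite (setIidPl (subD1set _ _)) h => ->.
Qed.

Lemma am_gen (K : artin -> Prop) : subgrp K -> (forall g, amA g -> K g) ->
  (forall g, amB g -> K g) -> forall g, K g.
Proof.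
move=> hK AK BK; apply: artin_ind => // x.
have [->|xu] := eqVneq x u; first by apply: BK; rewrite /amB !ret_genE !inE uS andbT; case: eqP.
by apply: AK; rewrite /amA !ret_genE !inE xu.
Qed.

Let E := coset amC_subgrp.
Let co g : E := coset_of amC_subgrp g.
Let act := free_action (@coset_act1 _ _ amC_subgrp) (@coset_actM _ _ amC_subgrp).
Let P : groupType := sdprod act.

(** The conjugate of [(1, g)] by the free letter of the base edge. *)
Definition am_conj g : P := (fgen (co 1) * (fgen (co g))^-1, g).

Lemma am_conjM : {morph am_conj : g h / g * h}.
Proof.
move=> g h; rewrite sdprod_mulE; congr pair; rewrite /= fmapM fmapV !fmap_gen.
by rewrite /co !coset_act_of mulg1 !mulgA mulgVK.
Qed.

Definition am_inj g : P := (1, g).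
Lemma am_injM : {morph am_inj : g h / g * h}.
Proof. by move=> g h; rewrite sdprod_mulE /= fmapg1 mulg1. Qed.

(** The plain inclusion on the generators of the factor without [u], and its conjugate by the base
    letter on those of the factor without [v]. Both agree on [amC], which fixes the base edge, so
    only [u] is treated apart; no relation involves both [u] and [v]. The first coordinate of the
    resulting homomorphism is the crossed homomorphism [am_kappa]. *)
Definition am_map_gen x : P := if x == u then am_conj (gen x) else am_inj (ret_gen S x).

Lemma am_conj_amC g : amC g -> am_conj g = am_inj g.
Proof.
move=> gC; congr pair; have -> : co g = co 1 by apply/coset_ofP; rewrite mulg1; apply: subgrpV amC_subgrp _ gC.
by rewrite mulgV.
Qed.

Lemma ret_gen_amC x : x <> u -> x <> v -> amC (ret_gen S x).
Proof.
move=> /eqP xu /eqP xv; rewrite /ret_gen; case: ifP => xS; last exact: (subgrp1 amC_subgrp).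
by rewrite /amC !ret_genE !inE xu xv xS.
Qed.

Lemma am_map_braid : braid_on am_map_gen.
Proof.
have main y : m u y <> 0%N -> (am_map_gen u * am_map_gen y) ^+ (m u y)./2 = (am_map_gen y * am_map_gen u) ^+ (m u y)./2.
  move=> uy; have yu : y <> u by move=> e; rewrite e label_diag in uy.
  have yv : y <> v by move=> e; rewrite e in uy.
  rewrite /am_map_gen eqxx; case: eqP => // _; rewrite -am_conj_amC; last exact: ret_gen_amC.
  rewrite -!am_conjM -!(morphgX am_conjM); congr am_conj.
  by have := ret_braid S uy; rewrite {1 4}/ret_gen uS.
move=> x y xy; have [xu|xu] := eqVneq x u; first by subst x; apply: main.
have [yu|yu] := eqVneq y u; first by subst y; rewrite label_sym main // label_sym.
rewrite /am_map_gen (negPf xu) (negPf yu) -!am_injM -!(morphgX am_injM); congr am_inj.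
exact: ret_braid.
Qed.

Definition am_map : artin -> P := aext am_map_gen.
Lemma am_mapM : {morph am_map : g h / g * h}. Proof. exact: aextM am_map_braid. Qed.
Lemma am_map_genE x : am_map (gen x) = am_map_gen x. Proof. exact: aext_gen am_map_braid _. Qed.

Lemma am_map_snd g : (am_map g).2 = ret S g.
Proof.
apply: (@artin_hom_eq _ (fun g => (am_map g).2) (ret S)) => [a b||x]; first by rewrite am_mapM.
  exact: retM.
rewrite am_map_genE /am_map_gen ret_genE; case: eqP => [->|_] //=.
by rewrite uS.
Qed.

Lemma am_map_ret g : am_map (ret S g) = am_map g.
Proof.
apply: (@artin_hom_eq _ (am_map \o ret S) am_map) => [a b||x].
- by rewrite /= retM am_mapM.
- exact: am_mapM.
- rewrite /= ret_genE; case: ifPn => // xS; rewrite (morphg1 am_mapM) am_map_genE /am_map_gen.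
  by case: eqP => [xu|_]; [rewrite xu uS in xS|rewrite /ret_gen (negPf xS)].
Qed.

Definition am_kappa g := (am_map g).1.

Lemma amC_ker g : ret S g = 1 -> amC g.
Proof.
move=> g1; rewrite /amC g1; have -> : S :\ u :\ v = (S :\ u :\ v) :&: S.
  by apply/esym/setIidPl/(subset_trans (subD1set _ _))/subD1set.
by rewrite -ret_ret g1 ret1.
Qed.

Lemma am_act_ret g c : @coset_act _ _ amC_subgrp (ret S g) c = coset_act g c.
Proof.
rewrite -(coset_ofK c) !coset_act_of; apply/coset_ofP/amC_ker.
by rewrite !(retM, retV) ret_ret setIid mulVg.
Qed.

Lemma am_kappaM g h :
  am_kappa (g * h) = am_kappa g * fmap (@coset_act _ _ amC_subgrp) g (am_kappa h).
Proof.
rewrite /am_kappa am_mapM /= am_map_snd; congr (_ * _).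
by apply: free_hom_eq => [f1 f2|f1 f2|x]; rewrite ?fmapM // !fmap_gen am_act_ret.
Qed.

Lemma am_kappaA g : amA g -> am_kappa g = 1.
Proof.
rewrite /am_kappa -am_map_ret => <-.
have -> : am_map (ret (S :\ u) g) = am_inj (ret (S :\ u) g) by
  apply: (@artin_hom_eq _ (am_map \o ret (S :\ u)) (am_inj \o ret (S :\ u))) => [a b|a b|x];
  rewrite /= ?retM ?am_mapM ?am_injM // ret_genE !inE; case: eqP => xu /=;
  rewrite ?(morphg1 am_mapM) //; case: ifP => xS; rewrite ?(morphg1 am_mapM) // am_map_genE
    /am_map_gen /ret_gen xS; case: eqP.
by [].
Qed.

Lemma am_kappaB g : amB g -> am_kappa g = fgen (co 1) * (fgen (co g))^-1.
Proof.
move=> gB; rewrite /am_kappa -am_map_ret -gB.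
have -> : am_map (ret (S :\ v) g) = am_conj (ret (S :\ v) g).
  apply: (@artin_hom_eq _ (am_map \o ret (S :\ v)) (am_conj \o ret (S :\ v))) => [a b|a b|x].
  - by rewrite /= retM am_mapM.
  - by rewrite /= retM am_conjM.
  rewrite /= ret_genE; case: ifPn => [|_]; last by rewrite (morphg1 am_mapM) (morphg1 am_conjM).
  rewrite !inE => /andP[/eqP xv xS]; rewrite am_map_genE /am_map_gen; case: eqP => // xu.
  have := ret_gen_amC xu xv; rewrite /ret_gen xS => h.
  by rewrite am_conj_amC.
congr (_ * (fgen _)^-1); apply/coset_ofP/amC_ker.
by rewrite retM retV gB ret_ret setIid mulVg.
Qed.

Definition am_tree : tree artin :=
  amalgam_tree amA_subgrp amB_subgrp amCA amCB am_gen am_kappaM am_kappaA am_kappaB.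

Definition rooted X := forall Y a k, Y \subset X -> 0 < k -> parab X a ->
  parab Y (a ^+ k) -> parab Y a.

Lemma am_tree_roots : rooted (S :\ u) -> rooted (S :\ v) ->
  forall g (l : edge am_tree * bool) k, 0 < k ->
  vact g (lstart l) = lstart l -> lact (g ^+ k) l = l -> lact g l = l.
Proof.
have CE g X : S :\ u :\ v \subset X -> X \subset S -> ret X g = ret S g ->
    amC g <-> parab (S :\ u :\ v) (ret S g).
  move=> CX XS gX; rewrite /amC /parab ret_ret.
  by have /setIidPl -> : S :\ u :\ v \subset S := subset_trans CX XS.
have Cu : S :\ u :\ v \subset S :\ u := subD1set _ _.
have Cv : S :\ u :\ v \subset S :\ v.
  by apply/subsetP => z; rewrite !inE => /and3P[-> _ ->].
move=> ru rv g l k k0; apply: amalgam_edge_roots => a ha.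
- have h2 := ret_equalizer_subgrp (S :\ u) S.
  move/(CE _ _ Cu (subD1set _ _) (subgrpX k h2 ha)); rewrite retX => h.
  by apply/(CE _ _ Cu (subD1set _ _) ha)/(ru _ _ k) => //; rewrite -ha; apply: parab_ret.
- have h2 := ret_equalizer_subgrp (S :\ v) S.
  move/(CE _ _ Cv (subD1set _ _) (subgrpX k h2 ha)); rewrite retX => h.
  by apply/(CE _ _ Cv (subD1set _ _) ha)/(rv _ _ k) => //; rewrite -ha; apply: parab_ret.
Qed.

Lemma am_tree_stab (x : vertex am_tree) : exists h,
  (forall g, vact g x = x -> ret (S :\ u) (g ^ h) = ret S (g ^ h)) \/
  (forall g, vact g x = x -> ret (S :\ v) (g ^ h) = ret S (g ^ h)).
Proof. exact: amalgam_stab. Qed.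

Lemma am_tree_edge_stab g (e : edge am_tree) : eact g e = e ->
  exists h, ret (S :\ u :\ v) (g ^ h) = ret S (g ^ h).
Proof. exact: amalgam_edge_stab. Qed.

Lemma ret_conj_eq X g h : parab S g -> ret X (g ^ h) = ret S (g ^ h) -> ret X g = 1 -> g = 1.
Proof.
move=> gS e gX; apply/eqP; rewrite -(conjg_eq1 _ (ret S h)) -gS -retJ -e.
by rewrite retJ gX conj1g.
Qed.

(** A vertex stabilizer is conjugate into one of the two factors, where the corresponding retraction
    agrees with [ret S]. *)
Lemma am_tree_free g (x : vertex am_tree) : parab S g -> vact g x = x ->
  ret (S :\ u) g = 1 -> ret (S :\ v) g = 1 -> g = 1.
Proof.
move=> gS gx gu gv; have [h [/(_ _ gx) e|/(_ _ gx) e]] := am_tree_stab x.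
  exact: ret_conj_eq gS e gu.
exact: ret_conj_eq gS e gv.
Qed.

Lemma am_tree_vertex : inhabited (vertex am_tree).
Proof. by split; left; apply: (coset_of _ (1 : artin)). Qed.

End AmalgamParab.
End Artin.

(** * Two-generator Artin groups *)

Lemma sqz1 (p q : int) : (p * q = 1 -> q * q = 1)%R.
Proof. by move/intUnitRing.unitzPl/orP => [] /eqP ->. Qed.

Section PairModel.
Variables (V : finType) (m : V -> V -> nat).
Hypothesis hm : is_EAFC m.
Variables (x y : V).
Hypothesis xy : x <> y.
Local Notation artin := (artin m).
Local Notation gen := (gen m).
Implicit Types (g h : artin).

Let k := (m x y)./2.
(** For nonadjacent [x] and [y] the modulus [k] is 0, so [kmult] is trivial and the index set [I] is
    a copy of Z; the same model then describes the free group on two generators. *)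
Definition kmult : mint -> Prop := fun i => (k %| (i : int))%Z.
Lemma kmult_subgrp : subgrp kmult.
Proof.
split=> [|i j hi hj|i hi]; rewrite /kmult.
- exact: dvdz0.
- by rewrite mintM rpredD.
- by rewrite mintV rpredN.
Qed.

Let I := coset kmult_subgrp.
Let cl (i : mint) : I := coset_of kmult_subgrp i.
Definition pair_act := free_action (@coset_act1 _ _ kmult_subgrp) (@coset_actM _ _ kmult_subgrp).
Local Notation D := (sdprod pair_act).

Lemma pair_act_gen (i j : mint) : pair_act i (fgen (cl j)) = fgen (cl (i * j)).
Proof. by rewrite /= fmap_gen coset_act_of. Qed.

Lemma pair_act_kmult (i : mint) f : kmult i -> pair_act i f = f.
Proof.
move=> ki; apply: (@free_hom_eq _ _ (pair_act i) id) => // [f1 f2|c]; first exact: gactM.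
rewrite -(coset_ofK c) pair_act_gen; congr fgen; apply/coset_ofP.
rewrite invgM -mulgA mint_commute mulgK.
exact: subgrpV kmult_subgrp _ ki.
Qed.

Definition pair_y : D := (fgen (cl 1), 1).
(** Chosen so that [pair_y * pair_x] is the generator of the Z-factor, whose [k]-th power is
    central. *)
Definition pair_x : D := ((fgen (cl 1))^-1, mone).
Definition pair_gen z : D := if z == y then pair_y else if z == x then pair_x else 1.

Lemma sd_in2 (i j : mint) : ((1, i) : D) * ((1, j) : D) = (1, i * j).
Proof. by rewrite sdprod_mulE /= fmapg1 mulg1. Qed.

Lemma sd_in2X n : ((1, mone) : D) ^+ n = (1, (n : int)).
Proof.
elim: n => [//|n IH]; rewrite expgSr IH sd_in2; congr pair.
by rewrite -[X in _ = X]/(n.+1 : int) -[LHS]/((n : int) + 1)%R; lia.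
Qed.

Lemma pair_yx : pair_y * pair_x = (1, mone).
Proof. by rewrite sdprod_mulE /= fmapV fmap_gen coset_act_of mulg1 mulgV mul1g. Qed.

Lemma pair_braid_yx : (pair_y * pair_x) ^+ k = (pair_x * pair_y) ^+ k.
Proof.
have -> : pair_x * pair_y = (pair_y * pair_x) ^ pair_y by rewrite conjgE !mulgA mulVg mul1g.
rewrite -conjXg; apply/esym/conjg_fixP/commgP; rewrite pair_yx sd_in2X /commute.
rewrite !sdprod_mulE; congr pair; last exact: mint_commute.
have := @pair_act_kmult k (fgen (cl 1)) (dvdzz _); rewrite /pair_y /= => ->.
by rewrite fmapg1 mulg1 mul1g.
Qed.

Lemma pair_gen_braid : braid_on m pair_gen.
Proof.
move=> z t zt; rewrite /pair_gen.
have xyF : (x == y) = false by apply/eqP.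
have [zy|zy] := eqVneq z y; have [ty|ty] := eqVneq t y.
- by rewrite zy ty (label_diag hm) in zt.
- have [tx|_] := eqVneq t x; last exact: braid_one.
  by rewrite zy tx (label_sym hm); apply: pair_braid_yx.
- have [zx|_] := eqVneq z x; last exact/esym/braid_one.
  by rewrite ty zx; apply/esym/pair_braid_yx.
- have [zx|_] := eqVneq z x; have [tx|_] := eqVneq t x => //; first exact: braid_one.
  exact/esym/braid_one.
Qed.

Definition pair_map : artin -> D := aext pair_gen.
Lemma pair_mapM : {morph pair_map : g h / g * h}.
Proof. exact: (aextM hm pair_gen_braid). Qed.
Lemma pair_map_gen z : pair_map (gen z) = pair_gen z.
Proof. exact: (aext_gen hm pair_gen_braid). Qed.

Lemma pair_map_y : pair_map (gen y) = pair_y.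
Proof. by rewrite pair_map_gen /pair_gen eqxx. Qed.

Lemma pair_map_snd g : (pair_map g).2 = expo x g.
Proof.
apply: (@artin_hom_eq _ _ _ (fun g => (pair_map g).2) (expo x)) => [a b||z].
- by rewrite pair_mapM.
- exact: expoM.
- rewrite pair_map_gen expo_gen // /pair_gen; case: eqP => [->|_].
    by case: eqP => // e; case: xy.
  by case: eqP.
Qed.

Let X := gen y * gen x.

Lemma X_kmult (i : mint) : kmult i -> commute (expgz X i) (gen y).
Proof.
case/dvdzP => q ->; rewrite mulrC expgzM; apply/commute_sym/commute_expgz.
rewrite -[expgz X k]/(X ^+ k); have [k0|xy0] := eqVneq (m x y) 0%N.
  by rewrite /k k0; apply: commute1.
have E : (gen x * gen y) ^+ k = X ^+ k by apply: braid_gen => //; apply/eqP.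
apply/commute_sym/commgP/conjg_fixP.
by rewrite conjXg conjgE /X !mulgA mulVg mul1g E.
Qed.

(** The basis letter of index [i] is the conjugate of [y] by the [i]-th power of [X]. It depends on
    [i] modulo [k] only, because [X] to the power [k] commutes with [y]. *)
Definition pair_letter (c : I) : artin := expgz X (val c) * gen y * (expgz X (val c))^-1.

Lemma pair_letter_cl i : pair_letter (cl i) = expgz X i * gen y * (expgz X i)^-1.
Proof.
rewrite /pair_letter; have := coset_repP kmult_subgrp i; rewrite /cl /=.
set j := coset_rep _ _ => ij; have -> : j = i * (i^-1 * j) by rewrite mulVKg.
have -> : expgz X (i * (i^-1 * j))%g = expgz X i * expgz X (i^-1 * j)%g by exact: expgzMm.
by rewrite invgM -!mulgA; congr (_ * _); rewrite !mulgA X_kmult // mulgK.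
Qed.

Definition pair_inv (d : D) : artin := fext pair_letter d.1 * expgz X d.2.

Lemma pair_letter_act (i : mint) f :
  fext pair_letter (pair_act i f) = expgz X i * fext pair_letter f * (expgz X i)^-1.
Proof.
apply: (@free_hom_eq _ _ (fun f => fext pair_letter (pair_act i f))
  (fun f => expgz X i * fext pair_letter f * (expgz X i)^-1)) => [f1 f2|f1 f2|c].
- by rewrite gactM fextM.
- by rewrite fextM !mulgA mulgVK.
- rewrite -(coset_ofK c) pair_act_gen !fext_gen !pair_letter_cl.
  have -> : expgz X (i * val c)%g = expgz X i * expgz X (val c) by exact: expgzMm.
  by rewrite invgM !mulgA.
Qed.

Lemma pair_invM : {morph pair_inv : d e / d * e}.
Proof.
move=> d e; rewrite /pair_inv sdprod_mulE fextM pair_letter_act.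
have -> : expgz X (d.2 * e.2)%g = expgz X d.2 * expgz X e.2 by exact: expgzMm.
by rewrite !mulgA mulgVK.
Qed.

Lemma pair_mapK g : pair_inv (pair_map g) = ret [set x; y] g.
Proof.
apply: (@artin_hom_eq _ _ _ (pair_inv \o pair_map) (ret [set x; y])) => [a b||z].
- by rewrite /= pair_mapM pair_invM.
- exact: retM.
- rewrite /= ret_genE // !inE pair_map_gen /pair_gen.
  case: (eqVneq z y) => [->|zy]; rewrite ?orbT ?orbF.
    by rewrite /pair_inv /= fext_gen pair_letter_cl /= invg1 !mulg1 mul1g.
  case: eqP => [->|_]; last by rewrite (morphg1 pair_invM).
  by rewrite /pair_inv /= fextV fext_gen pair_letter_cl /= invg1 !mulg1 mul1g /X mulKg.
Qed.

Lemma pair_map_inj g h : parab [set x; y] g -> parab [set x; y] h ->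
  pair_map g = pair_map h -> g = h.
Proof. by move=> gP hP e; rewrite -gP -hP -!pair_mapK e. Qed.

Lemma sd_in1 (f1 f2 : free I) : ((f1, 1) : D) * ((f2, 1) : D) = (f1 * f2, 1).
Proof. by rewrite sdprod_mulE /= fmap1 //; apply: coset_act1. Qed.

Lemma sd_in1X (f : free I) n : ((f, 1) : D) ^+ n = (f ^+ n, 1).
Proof. by elim: n => [//|n IH]; rewrite expgS IH sd_in1 -expgS. Qed.

(** The Z-coordinate of [g] vanishes because that of its power does, so [g] comes from an element
    [f] of the free part with a power in the group of a basis letter. Then [f] commutes with that
    letter, and a basis letter is not a proper power. *)
Lemma pair_roots g n : 0 < n -> parab [set x; y] g -> parab [set y] (g ^+ n) -> parab [set y] g.
Proof.
move=> n0 gP gn.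
have e0 : expo x g = 1.
  have : expo x (g ^+ n) = 1 by rewrite -gn expo_ret0 // inE; apply/eqP.
  rewrite (morphgX (expoM hm x)) => /(congr1 (id : mint -> int)).
  by rewrite expg_mint => /eqP; rewrite mulf_eq0 => /orP[/eqP //|]; lia.
have [f fE] : exists f, pair_map g = (f, 1).
  by exists (pair_map g).1; rewrite -e0 -pair_map_snd; case: (pair_map g).
have yE i : pair_map (expgz (gen y) i) = (expgz (fgen (cl 1)) i, 1).
  rewrite (morph_expgz _ _ pair_mapM) pair_map_y; case: i => j /=; rewrite sd_in1X //.
  by apply/mulg1_eq; rewrite sd_in1 mulgV.
have fn : f ^+ n = expgz (fgen (cl 1)) (expo y (g ^+ n)).
  have := congr1 pair_map gn; rewrite ret_single // yE (morphgX pair_mapM) fE sd_in1X.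
  by case.
have co : commute f (fgen (cl 1)).
  apply: (@free_commute_roots _ _ _ n 1) => //; rewrite fn expg1.
  exact/commute_sym/commute_expgz.
pose P z := z = f \/ z = fgen (cl 1).
have aP : abelian_on (generated P).
  by apply: generated_abelian => a b [] -> [] -> //; apply: commute_sym.
have [s [chi [_ _ sE]]] := free_abelian_cyclic (generated_subgrp P) aP.
have /sE := generated_sub (or_introl erefl : P f).
have /sE := generated_sub (or_intror erefl : P (fgen (cl 1))).
move: (chi _) (chi _) => c b eb ec.
pose deg : free I -> mint := fext (fun=> mone).
have degM : {morph deg : a1 a2 / a1 * a2} := fextM _.
have := congr1 deg eb; rewrite (morph_expgz _ _ degM) /deg fext_gen -/deg.
move=> /(congr1 (id : mint -> int)) /=; rewrite expgz_mint => /esym sb.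
(* The letter is [s] to the power [b] and has degree 1, so [b] is 1 or -1, and [s] is the letter to
   the power [b]. *)
have b2 : (b * b)%R = 1%R :> (int).
  by apply: sqz1 sb.
have fE' : f = expgz (fgen (cl 1)) (b * c)%R.
  by rewrite eb -expgzM mulrA b2 mul1r.
have -> : g = expgz (gen y) (b * c)%R.
  apply: pair_map_inj => //; last by rewrite fE yE fE'.
  apply: subgrp_expgz; first exact: parab_subgrp.
  by rewrite /parab ret_genE // !inE eqxx orbT.
apply: subgrp_expgz; first exact: parab_subgrp.
by rewrite /parab ret_genE // !inE eqxx.
Qed.

Lemma pair_alternative (H : artin -> Prop) : subgrp H -> (forall h, H h -> parab [set x; y] h) ->
  (forall h, H h -> (k %| (expo x h : int))%Z) -> abelian_on H \/ good H.
Proof.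
move=> hH HP Hk; pose phi h := (pair_map h).1.
have phiM : hom_on H phi.
  move=> g h Hg Hh; rewrite /phi pair_mapM sdprod_mulE pair_act_kmult //.
  by rewrite pair_map_snd; apply: Hk.
have [gd|ng] := pselect (good H); [by right|left=> g h Hg Hh].
apply: pair_map_inj; try by apply: HP; apply: subgrpM.
have sE a b : H a -> pair_map (a * b) = (phi a * phi b, expo x a * expo x b).
  move=> Ha; rewrite pair_mapM sdprod_mulE pair_act_kmult ?pair_map_snd //.
  by apply: Hk.
rewrite !sE // mint_commute; congr pair; apply: contrapT => nc; apply: ng.
by exists I, phi; split=> //; exists g, h.
Qed.

End PairModel.

(** * Unique roots and root-closed parabolic subgroups *)

Section UniqueRoots.
Variables (V : finType) (m : V -> V -> nat).
Hypothesis hm : is_EAFC m.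
Local Notation artin := (artin m).
Local Notation gen := (gen m).
Implicit Types (g h : artin) (S X Y : {set V}).

(** If [S] is complete, any vertex [x] can be split off. When some label at [x] is not 2, the
    triangle condition makes all other labels at both ends of that edge equal to 2; otherwise [x]
    splits off alone, which is the case [x = y] of the last hypothesis. *)
Lemma parab_decomposition (P : {set V} -> Prop) :
  P set0 ->
  (forall S u v, u \in S -> v \in S -> u <> v -> m u v = 0%N ->
     P (S :\ u) -> P (S :\ v) -> P (S :\ u :\ v) -> P S) ->
  (forall S x y, x \in S -> y \in S -> x = y \/ m x y <> 0%N ->
     (forall a b, a \in [set x; y] -> b \in S :\: [set x; y] -> m a b = 2) ->
     P (S :\: [set x; y]) -> P S) ->
  forall S, P S.
Proof.
move=> P0 Pam Pjoin S; have [n] := ubnP #|S|; elim: n S => // n IH S.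
rewrite ltnS => Sn; have sub Y z : z \in S -> Y \subset S :\ z -> P Y.
  move=> zS YS; apply: IH; apply: leq_ltn_trans (subset_leq_card YS) _.
  by have := cardsD1 z S; rewrite zS; lia.
have [->//|[x xS]] := set_0Vmem S.
have [[u [v [uS vS uv uv0]]]|nadj] :=
    pselect (exists u v, [/\ u \in S, v \in S, u <> v & m u v = 0%N]).
  apply: (Pam _ u v) => //; [apply: (sub _ u)|apply: (sub _ v)|apply: (sub _ u)] => //.
  exact: subD1set.
have adj a b : a \in S -> b \in S -> a <> b -> m a b <> 0%N.
  by move=> aS bS ab ab0; apply: nadj; exists a, b.
have join y : y \in S -> x = y \/ m x y <> 0%N ->
    (forall b, b \in S -> b <> x -> b <> y -> m x b = 2 /\ m y b = 2) -> P S.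
  move=> yS xy h; apply: (Pjoin _ x y) => // [a b|].
    rewrite !inE negb_or => aX /andP[/andP[/eqP bx /eqP by_] bS].
    by have [h1 h2] := h b bS bx by_; case/orP: aX => /eqP ->.
  apply: (sub _ x) => //; apply/subsetP => z; rewrite !inE negb_or.
  by move=> /andP[/andP[-> _] ->].
have [[y [yS yx xy2]]|all2] := pselect (exists y, [/\ y \in S, y <> x & m x y <> 2]).
  have xy0 : m x y <> 0%N by apply: adj => // e; case: yx.
  apply: (join y) => //; [by right|move=> b bS bx by_].
  have [_ [_ tri]] := hm.
  have xb : m x b <> 0%N by apply: adj => // e; case: bx.
  have yb : m y b <> 0%N by apply: adj => // e; case: by_.
  have := tri x y b xy0 yb xb.
  by do 3 case: eqP => //.
apply: (join x) => //; [by left|move=> b bS bx _].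
by split; apply: contrapT => n2; apply: all2; exists b.
Qed.

Definition uniquely_rooted S := forall g h k, 0 < k -> parab S g -> parab S h ->
  g ^+ k = h ^+ k -> (forall x y, ret [set x; y] g = ret [set x; y] h) -> g = h.

Lemma parabI X Y g : parab X g -> parab Y g -> parab (X :&: Y) g.
Proof. by move=> hX hY; rewrite /parab -(ret_ret hm) hY. Qed.

Lemma retC X Y g : ret X (ret Y g) = ret Y (ret X g).
Proof. by rewrite !(ret_ret hm) setIC. Qed.

Lemma gen_expgz_eq1 x (i : int) : expgz (gen x) i = 1 -> i = 0%R.
Proof.
move/(congr1 (expo x)); rewrite (morphg1 (expoM hm x)) (morph_expgz _ _ (expoM hm x)).
by rewrite expo_gen // eqxx expgz_mone.
Qed.

Lemma pair_rooted x y Y g k : 0 < k -> parab [set x; y] g -> parab Y (g ^+ k) -> parab Y g.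
Proof.
move=> k0 gP gY; have gI : parab ([set x; y] :&: Y) (g ^+ k).
  by apply: parabI gY; apply: subgrpX gP; apply: parab_subgrp.
have sub0 Z : parab set0 g -> parab Z g by apply: (parabS hm (sub0set _)).
have [exy|/eqP xy] := eqVneq x y.
  subst y; rewrite setUid in gP gI.
  have [xY|xY] := boolP (x \in Y); first by apply: (parabS hm _ gP); rewrite sub1set.
  have gk : g ^+ k = 1.
    rewrite -gI (_ : _ :&: _ = set0) ?ret0 //.
    by apply/setP => z; rewrite !inE; case: eqP => // ->; apply/negbTE.
  move: gk; rewrite -gP ret_single // -[_ ^+ _]/(expgz _ k) -expgzM => /gen_expgz_eq1 /eqP.
  rewrite mulf_eq0 => /orP[/eqP ->|]; last by lia.
  by apply: subgrp1; apply: parab_subgrp.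
have py : x \notin Y -> parab [set y] g.
  move=> xY; apply: (pair_roots hm xy k0 gP); apply: (parabS hm _ gI).
  apply/subsetP => z; rewrite !inE => /andP[/orP[/eqP zx|//] zY].
  by rewrite zx (negPf xY) in zY.
have px : y \notin Y -> parab [set x] g.
  move=> yY; rewrite setUC in gP gI; apply: (pair_roots hm _ k0 gP); first by move=> e; case: xy.
  apply: (parabS hm _ gI); apply/subsetP => z; rewrite !inE => /andP[/orP[/eqP zx|//] zY].
  by rewrite zx (negPf yY) in zY.
have [xY|xY] := boolP (x \in Y); have [yY|yY] := boolP (y \in Y).
- by apply: (parabS hm _ gP); apply/subsetP => z; rewrite !inE => /orP[] /eqP ->.
- by apply: (parabS hm _ (px yY)); rewrite sub1set.
- by apply: (parabS hm _ (py xY)); rewrite sub1set.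
- apply: sub0; have := parabI (px yY) (py xY); congr parab.
  by apply/setP => z; rewrite !inE; case: eqP => // ->; apply/eqP.
Qed.

(** Unique roots are applied to [a] and [ret Y a]: their [k]-th powers coincide, and their pair
    projections agree by the two-generator case [pair_rooted]. *)
Lemma uniquely_rooted_rooted S : uniquely_rooted S -> rooted m S.
Proof.
move=> uS Y a k YS k0 aS aY; apply/esym; apply: (uS _ _ k) => //.
- exact: (parabS hm YS (parab_ret hm Y a)).
- by rewrite -(retX hm) aY.
move=> x y; rewrite retC; apply/esym; apply: (@pair_rooted x y Y _ k) => //.
  exact: parab_ret.
by rewrite /parab -(retX hm) retC aY.
Qed.

Lemma rooted_torsion S g k : rooted m S -> 0 < k -> parab S g -> g ^+ k = 1 -> g = 1.
Proof.
move=> rS k0 gS gk; rewrite -[LHS](rS set0 g k) ?ret0 ?sub0set // gk.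
by apply: subgrp1; apply: parab_subgrp.
Qed.

Lemma rooted_torsionz S g (i : int) : rooted m S -> parab S g -> expgz g i = 1 -> i <> 0%R -> g = 1.
Proof.
move=> rS gS; case: i => n /= e n0; first by apply: (@rooted_torsion S g n) => //; lia.
by apply: (@rooted_torsion S g n.+1) => //; rewrite -[LHS]invgK e invg1.
Qed.

Section UniqueRootsAmalgam.
Variables (S : {set V}) (u v : V) (s q : artin) (k : nat).
Hypotheses (uS : u \in S) (uv : u <> v) (muv : m u v = 0%N).
Hypotheses (ru : rooted m (S :\ u)) (rv : rooted m (S :\ v)).
Hypotheses (k0 : 0 < k) (sS : parab S s) (qS : parab S q) (sq : s ^+ k = q ^+ k).
Hypotheses (squ : ret (S :\ u) s = ret (S :\ u) q) (sqv : ret (S :\ v) s = ret (S :\ v) q).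

Let H := generated (fun z => z = s \/ z = q).
Let hH : subgrp H := generated_subgrp _.

Lemma two_roots_gen (K : artin -> Prop) : subgrp K -> K s -> K q -> forall h, H h -> K h.
Proof. by move=> hK Ks Kq h; apply=> // y [] ->. Qed.

Lemma two_roots_parab h : H h -> parab S h.
Proof. by apply: two_roots_gen => //; apply: parab_subgrp. Qed.

Let Hs : H s. Proof. by apply: generated_sub; left. Qed.
Let Hq : H q. Proof. by apply: generated_sub; right. Qed.

(** Both projections identify [s] with [q], so the projections of any element of [H] are powers of
    [su] and [sv] with a common exponent. By torsion-freeness this exponent is unique unless [su]
    and [sv] are both trivial. *)
Lemma two_roots_exponent : exists rho : artin -> 'rV[int]_1,
  (forall g h, H g -> H h -> rho (g * h) = (rho g + rho h)%R) /\
  (forall h, H h -> rho h = 0%R -> ret (S :\ u) h = 1 /\ ret (S :\ v) h = 1).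
Proof.
pose su := ret (S :\ u) s; pose sv := ret (S :\ v) s.
have ex h : H h -> exists i : int, ret (S :\ u) h = expgz su i /\ ret (S :\ v) h = expgz sv i.
  move: h; apply: two_roots_gen; last by exists 1%R; rewrite /su /sv squ sqv.
  - split=> [|g h [i [e1 e2]] [j [e3 e4]]|g [i [e1 e2]]].
    + by exists 0%R; rewrite !ret1.
    + by exists (i + j)%R; rewrite !(retM hm) !expgzD e1 e2 e3 e4.
    + by exists (- i)%R; rewrite !(retV hm) !expgzN e1 e2.
  - by exists 1%R.
have [triv|ntriv] := pselect (su = 1 /\ sv = 1).
  exists (fun=> 0%R); split=> [g h _ _|h /ex[i [-> ->]] _]; first by rewrite addr0.
  by have [-> ->] := triv; rewrite !expgz1g.
have uniq i j : expgz su i = expgz su j -> expgz sv i = expgz sv j -> i = j.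
  move=> eu ev; apply: contrapT => ij; apply: ntriv.
  have ij0 : (i - j)%R <> 0%R by move=> /eqP; rewrite subr_eq0 => /eqP.
  by split; [apply: (rooted_torsionz ru) ij0|apply: (rooted_torsionz rv) ij0];
    rewrite ?expgzD ?expgzN ?eu ?ev ?mulgV //; apply: parab_ret.
pose i h := if pselect (H h) is left Hh then projT1 (cid (ex h Hh)) else 0%R.
have iP h : H h -> ret (S :\ u) h = expgz su (i h) /\ ret (S :\ v) h = expgz sv (i h).
  by move=> Hh; rewrite /i; case: pselect => // Hh'; apply: projT2 (cid (ex h Hh')).
exists (fun h => const_mx (i h)); split=> [g h Hg Hh|h Hh].
  apply/matrixP => a b; rewrite !mxE; have [eg1 eg2] := iP _ Hg; have [eh1 eh2] := iP _ Hh.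
  have [e1 e2] := iP _ (subgrpM hH Hg Hh); apply: uniq.
    by rewrite -e1 (retM hm) eg1 eh1 expgzD.
  by rewrite -e2 (retM hm) eg2 eh2 expgzD.
move/matrixP/(_ ord0 ord0); rewrite !mxE => i0; have [-> ->] := iP _ Hh.
by rewrite i0.
Qed.

(** If [H] is abelian, the quotient of [s] and [q] is a torsion element of the common kernel of the
    two projections, and this kernel acts freely. The other case cannot occur: a homomorphism to a
    free group identifies [s] and [q] by unique roots, hence has cyclic image. *)
Lemma unique_roots_amalgam : s = q.
Proof.
have [rho [rhoM rho0]] := two_roots_exponent.
pose T := am_tree hm uv muv uS.
have free_act h (z : vertex T) : H h -> vact h z = z -> rho h = 0%R -> h = 1.
  move=> Hh hz /(rho0 _ Hh)[hu hv].
  exact: (am_tree_free (two_roots_parab Hh) hz hu hv).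
have roots a (l : edge T * bool) n : H a -> 0 < n -> vact a (lstart l) = lstart l ->
    lact (a ^+ n) l = l -> lact a l = l.
  by move=> _; apply: am_tree_roots.
have [aH|[X [phi [hphi [g [h [Hg Hh []]]]]]]] :=
    tree_alternative hH rhoM free_act roots (am_tree_vertex hm uv muv uS).
  have hN : subgrp (fun h => [/\ H h, ret (S :\ u) h = 1 & ret (S :\ v) h = 1]).
    split=> [|a b [Ha au av] [Hb bu bv]|a [Ha au av]].
    - by rewrite !(ret1 hm); split=> //; apply: (subgrp1 hH).
    - by rewrite !(retM hm) au av bu bv mulg1; split=> //; apply: (subgrpM hH).
    - by rewrite !(retV hm) au av invg1; split=> //; apply: (subgrpV hH).
  apply/esym/divg1_eq; apply: (free_action_torsion hN (am_tree_vertex hm uv muv uS) _ _ k0).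
  - move=> h z [Hh hu hv] hz; exact: (am_tree_free (two_roots_parab Hh) hz hu hv).
  - split; first exact: (subgrpF hH).
      by rewrite (retM hm) (retV hm) squ mulgV.
    by rewrite (retM hm) (retV hm) sqv mulgV.
  - by rewrite expgnFl ?sq ?mulgV //; apply: aH.
have e : phi s = phi q.
  by apply: (free_unique_roots k0); rewrite -!(hom_onX hH hphi) // sq.
have cyc a : H a -> cycle_of (phi s) (phi a).
  suff: H a -> H a /\ cycle_of (phi s) (phi a) by move=> h1 /h1[].
  have hC := cycle_of_subgrp (phi s); move: a; apply: two_roots_gen.
  - split=> [|a b [Ha Ca] [Hb Cb]|a [Ha Ca]].
    + by split; [apply: (subgrp1 hH)|rewrite (hom_on1 hH hphi); apply: (subgrp1 hC)].
    + by split; [apply: (subgrpM hH)|rewrite hphi //; apply: (subgrpM hC)].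
    + by split; [apply: (subgrpV hH)|rewrite (hom_onV hH hphi) //; apply: (subgrpV hC)].
  - by split=> //; apply: cycle_of_id.
  - by split=> //; rewrite -e; apply: cycle_of_id.
by apply: (@cycle_of_abelian _ (phi s)); apply: cyc.
Qed.

End UniqueRootsAmalgam.

Lemma ret_split S x y g : x \in S -> y \in S ->
  (forall a b, a \in [set x; y] -> b \in S :\: [set x; y] -> m a b = 2) ->
  ret S g = ret [set x; y] g * ret (S :\: [set x; y]) g.
Proof.
move=> xS yS h; rewrite -(ret_join hm h); congr ret.
by apply/setP => z; rewrite !inE; do 2 (case: eqP => [->|_] //=).
Qed.

Lemma unique_roots S : uniquely_rooted S.
Proof.
elim/parab_decomposition: S => [g h k _ gP hP _ _|S u v uS vS uv uv0 IHu IHv _|S x y xS yS _ xy2 IH].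
- by rewrite -gP -hP !ret0.
- move=> g h k k0 gS hS gh pairs.
  have eqr Y : uniquely_rooted Y -> ret Y g = ret Y h.
    move=> uY; apply: (uY _ _ k) => //; try exact: parab_ret.
      by rewrite -!(retX hm) gh.
    by move=> x y; rewrite retC pairs retC.
  by apply: (unique_roots_amalgam uS uv uv0 (uniquely_rooted_rooted IHu)
    (uniquely_rooted_rooted IHv) k0 gS hS gh); apply: eqr.
- move=> g h k k0 gS hS gh pairs; rewrite -gS -hS !(ret_split _ xS yS xy2) pairs.
  congr (_ * _); apply: (IH _ _ k) => //; try exact: parab_ret.
    by rewrite -!(retX hm) gh.
  by move=> a b; rewrite retC pairs retC.
Qed.

Lemma all_rooted S : rooted m S.
Proof. exact/uniquely_rooted_rooted/unique_roots. Qed.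

Lemma artin_torsion g k : 0 < k -> g ^+ k = 1 -> g = 1.
Proof. by move=> k0; apply: (rooted_torsion (@all_rooted setT) k0); apply: retT. Qed.

End UniqueRoots.

(** * Embeddings in products of copies of Z and K *)

(** The parity action, which turns Z by Z into the Klein bottle group in the form y a y^-1 =
    a^-1. *)
Definition sgn_act (j i : mint) : mint := if odd `|(j : int)|%N then i^-1 else i.

Lemma odd_abszD (i j : int) : odd `|(i + j)%R|%N = odd `|i|%N (+) odd `|j|%N.
Proof.
rewrite -oddD; have [->|[->|->]] : (`|i| + `|j| = `|(i + j)%R| \/
  `|i| + `|j| = `|(i + j)%R| + `|i|.*2 \/ `|i| + `|j| = `|(i + j)%R| + `|j|.*2)%N by lia.
- by [].
- by rewrite oddD odd_double addbF.
- by rewrite oddD odd_double addbF.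
Qed.

Lemma sgn_actM j : {morph sgn_act j : a b / a * b}.
Proof. by move=> a b; rewrite /sgn_act; case: ifP => // _; rewrite invgM mint_commute. Qed.
Lemma sgn_act1 i : sgn_act 1 i = i. Proof. by []. Qed.
Lemma sgn_act_comp a b i : sgn_act (a * b) i = sgn_act a (sgn_act b i).
Proof.
rewrite /sgn_act -[(a * b)%g]/(a + b : int)%R odd_abszD.
by case: (odd `|(a : int)|%N); case: (odd `|(b : int)|%N); rewrite /= ?invgK.
Qed.
Definition klein_act : gaction mint mint := GAction sgn_actM sgn_act1 sgn_act_comp.
Definition kleinm := sdprod klein_act.
HB.instance Definition _ := Group.on kleinm.

(** A consequence of meeting the finite index subgroup in an abelian group. It makes no reference to
    that subgroup, passes to homomorphic images, and amounts to commutation in free groups. *)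
Definition virtually_commuting (G : groupType) (H : G -> Prop) :=
  exists2 k, 0 < k & forall g h, H g -> H h -> commute (g ^+ k) (h ^+ k).

Lemma virtually_commuting_image (G L : groupType) (H : G -> Prop) (f : G -> L) :
  subgrp H -> hom_on H f -> virtually_commuting H -> virtually_commuting (image_on H f).
Proof.
move=> hH hf [k k0 co]; exists k => // _ _ [g Hg <-] [h Hh <-].
have Xg := subgrpX k hH Hg; have Xh := subgrpX k hH Hh.
by rewrite -!(hom_onX hH hf) // /commute -!hf // co.
Qed.

Lemma virtually_commuting_free (X : choiceType) (H : free X -> Prop) :
  virtually_commuting H -> abelian_on H.
Proof.
by move=> [k k0 co] g h Hg Hh; apply: (free_commute_roots k0 k0); apply: co.
Qed.

(* Joint injectivity of s homomorphisms to Z and t homomorphisms to K with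
   s + 2t <= n, i.e. an embedding in Z^s x K^t. *)
Definition ZK_embeds (G : groupType) (H : G -> Prop) (n : nat) :=
  exists (I J : finType) (f : I -> G -> mint) (g : J -> G -> kleinm),
  [/\ #|I| + 2 * #|J| <= n, forall i, hom_on H (f i), forall j, hom_on H (g j) &
    forall h, H h -> (forall i, f i h = 1) -> (forall j, g j h = 1) -> h = 1].

Lemma ZK_embeds_trivial (G : groupType) (H : G -> Prop) n :
  (forall h, H h -> h = 1) -> ZK_embeds H n.
Proof.
move=> h1; exists 'I_0, 'I_0, (fun _ _ => 1), (fun _ _ => 1).
split=> [|[]|[]|h Hh _ _] //; [by rewrite !card_ord|exact: h1].
Qed.

Lemma ZK_embeds_leq (G : groupType) (H : G -> Prop) n p :
  n <= p -> ZK_embeds H n -> ZK_embeds H p.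
Proof.
move=> np [I [J [f [g [c hf hg inj]]]]]; exists I, J, f, g; split=> //.
exact: leq_trans c np.
Qed.

Lemma ZK_embeds_pullback (G L : groupType) (H : G -> Prop) (f : G -> L) n :
  hom_on H f -> (forall h, H h -> f h = 1 -> h = 1) -> ZK_embeds (image_on H f) n -> ZK_embeds H n.
Proof.
move=> hf inj [I [J [p [q [c hp hq pq]]]]].
exists I, J, (fun i => p i \o f), (fun j => q j \o f); split=> //.
- by move=> i; apply: hom_on_comp.
- by move=> j; apply: hom_on_comp.
- by move=> h Hh h1 h2; apply: inj => //; apply: pq => //; exists h.
Qed.

Lemma ZK_embeds_product (G L M : groupType) (H : G -> Prop) (f1 : G -> L) (f2 : G -> M) n1 n2 :
  hom_on H f1 -> hom_on H f2 -> (forall h, H h -> f1 h = 1 -> f2 h = 1 -> h = 1) ->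
  ZK_embeds (image_on H f1) n1 -> ZK_embeds (image_on H f2) n2 -> ZK_embeds H (n1 + n2).
Proof.
move=> hf1 hf2 inj [I1 [J1 [p1 [q1 [c1 hp1 hq1 pq1]]]]] [I2 [J2 [p2 [q2 [c2 hp2 hq2 pq2]]]]].
exists (I1 + I2)%type, (J1 + J2)%type,
  (fun i => match i with inl i => p1 i \o f1 | inr i => p2 i \o f2 end),
  (fun j => match j with inl j => q1 j \o f1 | inr j => q2 j \o f2 end); split.
- by rewrite !card_sum; lia.
- by case=> i; apply: hom_on_comp.
- by case=> j; apply: hom_on_comp.
- move=> h Hh h1 h2; apply: inj => //.
    by apply: pq1; [exists h|move=> i; apply: (h1 (inl i))|move=> i; apply: (h2 (inl i))].
  by apply: pq2; [exists h|move=> i; apply: (h1 (inr i))|move=> i; apply: (h2 (inr i))].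
Qed.

Lemma ZK_embeds_Z (G : groupType) (H : G -> Prop) (f : G -> mint) :
  hom_on H f -> (forall h, H h -> f h = 1 -> h = 1) -> ZK_embeds H 1.
Proof.
move=> hf inj; exists 'I_1, 'I_0, (fun _ => f), (fun _ _ => 1).
split=> [||[]|h Hh h1 _] //; first by rewrite !card_ord.
by apply: inj => //; apply: (h1 ord0).
Qed.

Lemma ZK_embeds_K (G : groupType) (H : G -> Prop) (f : G -> kleinm) :
  hom_on H f -> (forall h, H h -> f h = 1 -> h = 1) -> ZK_embeds H 2.
Proof.
move=> hf inj; exists 'I_0, 'I_1, (fun _ _ => 1), (fun _ => f).
split=> [|[]||h Hh _ h1] //; first by rewrite !card_ord.
by apply: inj => //; apply: (h1 ord0).
Qed.

Lemma image_generator (G : groupType) (H : G -> Prop) (p : G -> mint) :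
  subgrp H -> hom_on H p ->
  exists g, H g /\ forall h, H h -> ((p g : int) %| (p h : int))%Z.
Proof.
move=> hH hp.
have [[h0 [Hh0 ph0]]|p1] := pselect (exists h, H h /\ p h <> 1); last first.
  exists 1; split=> [|h Hh]; first exact: subgrp1.
  suff -> : p h = 1 by apply: dvdz0.
  by apply: contrapT => ph; apply: p1; exists h.
pose P n := `[< 0 < n /\ exists h, H h /\ p h = (n : int) >].
have exP : exists n, P n.
  exists `|(p h0 : int)|%N; apply/asboolP; split.
    by rewrite absz_gt0; apply/eqP.
  have [pos|neg] := lerP 0%R (p h0 : int).
    by exists h0; rewrite gez0_abs.
  exists h0^-1; split; first exact: subgrpV.
  by rewrite (hom_onV hH hp) // ltz0_abs.
have [n /asboolP[n0 [g [Hg pg]]] mn] := ex_minnP exP; exists g; split=> // h Hh.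
rewrite pg; have n1 : (0 < Posz n)%R by lia.
have md := ltz_pmod (p h : int) n1; have md0 := @modz_ge0 (p h : int) n (lt0r_neq0 n1).
have re : ((p h : int) %% n)%Z = ((p h : int) + n%:Z * - ((p h : int) %/ n)%Z)%R.
  by rewrite /modz mulrN mulrC.
have [r0|r0] := eqVneq ((p h : int) %% n)%Z 0%R; first exact/dvdz_mod0P.
have : n <= `|((p h : int) %% n)%Z|%N.
  apply: mn; apply/asboolP; split; first by rewrite absz_gt0.
  exists (h * expgz g (- ((p h : int) %/ n)%Z)%R); split.
    by apply: subgrpM => //; apply: subgrp_expgz.
  rewrite hp //; last exact: subgrp_expgz.
  rewrite (hom_on_expgz _ hH hp) // pg -[LHS]/((p h : int) + _)%R.
  by rewrite -[expgz _ _]/(expgz (n : mint) _ : int) expgz_mint gez0_abs // re.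
by move: md md0; move: (modz _ _) => t; lia.
Qed.

(* H is an extension of a subgroup d Z of Z by a cyclic group; with
   g r g^-1 = r^(+-1) it is Z, Z^2 or the Klein bottle group, all contained in K. *)
Lemma cyclic_by_Z_embeds (G : groupType) (H : G -> Prop) (p : G -> mint) (r : G) (c : G -> mint) :
  subgrp H -> hom_on H p -> H r -> p r = 1 ->
  (forall i : int, expgz r i = 1 -> r = 1 \/ i = 0%R) ->
  (forall h, H h -> p h = 1 -> h = expgz r (c h)) ->
  exists2 f : G -> kleinm, hom_on H f & forall h, H h -> f h = 1 -> h = 1.
Proof.
move=> hH hp Hr pr tr cE.
have [g [Hg gE]] := image_generator hH hp.
pose d := p g : int; pose q h : int := ((p h : int) %/ d)%Z.
have pq h : H h -> (p h : int) = (q h * d)%R by move=> /gE/divzK.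
have [eps grg] : exists eps : bool, g * r * g^-1 = expgz r (if eps then -1 else 1)%R.
  have Hj a b : H a -> H b -> H (a * b * a^-1) by move=> Ha Hb; do ?apply: subgrpM => //; apply: subgrpV.
  have pj a b : H a -> H b -> p b = 1 -> p (a * b * a^-1) = 1.
    move=> Ha Hb pb; have Va := subgrpV hH Ha; have Hab := subgrpM hH Ha Hb.
    by rewrite !hp // pb mulg1 (hom_onV hH hp) // mulgV.
  have e1 := cE _ (Hj _ _ Hg Hr) (pj _ _ Hg Hr pr).
  have Vg := subgrpV hH Hg; have e2 := cE _ (Hj _ _ Vg Hr) (pj _ _ Vg Hr pr).
  move: (c (g * r * g^-1)) (c (g^-1 * r * g^-1^-1)) e1 e2 => a b e1 e2.
  have [r1|r1] := pselect (r = 1); first by exists false; rewrite r1 expgz1g mulg1 mulgV.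
  have : expgz r (b * a - 1)%R = 1.
    rewrite expgzD expgzN expgz1 expgzM -e2; apply/eqP; rewrite divg_eq1; apply/eqP.
    have J z : g^-1 * z * g^-1^-1 = z ^ g by rewrite conjgE invgK mulgA.
    by rewrite J -expgzJ -e1 conjgE !mulgA mulVg mul1g mulgVK.
  case/tr => // /eqP; rewrite subr_eq0 => /eqP /intUnitRing.unitzPl /orP[] /eqP ba.
    by exists false; rewrite e1 ba.
  by exists true; rewrite e1 ba.
have conj_pow (n i : int) : expgz g n * expgz r i * (expgz g n)^-1 =
    expgz r (if eps && odd `|n|%N then - i else i)%R.
  have J (a z : G) : a * z * a^-1 = (z ^ a^-1)%g by rewrite conjgE invgK mulgA.
  have step (i' : int) : expgz r i' ^ g^-1 = expgz r (if eps then - i' else i')%R.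
    by rewrite expgzJ -J grg -expgzM; case: (eps); rewrite ?mulN1r ?mul1r.
  have stepV (i' : int) : expgz r i' ^ g = expgz r (if eps then - i' else i')%R.
    apply: (@conjg_inj _ g^-1); rewrite conjgK step.
    by case: (eps); rewrite ?opprK.
  elim/int_rec: n i => [|n IH|n IH] i; first by rewrite andbF invg1 mulg1 mul1g.
  - rewrite -[n.+1]addn1 PoszD addrC expgzD expgz1 J invgM conjgM -[X in (X ^ _)%g]J IH step.
    rewrite odd_abszD; case: (eps) => //=; case: (odd _) => //=.
    by rewrite opprK.
  - have -> : (- Posz n.+1 = - 1 - Posz n)%R by lia.
    rewrite expgzD J invgM conjgM -[X in (X ^ _)%g]J IH expgzN invgK stepV.
    rewrite odd_abszD; case: (eps) => //=; case: (odd _) => //=.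
    by rewrite opprK.
(* For [r = 1] the exponent is undetermined, and 0 is chosen so that it is additive. *)
pose c' h : int := if r == 1 then 0%R else c h.
have c'E h : H h -> p h = 1 -> h = expgz r (c' h).
  move=> Hh ph; rewrite /c'; case: eqP => [r1|_]; last exact: cE.
  by rewrite {1}(cE _ Hh ph) r1 !expgz1g.
have uniq (a b : int) : r <> 1 -> expgz r a = expgz r b -> a = b.
  move=> r1 ab; have : expgz r (a - b)%R = 1 by rewrite expgzD expgzN ab mulgV.
  by case/tr => // /eqP; rewrite subr_eq0 => /eqP.
pose rest h := h * expgz g (- q h)%R.
have Hrest h : H h -> H (rest h) by move=> Hh; apply: subgrpM => //; apply: subgrp_expgz.
have prest h : H h -> p (rest h) = 1.
  move=> Hh; rewrite /rest hp //; last exact: subgrp_expgz.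
  rewrite (hom_on_expgz _ hH hp) // -[LHS]/((p h : int) + _)%R.
  by rewrite -[expgz _ _]/(expgz (p g) _ : int) expgz_mint (pq _ Hh) mulrN [(q h * d)%R]mulrC addrN.
have hE h : H h -> h = expgz r (c' (rest h)) * expgz g (q h).
  by move=> Hh; rewrite -(c'E _ (Hrest _ Hh) (prest _ Hh)) /rest expgzN mulgVK.
have qM a b : H a -> H b -> q (a * b) = (q a + q b)%R.
  move=> Ha Hb; have [d0|d0] := eqVneq d 0%R; first by rewrite /q d0 !divz0.
  apply: (mulIf d0); rewrite mulrDl -!pq //; last exact: subgrpM.
  by rewrite hp.
(* If [g] centralizes [r], the second coordinate is doubled: its parity action becomes trivial, and
   the image lies in a copy of Z^2 inside K. *)
pose f h : kleinm := ((c' (rest h) : mint), (if eps then q h else q h + q h)%R : mint).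
exists f; last first.
  move=> h Hh [c0 j0]; rewrite (hE h Hh) c0.
  have -> : q h = 0%R; last by rewrite mulg1.
  by move: j0; rewrite mint1; case: (eps) => //; lia.
move=> a b Ha Hb; rewrite /f sdprod_mulE /=; congr pair; last first.
  by rewrite qM //; case: (eps) => //; rewrite mintM; lia.
have -> : sgn_act (if eps then q a else q a + q a)%R (c' (rest b)) =
   (if eps && odd `|q a|%N then - c' (rest b) else c' (rest b))%R.
  rewrite /sgn_act; case: (eps) => //=; case: ifP => //.
  by rewrite odd_abszD addbb.
have [r1|r1] := pselect (r = 1).
  rewrite /c'; case: eqP => // _; rewrite oppr0 if_same; exact/esym/mulg1.
apply: uniq => //; rewrite -c'E; [|by apply: Hrest; apply: subgrpM|by apply: prest; apply: subgrpM].
have -> : rest (a * b) = a * b * (expgz g (q b))^-1 * (expgz g (q a))^-1.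
  by rewrite /rest qM // [(q a + q b)%R]addrC opprD expgzD !expgzN !mulgA.
rewrite {1}(hE _ Ha) {1}(hE _ Hb) expgzMm -conj_pow !mulgA.
by rewrite mulgK.
Qed.

(** * Embedding virtually commuting subgroups *)

Section Embedding.
Variables (V : finType) (m : V -> V -> nat).
Hypothesis hm : is_EAFC m.
Local Notation artin := (artin m).
Local Notation gen := (gen m).
Implicit Types (g h : artin) (S X Y : {set V}).

(** The kernel of [expo x] on [H] lies in the free part of the model, where virtual commutation
    makes it abelian, hence cyclic. So [H] is cyclic by Z. *)
Lemma pair_ZK_embeds x y (H : artin -> Prop) : x <> y -> subgrp H ->
  (forall h, H h -> parab [set x; y] h) -> virtually_commuting H -> ZK_embeds H 2.
Proof.
move=> xy hH HP [k k0 co].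
pose pm := @pair_map V m x y; have pmM : {morph pm : g h / g * h} := pair_mapM hm xy.
have pm2 h : (pm h).2 = expo x h := pair_map_snd hm xy h.
have pmI := pair_map_inj hm xy.
pose K f := exists2 h, H h & pm h = (f, 1).
have sd1 := @sd_in1 V m x y.
have hK : subgrp K.
  split=> [|f1 f2 [h1 H1 e1] [h2 H2 e2]|f [h Hh e]].
  - by exists 1; [apply: subgrp1|apply: (morphg1 pmM)].
  - by exists (h1 * h2); [apply: subgrpM|rewrite pmM e1 e2 sd1].
  - exists h^-1; first exact: subgrpV.
    by rewrite (morphgV pmM) e; apply/mulg1_eq; rewrite sd1 mulgV.
have aK : abelian_on K.
  apply: virtually_commuting_free; exists k => // f1 f2 [h1 H1 e1] [h2 H2 e2].
  have := congr1 pm (co _ _ H1 H2); rewrite !pmM !(morphgX pmM) e1 e2 !sd_in1X !sd1.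
  by move/(congr1 fst).
have [s [chi [[r Hr rE] hchi sE]]] := free_abelian_cyclic hK aK.
have pX h (i : int) : pm h = (s, 1) -> pm (expgz h i) = (expgz s i, 1).
  move=> e; rewrite (morph_expgz _ _ pmM) e; case: i => j /=; rewrite sd_in1X //.
  by apply/mulg1_eq; rewrite sd1 mulgV.
have [f hf injf] : exists2 f : artin -> kleinm, hom_on H f & forall h, H h -> f h = 1 -> h = 1.
  apply: (@cyclic_by_Z_embeds _ H (expo x) r (fun h => chi (pm h).1) hH
    (morph_hom_on (expoM hm x) (H := H)) Hr).
  - by rewrite -pm2 rE.
  - move=> i ri; have [->|i0] := eqVneq i 0%R; [by right|left].
    have s1 : s = 1.
      apply: (@free_unique_rootsz _ _ _ i); first by move=> e; rewrite e eqxx in i0.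
      rewrite expgz1g; have := pX r i rE; rewrite ri (morphg1 pmM).
      by case.
    apply: pmI; [exact: HP|by apply: subgrp1; apply: parab_subgrp|].
    by rewrite -/pm rE s1 (morphg1 pmM).
  - move=> h Hh p1; have hE : pm h = ((pm h).1, 1).
      by rewrite -p1 -pm2; case: (pm h).
    apply: pmI; [exact: HP|by apply: subgrp_expgz; [apply: parab_subgrp|apply: HP]|].
    rewrite -/pm (pX _ _ rE) hE; congr pair; apply: sE.
    by exists h.
exact: ZK_embeds_K hf injf.
Qed.

Lemma single_ZK_embeds x (H : artin -> Prop) : subgrp H ->
  (forall h, H h -> parab [set x] h) -> ZK_embeds H 1.
Proof.
move=> hH HP; apply: (@ZK_embeds_Z _ H (expo x)); first exact: (morph_hom_on (expoM hm x)).
by move=> h /HP <- e; rewrite expo_ret ?inE // in e; rewrite ret_single // e.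
Qed.

Lemma image_ret S (H : artin -> Prop) : subgrp H ->
  subgrp (image_on H (ret S)) /\ forall h, image_on H (ret S) h -> parab S h.
Proof.
move=> hH; split; first exact: image_on_subgrp hH (morph_hom_on (retM hm S) (H := H)).
by move=> _ [h _ <-]; apply: parab_ret.
Qed.

Section EmbeddingAmalgam.
Variables (S : {set V}) (u v : V) (H : artin -> Prop) (k : nat).
Hypotheses (uS : u \in S) (vS : v \in S) (uv : u <> v) (muv : m u v = 0%N).
Hypotheses (hH : subgrp H) (HS : forall h, H h -> parab S h) (k0 : 0 < k).
Hypothesis co : forall g h, H g -> H h -> commute (g ^+ k) (h ^+ k).
Let C := S :\ u :\ v.
Hypothesis IH : forall X, X \in [:: S :\ u; S :\ v; C] -> ZK_embeds (image_on H (ret X)) #|X|.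
Let T := am_tree hm uv muv uS.

Lemma ret_embeds X : X \in [:: S :\ u; S :\ v; C] ->
  (forall h, H h -> ret X h = 1 -> h = 1) -> ZK_embeds H #|S|.
Proof.
move=> XS inj; apply: (@ZK_embeds_leq _ _ #|X|).
  apply: subset_leq_card; move: XS; rewrite !inE => /or3P[] /eqP ->; rewrite ?subD1set //.
  exact: subset_trans (subD1set _ _) (subD1set _ _).
by apply: ZK_embeds_pullback inj (IH XS); apply: (morph_hom_on (retM hm X)).
Qed.

Lemma no_edge_fix d (e : edge T) : H d -> ret C d = 1 -> eact d e = e -> d = 1.
Proof.
move=> Hd dC /am_tree_edge_stab[h e1]; exact: (ret_conj_eq hm (HS Hd) e1 dC).
Qed.

Lemma one_vertex_fix d (z z' : vertex T) : H d -> ret C d = 1 -> d <> 1 ->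
  vact d z = z -> vact d z' = z' -> z = z'.
Proof.
move=> Hd dC d1 dz dz'; case eg : (geo z z') => [|l w]; first exact: geo_nil eg.
case: d1; apply: (@no_edge_fix d l.1) => //; apply/lact_eq.
by apply: (geo_fixed dz dz'); rewrite eg mem_head.
Qed.

(** Nontrivial kernel elements fix no edge, so [d] fixes only [z], and its conjugate by [h] only the
    translate of [z] by [h]. Their [k]-th powers are nontrivial and commute, so both vertices
    coincide. Thus [H] fixes [z], and one of the two retractions is injective on it. *)
Lemma elliptic_kernel_embeds d (z : vertex T) : H d -> ret C d = 1 -> d <> 1 ->
  vact d z = z -> ZK_embeds H #|S|.
Proof.
move=> Hd dC d1 dz.
have fixz h : H h -> vact h z = z.
  move=> Hh; have Hh' := subgrpV hH Hh; pose d' := h * d * h^-1.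
  have Hd' : H d' by apply: (subgrpM hH) => //; apply: (subgrpM hH).
  have d'C : ret C d' = 1 by rewrite !(retM hm) dC mulg1 -(retM hm) mulgV (ret1 hm).
  have nt g : H g -> g <> 1 -> g ^+ k <> 1.
    by move=> Hg g1 gk; apply: g1; apply: (artin_torsion hm k0).
  have d'1 : d' <> 1.
    move=> e; apply: d1; have := congr1 (fun t => h^-1 * t * h) e.
    by rewrite /d' !mulgA mulVg mul1g mulgVK mulg1 mulVg.
  have fd : vact (d ^+ k) z = z := vactX k dz.
  have fd' : vact (d' ^+ k) (vact h z) = vact h z by apply/vactX/vactJ.
  have f2 : vact (d' ^+ k) (vact (d ^+ k) (vact h z)) = vact (d ^+ k) (vact h z).
    by rewrite -vactM (co Hd' Hd) vactM fd'.
  have rk g : ret C g = 1 -> ret C (g ^+ k) = 1 by move=> e; rewrite (retX hm) e expg1n.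
  have f3 := one_vertex_fix (subgrpX k hH Hd') (rk _ d'C) (nt _ Hd' d'1) f2 fd'.
  exact/esym/(one_vertex_fix (subgrpX k hH Hd) (rk _ dC) (nt _ Hd d1) fd f3).
have [g [h1|h1]] := am_tree_stab z.
  apply: (@ret_embeds (S :\ u)); first by rewrite inE eqxx.
  by move=> h Hh; apply: (ret_conj_eq hm (HS Hh)); apply: h1; apply: fixz.
apply: (@ret_embeds (S :\ v)); first by rewrite !inE eqxx orbT.
by move=> h Hh; apply: (ret_conj_eq hm (HS Hh)); apply: h1; apply: fixz.
Qed.

(** The kernel of [ret C] on [H] acts freely, [psi] is injective on it, and the image of [psi] is
    abelian, hence cyclic. So [H] embeds through [ret C] and one integer coordinate, for which the
    two vertices missing from [C] leave room. *)
Lemma hyperbolic_kernel_embeds :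
  (forall d (z : vertex T), H d -> ret C d = 1 -> d <> 1 -> vact d z <> z) ->
  ZK_embeds H #|S|.
Proof.
move=> nofix; have [z0] := am_tree_vertex hm uv muv uS.
have h1M : hom_on H (fun=> 1 : mint) by move=> *; rewrite mulg1.
pose psi := tree_hom (T := T) hH (fun=> 1) z0.
have psiM : hom_on H psi := tree_homM (T := T) hH h1M z0.
have psi_inj d : H d -> ret C d = 1 -> psi d = 1 -> d = 1.
  move=> Hd dC pd; apply: contrapT => d1.
  have Hk := subgrpX k hH Hd; pose D := d ^+ k.
  have DC : ret C D = 1 by rewrite (retX hm) dC expg1n.
  have D1 : D <> 1 by move=> e; apply: d1; apply: (artin_torsion hm k0).
  have pD : psi D = 1 by rewrite /D (hom_onX hH psiM) // pd expg1n.
  have nfD z := nofix D z Hk DC D1.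
  have [red|[w1 [x [y [w2 [h [e Hh hx yE nx]]]]]]] := backtrackP hH z0 (vact D z0).
    exact: nfD (tree_hom_trivial pD red).
  (* Only the powers [h ^+ k] and [D] are known to commute, so [gate] is applied to them;
     root-closed edge stabilizers ensure that [h ^+ k] still moves [x]. *)
  have lhx : lact (h ^+ k) x <> x.
    move=> e1; apply: nx; apply/lact_eq; apply: (can_inj (@linvK _)); rewrite linv_lact.
    apply: (am_tree_roots (@all_rooted _ _ hm _) (@all_rooted _ _ hm _) k0 hx).
    by rewrite -linv_lact e1.
  apply: (nfD (lend x)); apply: (gate e erefl (co Hh Hd)) => //; first exact: vactX.
  rewrite yE -linv_lact -lactM -expgSr expgS lactM.
  by move=> /(can_inj (@linvK _)) /lact_inj.
have aP : abelian_on (image_on H psi).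
  by apply/virtually_commuting_free/virtually_commuting_image => //; exists k.
have [s [chi [_ hchi sE]]] := free_abelian_cyclic (image_on_subgrp hH psiM) aP.
have cC : #|C| + 1 <= #|S|.
  have := cardsD1 u S; have := cardsD1 v (S :\ u); rewrite -/C uS !inE vS.
  by case: eqP => [e|_]; [case: uv|lia].
apply: (ZK_embeds_leq cC).
apply: (@ZK_embeds_product _ _ _ H (ret C) (chi \o psi)).
- exact: (morph_hom_on (retM hm C)).
- exact: hom_on_comp psiM hchi.
- move=> h Hh hC /= ch; apply: psi_inj => //; rewrite (sE _ (ex_intro2 _ _ h Hh erefl)) ch.
  by [].
- by apply: IH; rewrite !inE eqxx !orbT.
- apply: (@ZK_embeds_Z _ _ id) => //; move=> ? ? _ _ //.
Qed.

Lemma amalgam_ZK_embeds : ZK_embeds H #|S|.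
Proof.
have [[d [z [Hd dC d1 dz]]]|nofix] := pselect (exists d (z : vertex T),
    [/\ H d, ret C d = 1, d <> 1 & vact d z = z]).
  exact: elliptic_kernel_embeds Hd dC d1 dz.
apply: hyperbolic_kernel_embeds => d z Hd dC d1 dz.
by apply: nofix; exists d, z.
Qed.

End EmbeddingAmalgam.

Lemma artin_ZK_embeds S (H : artin -> Prop) : subgrp H -> (forall h, H h -> parab S h) ->
  virtually_commuting H -> ZK_embeds H #|S|.
Proof.
elim/(parab_decomposition hm): S H => [H hH HS _|S u v uS vS uv uv0 IHu IHv IHC H hH HS vc|
  S x y xS yS _ xy2 IH H hH HS vc].
- by apply: ZK_embeds_trivial => h /HS <-; rewrite ret0.
- have IHX X : (forall H, subgrp H -> (forall h, H h -> parab X h) ->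
      virtually_commuting H -> ZK_embeds H #|X|) -> ZK_embeds (image_on H (ret X)) #|X|.
    move=> IHX; have [h1 h2] := image_ret X hH; apply: IHX h1 h2 _.
    exact: virtually_commuting_image hH (morph_hom_on (retM hm X) (H := H)) vc.
  have [k k0 co] := vc; apply: (amalgam_ZK_embeds uS vS uv uv0 hH HS k0 co) => X.
  by rewrite !inE => /or3P[] /eqP ->; apply: IHX.
have vcX X : virtually_commuting (image_on H (ret X)).
  exact: virtually_commuting_image hH (morph_hom_on (retM hm X) (H := H)) vc.
have -> : #|S| = #|[set x; y]| + #|S :\: [set x; y]|.
  rewrite -[LHS](cardsID [set x; y]); congr (_ + _); congr #|pred_of_set _|.
  by apply/setIidPr/subsetP => z; rewrite !inE => /orP[] /eqP ->.
apply: (@ZK_embeds_product _ _ _ H (ret [set x; y]) (ret (S :\: [set x; y]))).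
- exact: (morph_hom_on (retM hm _)).
- exact: (morph_hom_on (retM hm _)).
- by move=> h Hh h1 h2; rewrite -(HS h Hh) (ret_split hm _ xS yS xy2) h1 h2 mulg1.
- have [h1 h2] := image_ret [set x; y] hH.
  have [exy|/eqP xy] := eqVneq x y; last by rewrite cards2 (introN eqP xy); apply: (@pair_ZK_embeds x y).
  by subst y; rewrite setUid cards1 in h1 h2 *; apply: (@single_ZK_embeds x).
- by have [h1 h2] := image_ret (S :\: [set x; y]) hH; apply: IH.
Qed.

End Embedding.

(** * The alternative for subgroups of the finite index subgroup *)

Lemma good_pullback (G L : groupType) (H : G -> Prop) (f : G -> L) :
  hom_on H f -> good (image_on H f) -> good H.
Proof.
move=> hf [X [phi [hphi [_ [_ [[x Hx <-] [y Hy <-] nc]]]]]].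
exists X, (phi \o f); split; first exact: hom_on_comp.
by exists x, y.
Qed.

Section Alternative.
Variables (V : finType) (m : V -> V -> nat).
Hypothesis hm : is_EAFC m.
Local Notation artin := (artin m).
Implicit Types (g h : artin) (S X Y : {set V}).

(** An embedding in Z^s x K^t becomes additive after squaring, because the second Klein coordinate
    of a square is even and acts trivially. On an abelian torsion-free group squaring is an
    injective homomorphism. *)
Lemma abelian_coordinates (H : artin -> Prop) : subgrp H -> abelian_on H ->
  exists n (rho : artin -> 'rV[int]_n),
    (forall g h, H g -> H h -> rho (g * h) = (rho g + rho h)%R) /\
    (forall h, H h -> rho h = 0%R -> h = 1).
Proof.
move=> hH aH; have [||I [J [p [q [_ hp hq inj]]]]] := @artin_ZK_embeds _ _ hm setT H hH.
- by move=> h _; apply: retT.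
- by exists 1%N => // g h Hg Hh; rewrite !expg1; apply: aH.
pose coord (k : I + (J + J)) h : int :=
  match k with
  | inl i => p i (h ^+ 2) | inr (inl j) => (q j (h ^+ 2)).1 | inr (inr j) => (q j (h ^+ 2)).2
  end.
have coordM k g h : H g -> H h -> coord k (g * h) = (coord k g + coord k h)%R.
  move=> Hg Hh; have Xg := subgrpX 2 hH Hg; have Xh := subgrpX 2 hH Hh.
  have even j z : klein_act (q j g * q j g).2 z = z.
    by rewrite -[LHS]/(sgn_act ((q j g).2 + (q j g).2 : int)%R z) /sgn_act odd_abszD addbb.
  rewrite /coord expgMn; last exact: aH.
  case: k => [i|[j|j]]; rewrite ?hp ?hq // sdprod_mulE.
  rewrite -[LHS]/((q j g * q j g).1 * klein_act (q j g * q j g).2 (q j h * q j h).1).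
  by rewrite even.
exists #|{: I + (J + J)}|, (fun h => (\row_k coord (enum_val k) h)%R); split=> [g h Hg Hh|h Hh].
  by apply/rowP => k; rewrite !mxE coordM.
move=> e; have c0 k : coord k h = 0%R.
  by have := congr1 (fun r : 'rV_ _ => r ord0 (enum_rank k)) e; rewrite !mxE enum_rankK.
apply: (artin_torsion hm (isT : 0 < 2)); apply: inj; first exact: subgrpX.
  by move=> i; apply: (c0 (inl i)).
move=> j; have := c0 (inr (inl j)); have := c0 (inr (inr j)); rewrite /coord.
by case: (q j _) => a b /= -> ->.
Qed.

(** Only the smaller end of each edge is constrained: a single congruence per edge yields the index
    bound, and it already makes the Z-part of the dihedral model act trivially. *)
Definition artin0 g := forall x y, m x y <> 0%N -> enum_rank x < enum_rank y ->
  ((m x y)./2 %| (expo x g : int))%Z.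

Lemma artin0_subgrp : subgrp artin0.
Proof.
split=> [|g h hg hh|g hg] x y xy lt.
- by rewrite (morphg1 (expoM hm x)) dvdz0.
- by rewrite (expoM hm) mintM rpredD ?hg ?hh.
- by rewrite (morphgV (expoM hm x)) mintV rpredN hg.
Qed.

Lemma artin0_conj g h : artin0 h -> artin0 (g * h * g^-1).
Proof.
move=> hh x y xy lt; rewrite !(expoM hm) (morphgV (expoM hm x)) mint_commute mulgA mulVg mul1g.
exact: hh.
Qed.

Lemma artin0_ret X g : artin0 g -> artin0 (ret X g).
Proof.
move=> hg x y xy lt; have [xX|xX] := boolP (x \in X); first by rewrite (expo_ret hm) ?hg.
by rewrite (expo_ret0 hm) // dvdz0.
Qed.

(** In the amalgam case both retractions of [H] may be assumed abelian; their integer coordinates,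
    put side by side, are injective on vertex stabilizers by [am_tree_free]. In the join case
    commutators vanish in both factors. *)
Lemma artin_alternative S (H : artin -> Prop) : subgrp H -> (forall h, H h -> parab S h) ->
  (forall h, H h -> artin0 h) -> abelian_on H \/ good H.
Proof.
elim/(parab_decomposition hm): S H => [H hH HS _|S u v uS vS uv uv0 IHu IHv _ H hH HS H0|
  S x y xS yS adj xy2 IH H hH HS H0].
- by left=> g h /HS <- /HS <-; rewrite !ret0.
- have IHX X : (forall H, subgrp H -> (forall h, H h -> parab X h) ->
      (forall h, H h -> artin0 h) -> abelian_on H \/ good H) ->
      abelian_on (image_on H (ret X)) \/ good H.
    move=> IHX; have [h1 h2] := image_ret hm X hH.
    have [||gd] := IHX _ h1 h2; [by move=> _ [h /H0 h0 <-]; apply: artin0_ret|by left|right].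
    by apply: good_pullback gd; apply: (morph_hom_on (retM hm X)).
  have [au|] := IHX _ IHu; last by right.
  have [av|] := IHX _ IHv; last by right.
  have hom X : hom_on H (ret X) := morph_hom_on (retM hm X) (H := H).
  have [nu [ru [ruM ru0]]] := abelian_coordinates (image_ret hm (S :\ u) hH).1 au.
  have [nv [rv [rvM rv0]]] := abelian_coordinates (image_ret hm (S :\ v) hH).1 av.
  have im X h : H h -> image_on H (ret X) (ret X h) by move=> Hh; exists h.
  pose rho h := row_mx (ru (ret (S :\ u) h)) (rv (ret (S :\ v) h)).
  apply: (@tree_alternative _ (am_tree hm uv uv0 uS) _ hH _ rho).
  + move=> g h Hg Hh; rewrite /rho !(retM hm) ruM ?rvM ?add_row_mx //; exact: im.
  + move=> a z Ha az; rewrite /rho -(row_mx0 _ 1 nu nv) => /eq_row_mx[eu ev].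
    by apply: (am_tree_free (HS _ Ha) az); [apply: ru0 eu|apply: rv0 ev]; apply: im.
  + move=> a l k _; apply: am_tree_roots; exact: all_rooted.
  + exact: am_tree_vertex.
have [aX|] : abelian_on (image_on H (ret [set x; y])) \/ good (image_on H (ret [set x; y])).
  have [h1 h2] := image_ret hm [set x; y] hH.
  have h0 : forall h, image_on H (ret [set x; y]) h -> artin0 h.
    by move=> _ [h /H0 h0 <-]; apply: artin0_ret.
  have [exy|/eqP xy] := eqVneq x y.
    subst y; left=> g h /h2 + /h2; rewrite setUid => <- <-; rewrite !ret_single //.
    exact: cycle_of_abelian (ex_intro _ _ erefl) (ex_intro _ _ erefl).
  have xy0 : m x y <> 0%N by case: adj.
  (* [pair_alternative] constrains the exponent of its first vertex, so the smaller vertex has to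
     come first. *)
  case: (ltngtP (enum_rank x) (enum_rank y)) => [lt|gt|/val_inj/enum_rank_inj //].
    by apply: (pair_alternative hm xy h1 h2) => h /h0; apply.
  have yx : y <> x by move=> e; case: xy.
  apply: (pair_alternative hm yx h1).
    by move=> h /h2; rewrite setUC.
  by move=> h /h0; apply=> //; rewrite (label_sym hm).
- have [h1 h2] := image_ret hm (S :\: [set x; y]) hH.
  have [|aY|] := IH _ h1 h2; [by move=> _ [h /H0 h0 <-]; apply: artin0_ret| |].
    left=> g h Hg Hh; apply/commgP/eqP; have Hgh : H [~ g, h].
      by rewrite /commg; apply: (subgrpM hH); [exact: (subgrpV hH)|exact: (subgrpJ hH)].
    rewrite -(HS _ Hgh) (ret_split hm _ xS yS xy2).
    have triv X : abelian_on (image_on H (ret X)) -> ret X [~ g, h] = 1.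
      move=> aI; rewrite (hom_onR hH (morph_hom_on (retM hm X) (H := H))) //.
      by apply/eqP/commgP/aI; [exists g|exists h].
    by rewrite !triv ?mulg1.
  by move=> gd; right; apply: good_pullback gd; apply: (morph_hom_on (retM hm _)).
by move=> gd; right; apply: good_pullback gd; apply: (morph_hom_on (retM hm _)).
Qed.

End Alternative.

(** * Klein bottle group and free abelian groups *)

Lemma greprM (S : sgroup) (a b : gquot S) :
  geq (grepr (a * b)) (gmul (grepr a) (grepr b)).
Proof. by apply/gclP; rewrite gclM !greprK. Qed.

Lemma grepr_inj (S : sgroup) (a b : gquot S) : geq (grepr a) (grepr b) -> a = b.
Proof. by move/gclP; rewrite !greprK. Qed.

Section FreeSetoid.
Variable Y : choiceType.

Lemma pres_eq_foldr_push (R : word Y -> word Y -> Prop) (w u : seq (Y * bool)) :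
  pres_eq R (foldr (@push Y) u w) (w ++ u).
Proof.
elim: w => [|l w IH] /=; first exact: pe_refl.
have step v : pres_eq R (push l v) (l :: v).
  case: v => [|l' v] /=; first exact: pe_refl.
  case: ifP => [/eqP ->|_]; last exact: pe_refl.
  by apply: pe_sym; case: l => x b; apply: (pe_free R [::] v x b).
apply: pe_trans (step _) _.
by rewrite -[l :: _]/([:: l] ++ _) -[l :: (w ++ u)]/([:: l] ++ _); apply: pe_catl.
Qed.

Lemma fword_hom (f g : free Y) :
  geq (fword (f * g) : free_group Y) (gmul (fword f : free_group Y) (fword g : free_group Y)).
Proof. exact: pres_eq_foldr_push. Qed.

Lemma fword_fprod_eq (w : free_group Y) : geq (fword (fprod w) : free_group Y) w.
Proof.
rewrite fword_fprod -[X in geq _ X]cats0; exact: pres_eq_foldr_push.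
Qed.

End FreeSetoid.

(** The image is not cyclic, so Nielsen-Schreier provides two basis letters; the others are sent to
    1, and [up] splits the resulting map onto rank 2. *)
Lemma good_surjection (G : groupType) (H : G -> Prop) : subgrp H -> good H ->
  exists (psi : G -> free bool), hom_on H psi /\ forall f, exists2 h, H h & psi h = f.
Proof.
move=> hH [X [phi [hphi [g [h [Hg Hh nc]]]]]].
have hI := image_on_subgrp hH hphi.
have [[s [chi [_ _ sE]]]|[Y [y1 [y2 [psi [ne hpsi sur]]]]]] := nielsen_schreier hI.
  have cyc f : image_on H phi f -> cycle_of s f by move=> /sE e; exists (chi f).
  by case: nc; apply: (@cycle_of_abelian _ s); apply: cyc; [exists g|exists h].
pose col y : free bool := if y == y1 then fgen true else if y == y2 then fgen false else 1.
exists (fext col \o (psi \o phi)); split=> [|f].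
  by apply: hom_on_comp; [apply: hom_on_comp|apply/morph_hom_on/fextM].
pose up (b : bool) : free Y := fgen (if b then y1 else y2).
have [_ [a Ha <-] e] := sur (fext up f); exists a => //=; rewrite e.
apply: (@free_hom_eq _ _ (fext col \o fext up) id) => // [f1 f2|b]; first by rewrite /= !fextM.
rewrite /= !fext_gen /col; case: b; rewrite ?eqxx //.
by case: eqP => // e'; case: ne.
Qed.

Definition klein_rel (l r : word bool) :=
  l = [:: (true, true); (true, true)] /\ r = [:: (false, true); (false, true)].
Local Notation kpres := (presg klein_rel).

(** For a = x y^-1 the relation x^2 = y^2 says that y inverts a, which leads from the given
    presentation to the semidirect product. *)
Definition klein_a : kpres := pgen klein_rel true * (pgen klein_rel false)^-1.
Definition klein_y : kpres := pgen klein_rel false.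

Lemma klein_y_conj : klein_a ^ klein_y^-1 = klein_a^-1.
Proof.
have e : pgen klein_rel true * pgen klein_rel true = klein_y * klein_y.
  have := @pcl_rel _ klein_rel _ _ (conj erefl erefl).
  by rewrite !pclE !big_cons !big_nil !mulg1.
rewrite conjgE invgK invgM invgK /klein_a -/klein_y !mulgA.
apply: (@mulIg _ klein_y); rewrite mulgVK; apply: (@mulIg _ klein_y); rewrite mulgVK.
by rewrite -[RHS]mulgA -e mulgA mulgVK.
Qed.

Definition klein_map (d : kleinm) : kpres := expgz klein_a d.1 * expgz klein_y d.2.

Lemma klein_conj (i j : int) :
  expgz klein_y j * expgz klein_a i * (expgz klein_y j)^-1 = expgz klein_a (sgn_act j i).
Proof.
have J (a z : kpres) : a * z * a^-1 = (z ^ a^-1)%g by rewrite conjgE invgK mulgA.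
have step (i' : int) : expgz klein_a i' ^ klein_y^-1 = expgz klein_a (- i')%R.
  by rewrite expgzJ klein_y_conj -[klein_a^-1]/(expgz klein_a (-1)) -expgzM mulN1r.
have stepV (i' : int) : expgz klein_a i' ^ klein_y = expgz klein_a (- i')%R.
  by apply: (@conjg_inj _ klein_y^-1); rewrite conjgK step opprK.
elim/int_rec: j i => [|n IH|n IH] i; first by rewrite invg1 mulg1 mul1g.
- rewrite -[n.+1]addn1 PoszD addrC expgzD expgz1 J invgM conjgM -[X in (X ^ _)%g]J IH step.
  rewrite /sgn_act odd_abszD; case: (odd `|Posz n|%N); rewrite //=.
  by rewrite mintV opprK.
- have -> : (- Posz n.+1 = - 1 - Posz n)%R by lia.
  rewrite expgzD J invgM conjgM -[X in (X ^ _)%g]J IH expgzN invgK stepV.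
  rewrite /sgn_act odd_abszD; case: (odd `|(- Posz n)%R|%N); rewrite //=.
  by rewrite mintV opprK.
Qed.

Lemma klein_mapM : {morph klein_map : d e / d * e}.
Proof.
move=> [i j] [i' j']; rewrite /klein_map sdprod_mulE !expgzMm -[klein_act _ _]/(sgn_act j i').
by rewrite -klein_conj !mulgA mulgVK.
Qed.

Lemma klein_map_inj d : klein_map d = 1 -> d = 1.
Proof.
(* The images of x and y: both squares are (0, 2) in additive notation, so the presentation supplies
   a left inverse of [klein_map]. *)
pose k1 : kleinm := (mone, mone); pose k2 : kleinm := (1, mone).
pose f (b : bool) : kleinm := if b then k1 else k2.
have fr l r : klein_rel l r -> weval f l = weval f r.
  by move=> [-> ->]; rewrite /weval !big_cons !big_nil.
have fM := pextM fr; move=> /(congr1 (pext f)); rewrite (morphg1 fM) /klein_map fM.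
rewrite !(morph_expgz _ _ fM) fM (morphgV fM) !pext_gen //.
have -> : f true * (f false)^-1 = (mone, 1) by [].
have e1 (i : int) : expgz ((mone, 1) : kleinm) i = (i, 1).
  have nat (n : nat) : ((mone, 1) : kleinm) ^+ n = (n : int, 1).
    elim: n => [//|n IH]; rewrite expgSr IH sdprod_mulE; congr pair.
    by rewrite -[LHS]/((n : int) + 1)%R -[RHS]/(n.+1 : int); lia.
  by case: i => n /=; rewrite nat //; apply/mulg1_eq.
have e2 (i : int) : expgz ((1, mone) : kleinm) i = (1, i).
  have nat (n : nat) : ((1, mone) : kleinm) ^+ n = (1, n : int).
    elim: n => [//|n IH]; rewrite expgSr IH sdprod_mulE gact1 mulg1; congr pair.
    by rewrite -[LHS]/((n : int) + 1)%R -[RHS]/(n.+1 : int); lia.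
  case: i => n; rewrite /= nat //; apply/mulg1_eq; rewrite sdprod_mulE gact1 mulg1; congr pair.
  by rewrite NegzE; apply: (mulgV (Posz n.+1 : mint)).
by case: d => i j; rewrite /= e1 e2 sdprod_mulE /= mulg1 mul1g.
Qed.

Section FreeAbelian.
Variable G : groupType.

(** The first coordinate has image d Z. If d = 0 it is dropped; otherwise an element with value d
    completes a basis of its kernel. The new coordinates become surjective, as an isomorphism with a
    free abelian group requires. *)
Lemma free_abelian_basis n (H : G -> Prop) (rho : G -> 'rV[int]_n) : subgrp H -> abelian_on H ->
  (forall g h, H g -> H h -> rho (g * h) = (rho g + rho h)%R) ->
  (forall h, H h -> rho h = 0%R -> h = 1) ->
  exists k (c : G -> 'rV[int]_k), [/\ forall g h, H g -> H h -> c (g * h) = (c g + c h)%R,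
    forall h, H h -> c h = 0%R -> h = 1 & forall z, exists2 h, H h & c h = z].
Proof.
elim: n H rho => [|n IH] H rho hH aH rhoM rho0.
  exists 0%N, rho; split=> // z; exists 1; first exact: subgrp1.
  by rewrite (thinmx0 z) thinmx0.
pose p h : mint := rho h ord0 ord0.
have hp : hom_on H p by move=> g h Hg Hh; rewrite /p rhoM // mxE.
pose K h := H h /\ p h = 1.
have hK : subgrp K.
  split=> [|g h [Hg pg] [Hh ph]|g [Hg pg]].
  - by split; [apply: subgrp1|apply: (hom_on1 hH hp)].
  - by split; [apply: subgrpM|rewrite hp // pg ph].
  - by split; [apply: subgrpV|rewrite (hom_onV hH hp) // pg].
have aK : abelian_on K by move=> g h [Hg _] [Hh _]; apply: aH.
have [||k [c [cM c0 cS]]] := IH K (fun h => col' ord0 (rho h)) hK aK.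
- by move=> g h [Hg _] [Hh _]; rewrite rhoM // linearD.
- move=> h [Hh ph] e; apply: rho0 => //; apply/rowP => j; rewrite mxE.
  case: (unliftP ord0 j) => [i|] ->; last exact: ph.
  by have := congr1 (fun r : 'rV_ _ => r ord0 i) e; rewrite !mxE.
have [g [Hg gE]] := image_generator hH hp.
pose d := p g : int; pose q h : int := ((p h : int) %/ d)%Z.
have pq h : H h -> (p h : int) = (q h * d)%R by move=> /gE/divzK.
have [d0|d0] := eqVneq d 0%R.
  have HK h : H h -> K h by move=> Hh; split=> //; have := pq h Hh; rewrite d0 mulr0.
  exists k, c; split=> [a b Ha Hb|h Hh|z]; [by apply: cM; apply: HK|by apply/c0/HK|].
  by have [h [Hh _] <-] := cS z; exists h.
have qM a b : H a -> H b -> q (a * b) = (q a + q b)%R.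
  move=> Ha Hb; apply: (mulIf d0); rewrite mulrDl -!pq //; last exact: subgrpM.
  by rewrite hp.
pose rest h := h * expgz g (- q h)%R.
have Krest h : H h -> K (rest h).
  move=> Hh; have Hgq := subgrp_expgz (- q h)%R hH Hg; split; first exact: subgrpM.
  rewrite /rest hp // (hom_on_expgz _ hH hp) // -[LHS]/((p h : int) + _)%R.
  by rewrite -[expgz _ _]/(expgz (p g) _ : int) expgz_mint (pq _ Hh) mulrN [(q h * d)%R]mulrC addrN.
have restM a b : H a -> H b -> rest (a * b) = rest a * rest b.
  move=> Ha Hb; rewrite /rest qM // opprD expgzD -!mulgA; congr (_ * _); rewrite !mulgA; congr (_ * _).
  by apply: aH => //; apply: subgrp_expgz.
exists (1 + k)%N, (fun h => row_mx (const_mx (q h)) (c (rest h))); split=> [a b Ha Hb|h Hh|z].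
- by rewrite qM // restM // cM ?add_row_mx; [congr row_mx; apply/matrixP => i j; rewrite !mxE|exact: Krest|exact: Krest].
- rewrite -(row_mx0 _ 1 1 k) => /eq_row_mx[/matrixP/(_ ord0 ord0)]; rewrite !mxE => q0.
  move/(c0 _ (Krest _ Hh)); rewrite /rest q0 oppr0 mulg1; exact.
- have [h [Hh ph] ch] := cS (rsubmx z); pose i := lsubmx z ord0 ord0.
  have Hgi := subgrp_expgz i hH Hg; have Hx := subgrpM hH Hh Hgi.
  have qx : q (h * expgz g i) = i.
    apply: (mulIf d0); rewrite -pq // hp // ph (hom_on_expgz _ hH hp) // mul1g.
    by rewrite -[LHS]/(expgz (p g) i : int) expgz_mint mulrC.
  exists (h * expgz g i) => //; rewrite /rest qx expgzN mulgK ch -[RHS]hsubmxK.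
  by congr row_mx; apply/rowP => j; rewrite !mxE ord1 /i mxE.
Qed.

End FreeAbelian.

Section FreeAbelianPresentation.
Variable k : nat.
Definition fab_rel (l r : word 'I_k) :=
  exists x y : 'I_k, l = [:: (x, true); (y, true)] /\ r = [:: (y, true); (x, true)].
Local Notation A := (presg fab_rel).

Lemma fab_commute (a b : A) : commute a b.
Proof.
have gg x y : commute (pgen fab_rel x) (pgen fab_rel y).
  have := @pcl_rel _ fab_rel _ _ (ex_intro _ x (ex_intro _ y (conj erefl erefl))).
  by rewrite !pclE !big_cons !big_nil !mulg1.
apply: (@generated_abelian _ (fun a => exists x, a = pgen fab_rel x)).
- by move=> _ _ [x ->] [y ->].
- by apply: pres_ind a; [apply: generated_subgrp|move=> x; apply: generated_sub; exists x].
- by apply: pres_ind b; [apply: generated_subgrp|move=> x; apply: generated_sub; exists x].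
Qed.

Definition fab_map (z : 'rV[int]_k) : A := \prod_(i < k) expgz (pgen fab_rel i) (z ord0 i).

Lemma fab_mapD z t : fab_map (z + t)%R = fab_map z * fab_map t.
Proof.
rewrite /fab_map -prodgM_commute; last by move=> *; apply: fab_commute.
by apply: eq_bigr => i _; rewrite mxE expgzD.
Qed.

Lemma fab_map_inj z t : fab_map z = fab_map t -> z = t.
Proof.
move=> e; apply/rowP => i.
pose f (j : 'I_k) : mint := if j == i then mone else 1.
have fr l r : fab_rel l r -> weval f l = weval f r.
  move=> [x [y [-> ->]]]; rewrite /weval !big_cons !big_nil !mulg1; exact: mint_commute.
have fM := pextM fr.
have E s : pext f (fab_map s) = s ord0 i.
  rewrite /fab_map (big_morph _ fM (morphg1 fM)).
  rewrite (eq_bigr (fun j => if j == i then s ord0 i : mint else 1)) => [|j _].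
    by rewrite -big_mkcond big_pred1_eq.
  rewrite (morph_expgz _ _ fM) pext_gen // /f.
  by case: eqP => [->|_]; [apply: expgz_mone|apply: expgz1g].
by rewrite -!E e.
Qed.

Lemma fab_map_surj a : exists z, fab_map z = a.
Proof.
have f0 : fab_map 0%R = 1 by rewrite /fab_map big1 // => i _; rewrite mxE.
have E x : fab_map (delta_mx ord0 x) = pgen fab_rel x.
  rewrite /fab_map (eq_bigr (fun j => if j == x then pgen fab_rel x else 1)) => [|j _].
    by rewrite -big_mkcond big_pred1_eq.
  by rewrite mxE eqxx /=; case: eqP => [->|_].
apply: (@pres_ind _ fab_rel (fun a => exists z, fab_map z = a)); last by move=> x; exists (delta_mx ord0 x).
split=> [|_ _ [z <-] [t <-]|_ [z <-]]; first by exists 0%R.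
- by exists (z + t)%R; rewrite fab_mapD.
- by exists (- z)%R; apply/esym/mulg1_eq; rewrite -fab_mapD addrN.
Qed.

End FreeAbelianPresentation.

(** * Transfer to setoid groups *)

Section Index.
Variable G : groupType.

Definition index_at_most (K : G -> Prop) (n : nat) :=
  exists reps : seq G, size reps <= n /\ forall g, exists2 r, r \in reps & K (r^-1 * g).

(** Each representative [r] is replaced by elements of its coset [r K] realizing the residues of [p]
    modulo [k]; a residue that does not occur receives the default 1, which is harmless for the
    bound. *)
Lemma index_step (K : G -> Prop) n (p : G -> mint) k : subgrp K -> {morph p : g h / g * h} ->
  0 < k -> index_at_most K n ->
  index_at_most (fun g => K g /\ (k %| (p g : int))%Z) (n * k).
Proof.
move=> hK pM k0 [reps [sz repsE]].
pose P r (i : nat) z := K (r^-1 * z) /\ ((p z : int) %% k)%Z = i.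
pose f r i := if pselect (exists z, P r i z) is left h then projT1 (cid h) else 1.
have fP r i z : P r i z -> P r i (f r i).
  by move=> h; rewrite /f; case: pselect => [h'|[]]; [apply: projT2 (cid h')|exists z].
exists [seq f r i | r <- reps, i <- iota 0 k]; split.
  by rewrite size_allpairs size_iota leq_mul2r sz orbT.
move=> g; have [r rr Krg] := repsE g.
have kz : Posz k != 0%R by lia.
have md := @modz_ge0 (p g : int) k kz; have lt := ltz_pmod (p g : int) (_ : 0 < Posz k)%R.
have Pg : P r `|((p g : int) %% k)%Z|%N g by split; rewrite // gez0_abs.
have [K1 p1] := fP _ _ _ Pg; exists (f r `|((p g : int) %% k)%Z|%N).
  apply/allpairsP; exists (r, `|((p g : int) %% k)%Z|%N); rewrite mem_iota add0n; split=> //=.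
  have k0' : (0 < Posz k)%R by lia.
  by have := lt k0'; move: md; move: (modz _ _) => t; lia.
split.
  by have := subgrpM hK (subgrpV hK K1) Krg; rewrite invgM invgK mulgA mulgK.
rewrite pM (morphgV pM) mintM mintV addrC -eqz_mod_dvd; apply/eqP.
by rewrite p1 gez0_abs.
Qed.

End Index.

Section Artin0Index.
Variables (V : finType) (m : V -> V -> nat).
Hypothesis hm : is_EAFC m.

Lemma artin0_index : index_at_most (@artin0 V m) (edge_half_prod m).
Proof.
pose P (e : V * V) := (enum_rank e.1 < enum_rank e.2)%N && (m e.1 e.2 != 0)%N.
pose L := [seq e <- index_enum (V * V)%type | P e].
have -> : edge_half_prod m = (\prod_(e <- L) (m e.1 e.2)./2)%N.
  by rewrite /edge_half_prod pair_big_dep /= big_filter.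
have PL e : e \in L -> m e.1 e.2 <> 0%N by rewrite mem_filter => /andP[/andP[_ /eqP]].
have LP x y : m x y <> 0%N -> (enum_rank x < enum_rank y)%N -> (x, y) \in L.
  by move=> /eqP h1 h2; rewrite mem_filter /P /= h2 h1 mem_index_enum.
pose K (l : seq (V * V)) (g : artin m) :=
  forall e, e \in l -> ((m e.1 e.2)./2 %| (expo e.1 g : int))%Z.
have hK l : subgrp (K l).
  split=> [|g h hg hh|g hg] e el.
  - by rewrite (morphg1 (expoM hm e.1)) dvdz0.
  - by rewrite (expoM hm) mintM rpredD ?hg ?hh.
  - by rewrite (morphgV (expoM hm e.1)) mintV rpredN hg.
(* The congruences are imposed one edge at a time, each multiplying the bound by the half-label. *)
have idx l : {subset l <= L} -> index_at_most (K l) (\prod_(e <- l) (m e.1 e.2)./2)%N.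
  elim: l => [|e l IH] lL.
    by rewrite big_nil; exists [:: 1]; split=> // g; exists 1; rewrite ?inE.
  rewrite big_cons mulnC.
  have e0 : (0 < (m e.1 e.2)./2)%N.
    by apply: (half_label_gt0 hm); apply: PL; apply: lL; rewrite mem_head.
  have lL' : {subset l <= L} by move=> z zl; apply: lL; rewrite inE zl orbT.
  have [reps [sz repsE]] := index_step (hK l) (expoM hm e.1) e0 (IH lL').
  exists reps; split=> // g; have [r rr [h1 h2]] := repsE g; exists r => // z.
  by rewrite inE => /orP[/eqP ->|/h1].
have [reps [sz repsE]] := idx L (fun _ => id).
exists reps; split=> // g; have [r rr h] := repsE g; exists r => // x y xy lt.
exact: (h (x, y) (LP _ _ xy lt)).
Qed.

End Artin0Index.

Section Transfer.
Variables (V : finType) (m : V -> V -> nat).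
Hypothesis hm : is_EAFC m.
Local Notation Gs := (artin_group m).
Local Notation pc := (pcl (artin_rel m)).

Lemma pcl_mul (w u : Gs) : pc (gmul w u) = pc w * pc u.
Proof. exact: pcl_cat. Qed.
Lemma pcl_inv (w : Gs) : pc (ginv w) = (pc w)^-1.
Proof. exact: (@gclV Gs). Qed.
Lemma pcl_geq (w u : Gs) : geq w u -> pc w = pc u.
Proof. by move=> e; apply/pclP. Qed.

Definition descend (H : Gs -> Prop) (a : artin m) : Prop := H (grepr a).

Section Subgroup.
Variables (H : Gs -> Prop) (hH : is_subgroup Gs H).

Lemma descendE w : descend H (pc w) <-> H w.
Proof.
have e : @geq Gs (grepr (pc w)) w by apply: (@grepr_gcl Gs).
by split; apply: (sub_geq hH); [|apply: geq_sym].
Qed.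

Lemma descend_subgrp : subgrp (descend H).
Proof.
split=> [|a b|a].
- exact/(descendE [::])/(sub_one hH).
- have [w ->] := pcl_surj a; have [u ->] := pcl_surj b.
  move=> /descendE Hw /descendE Hu; rewrite -pcl_cat; apply/descendE.
  exact: (sub_mul hH Hw Hu).
- have [w ->] := pcl_surj a => /descendE Hw; rewrite -pcl_inv; apply/descendE.
  exact: (sub_inv hH Hw).
Qed.

Lemma hom_on_setoid (L : groupType) (f : artin m -> L) (x y : sub_sgroup hH) :
  hom_on (descend H) f ->
  f (pc (proj1_sig (gmul x y))) = f (pc (proj1_sig x)) * f (pc (proj1_sig y)).
Proof.
move=> hf; case: x y => [w Hw] [u Hu]; rewrite -hf; first by rewrite -pcl_cat.
  exact/descendE.
exact/descendE.
Qed.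

Lemma ZK_embeds_setoid n : ZK_embeds (descend H) n ->
  exists s t : nat, (s + 2 * t <= n)%N /\
    exists f : sub_sgroup hH -> ZK_group s t, is_hom f /\ hom_injective f.
Proof.
move=> [I [J [p [q [c hp hq inj]]]]]; exists #|I|, #|J|; split=> //.
pose f (x : sub_sgroup hH) : ZK_group #|I| #|J| :=
  ((fun i => p (enum_val i) (pc (proj1_sig x)) : Zgroup),
   (fun j => grepr (klein_map (q (enum_val j) (pc (proj1_sig x)))) : klein_group)).
exists f; split; first split.
- move=> [w Hw] [u Hu] /pcl_geq /= e; rewrite /f /= e; split=> i; first by [].
  exact: pe_refl.
- move=> x y; rewrite /f; split=> i /=; first exact: hom_on_setoid x y (hp (enum_val i)).
  have -> := hom_on_setoid x y (hq (enum_val i)); rewrite klein_mapM.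
  exact: (@greprM klein_group).
- move=> x y [/= e1 e2]; suff e : pc (proj1_sig x) = pc (proj1_sig y) by apply/pclP.
  have Hx : descend H (pc (proj1_sig x)) by apply/descendE; apply: (proj2_sig x).
  have Hy : descend H (pc (proj1_sig y)) by apply/descendE; apply: (proj2_sig y).
  have hD := descend_subgrp.
  apply: divg1_eq; apply: inj; first exact: subgrpF.
    move=> i; rewrite hp //; last exact: subgrpV.
    by rewrite (hom_onV hD (hp i)) //; have := e1 (enum_rank i); rewrite enum_rankK => ->; rewrite mulgV.
  move=> j; rewrite hq //; last exact: subgrpV.
  rewrite (hom_onV hD (hq j)) //; have := e2 (enum_rank j); rewrite enum_rankK.
  move=> /(@grepr_inj klein_group) e; apply: klein_map_inj.
  by rewrite klein_mapM (morphgV klein_mapM) e mulgV.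
Qed.

Lemma good_setoid : good (descend H) ->
  exists f : sub_sgroup hH -> free_group bool, is_hom f /\ hom_surjective f.
Proof.
move=> /(good_surjection descend_subgrp)[psi [hpsi sur]].
exists (fun x => fword (psi (pc (proj1_sig x)))); split; first split.
- by move=> x y /pcl_geq ->; apply: geq_refl.
- by move=> x y; rewrite (hom_on_setoid x y hpsi); apply: fword_hom.
- move=> w; have [h Hh e] := sur (fprod w).
  exists (exist _ (grepr h) Hh); rewrite /= /pcl greprK e.
  exact: fword_fprod_eq.
Qed.

Lemma free_abelian_setoid : abelian_on (descend H) -> is_free_abelian (sub_sgroup hH).
Proof.
move=> aH; have hD := descend_subgrp.
have [n [rho [rhoM rho0]]] := abelian_coordinates hm hD aH.
have [k [c [cM c0 cS]]] := free_abelian_basis hD aH rhoM rho0.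
pose f (x : sub_sgroup hH) : free_abelian_group 'I_k := grepr (fab_map (c (pc (proj1_sig x)))).
have Hx (x : sub_sgroup hH) : descend H (pc (proj1_sig x)).
  by apply/descendE; apply: (proj2_sig x).
exists 'I_k, f; split; first split; last split.
- by move=> x y /pcl_geq e; rewrite /f e; apply: geq_refl.
- move=> x y; rewrite /f [pc _]pcl_cat cM // fab_mapD.
  exact: (@greprM (free_abelian_group 'I_k)).
- move=> x y /(@grepr_inj (free_abelian_group 'I_k)) /fab_map_inj e.
  suff e' : pc (proj1_sig x) = pc (proj1_sig y) by apply/pclP.
  apply: divg1_eq; apply: c0; first exact: subgrpF.
  have cV h : descend H h -> c h^-1 = (- c h)%R.
    have c1 : c 1 = 0%R.
      by apply: (addrI (c 1)); rewrite -cM ?mulg1 ?addr0 //; apply: subgrp1.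
    move=> Hh; apply: (addrI (c h)); rewrite -cM ?mulgV ?c1 ?subrr //; exact: subgrpV.
  by rewrite cM ?cV ?e ?subrr //; apply: subgrpV.
- move=> w; have [z ez] := fab_map_surj (pcl (@fab_rel k) w); have [h Hh ch] := cS z.
  exists (exist _ (grepr h) Hh); rewrite /f /= /pcl greprK ch ez.
  exact: (@grepr_gcl (free_abelian_group 'I_k)).
Qed.

End Subgroup.

Definition artin0_word (w : Gs) : Prop := artin0 (pc w).

Lemma artin0_word_subgroup : is_subgroup Gs artin0_word.
Proof.
have h0 := artin0_subgrp hm; split; rewrite /artin0_word.
- by move=> x y /pcl_geq ->.
- exact: (subgrp1 h0).
- by move=> x y hx hy; rewrite pcl_mul; apply: (subgrpM h0).
- by move=> x hx; rewrite pcl_inv; apply: (subgrpV h0).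
Qed.

Lemma artin0_word_normal : is_normal Gs artin0_word.
Proof. by move=> g h hh; rewrite /artin0_word !pcl_mul pcl_inv; apply: artin0_conj. Qed.

Lemma In_map_mem (T : eqType) (U : Type) (f : T -> U) (s : seq T) x :
  x \in s -> List.In (f x) (map f s).
Proof.
elim: s => //= y s IH; rewrite inE => /orP[/eqP ->|/IH]; by [left|right].
Qed.

Lemma artin0_word_index : index_le Gs artin0_word (edge_half_prod m).
Proof.
have [reps [sz repsE]] := artin0_index hm.
exists (map (@grepr Gs) reps); split; first by rewrite size_map.
move=> g; have [r rr h] := repsE (pc g); exists (grepr r); split; first exact: In_map_mem.
by rewrite /artin0_word pcl_mul pcl_inv /pcl greprK.
Qed.

Section FiniteIndex.
Variables (H : Gs -> Prop) (hH : is_subgroup Gs H).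
Definition trace (x : sub_sgroup hH) : Prop := artin0_word (proj1_sig x).

Lemma trace_subgroup : is_subgroup (sub_sgroup hH) trace.
Proof.
have [h1 h2 h3 h4] := artin0_word_subgroup; split; rewrite /trace.
- by move=> x y; apply: h1.
- exact: h2.
- by move=> x y; apply: h3.
- by move=> x; apply: h4.
Qed.

(** Representatives in the big group need not lie in [H]; each is exchanged for an element of [H] in
    its coset, if there is one. *)
Lemma trace_finite_index : finite_index (sub_sgroup hH) trace.
Proof.
have [reps [_ repsE]] := artin0_word_index; exists (size reps).
pose pick (r : Gs) : sub_sgroup hH :=
  if pselect (exists x : sub_sgroup hH, artin0_word (gmul (ginv r) (proj1_sig x))) is left h
  then projT1 (cid h) else gone _.
exists (map pick reps); split; first by rewrite size_map.
move=> x; have [r [rr h]] := repsE (proj1_sig x); exists (pick r); split.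
  exact: List.in_map.
have : artin0_word (gmul (ginv r) (proj1_sig (pick r))).
  by rewrite /pick; case: pselect => [h'|[]]; [apply: projT2 (cid h')|exists x].
rewrite /trace /artin0_word /= => h2; have h0 := artin0_subgrp hm.
have := subgrpM h0 (subgrpV h0 h2) h.
by rewrite !pcl_mul !pcl_inv invgM invgK -mulgA mulVKg.
Qed.

Let hI := is_subgroupI hH artin0_word_subgroup.

(** Largeness concerns a subgroup of the group carried by [H], whereas the alternative concerns the
    intersection inside the whole group; this map passes between the two subtypes. *)
Definition trace_to_meet (x : sub_sgroup trace_subgroup) : sub_sgroup hI :=
  exist _ (proj1_sig (proj1_sig x)) (conj (proj2_sig (proj1_sig x)) (proj2_sig x)).

Lemma large_of_surjection (f : sub_sgroup hI -> free_group bool) :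
  is_hom f -> hom_surjective f -> is_large (sub_sgroup hH).
Proof.
move=> [f1 f2] sur; exists trace, trace_subgroup; split; first exact: trace_finite_index.
exists (fun x => f (trace_to_meet x)); split.
  split=> [x y e|x y]; first exact: f1.
  apply: geq_trans (f2 _ _); apply: f1; exact: geq_refl.
move=> w; have [[z [Hz z0]] e] := sur w.
by exists (exist _ (exist _ z Hz) z0).
Qed.

Lemma meet_descend a : descend (fun x => H x /\ artin0_word x) a <-> descend H a /\ artin0 a.
Proof. by rewrite /descend /artin0_word /pcl greprK. Qed.

Lemma virtually_abelian_of_abelian :
  abelian_on (descend (fun x => H x /\ artin0_word x)) -> is_virtually_abelian (sub_sgroup hH).
Proof.
move=> aH; exists trace, trace_subgroup; split; first exact: trace_finite_index.
move=> [[x Hx] x0] [[y Hy] y0]; apply/pclP; rewrite !pcl_cat.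
by apply: aH; apply/(descendE hI).
Qed.

Lemma meet_alternative :
  abelian_on (descend (fun x => H x /\ artin0_word x)) \/
  good (descend (fun x => H x /\ artin0_word x)).
Proof.
apply: (@artin_alternative _ _ hm setT _ (descend_subgrp hI)) => [h _|h /meet_descend[]//].
exact: retT.
Qed.

Lemma abelian_meet_embeds :
  abelian_on (descend (fun x => H x /\ artin0_word x)) ->
  exists s t : nat, (s + 2 * t <= #|V|)%N /\
    exists f : sub_sgroup hH -> ZK_group s t, is_hom f /\ hom_injective f.
Proof.
move=> aH; have hD := descend_subgrp hH; apply: (@ZK_embeds_setoid _ hH); rewrite -cardsT.
apply: (artin_ZK_embeds hm hD) => [h _|]; first exact: retT.
(* Every half-label divides [k], so [k]-th powers satisfy all congruences and those of elements of
   [H] commute. *)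
pose k := (\prod_(e : V * V | m e.1 e.2 != 0%N) (m e.1 e.2)./2)%N.
have Xk (h : artin m) : artin0 (h ^+ k).
  move=> x y xy _; rewrite (morphgX (expoM hm x)) expg_mint dvdz_mull //.
  by rewrite /k (bigD1 (x, y)) /=; [rewrite PoszM dvdz_mulr|apply/eqP].
exists k; first by apply: prodn_cond_gt0 => e /eqP; apply: half_label_gt0.
by move=> g h Hg Hh; apply: aH; apply/meet_descend; split=> //; apply: subgrpX.
Qed.

End FiniteIndex.
End Transfer.

Local Close Scope group_scope.

Theorem theorem1p1 (V : finType) (m : V -> V -> nat) (hm : is_EAFC m) :
  exists (G0 : artin_group m -> Prop) (hG0 : is_subgroup (artin_group m) G0),
    is_normal (artin_group m) G0 /\
    index_le (artin_group m) G0 (edge_half_prod m) /\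
    (forall (H : artin_group m -> Prop) (hH : is_subgroup (artin_group m) H),
       ((exists s t : nat, s + 2 * t <= #|V| /\
           exists f : sub_sgroup hH -> ZK_group s t,
             is_hom f /\ hom_injective f) /\
        is_free_abelian (sub_sgroup (is_subgroupI hH hG0)))
       \/
       (exists (X : Type) (x1 x2 : X), x1 <> x2 /\
          exists f : sub_sgroup (is_subgroupI hH hG0) -> free_group X,
            is_hom f /\ hom_surjective f)) /\
    (forall (H : artin_group m -> Prop) (hH : is_subgroup (artin_group m) H),
       is_large (sub_sgroup hH) \/ is_virtually_abelian (sub_sgroup hH)).
Proof.
exists (@artin0_word V m), (artin0_word_subgroup hm).
split; first exact: artin0_word_normal.
split; first exact: artin0_word_index.
split=> H hH; have [aH|gd] := meet_alternative hm hH.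
- left; split; first exact: abelian_meet_embeds.
  exact: free_abelian_setoid.
- right; exists bool, true, false; split=> //; exact: good_setoid.
- by right; apply: virtually_abelian_of_abelian.
- have [f [hf sur]] := good_setoid (is_subgroupI hH (artin0_word_subgroup hm)) gd.
  by left; apply: large_of_surjection hf sur.
Qed.
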